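(* Let $\mathcal A^{\mathfrak f}=\mathcal Z^{\mathfrak f}/(\zeta^{\mathfrak f}(2))$ with projection $\alpha:\mathcal Z^{\mathfrak f}\to\mathcal A^{\mathfrak f}$. Then: (i) the rule $\Delta(a)=(\alpha\circ\zeta^{\mathfrak f}\otimes\alpha\circ\zeta^{\mathfrak f})(\Delta_{\mathrm{Gon}}(w))$, for any $w\in\mathbb Q\langle\mathcal X\rangle$ with $\alpha(\zeta^{\mathfrak f}(w))=a$, gives a well-defined coproduct making $(\mathcal A^{\mathfrak f},\cdot,\Delta)$ a weight-graded commutative Hopf algebra; (ii) the rule $\Delta_{\mathrm{Gon}}(\xi)=(\alpha\circ\zeta^{\mathfrak f}\otimes\zeta^{\mathfrak f})(\Delta_{\mathrm{Gon}}(w))$, for any $w\in\mathbb Q\langle\mathcal X\rangle$ with $\zeta^{\mathfrak f}(w)=\xi$, is independent of the choice of the lift $w$ and defines an algebra morphism $\mathcal Z^{\mathfrak f}\to\mathcal A^{\mathfrak f}\otimes\mathcal Z^{\mathfrak f}$ which is a coassociative and counital coaction of the Hopf algebra in (i) on $\mathcal Z^{\mathfrak f}$.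
   Context: Let $\mathcal X=\{x_0,x_1\}$, $\mathbb Q\langle\mathcal X\rangle$ the free noncommutative polynomial algebra (monomials are words, $\mathbf 1$ the empty word), graded by weight = number of letters. The shuffle product $ш$ is given by $\mathbf 1 ш w=w ш \mathbf 1=w$ and $au ш bv=a(u ш bv)+b(au ш v)$ for letters $a,b$ and words $u,v$. Let $\mathcal Y=\{y_1,y_2,\dots\}$ and let $*$ (stuffle) on $\mathbb Q\langle\mathcal Y\rangle$ be given by $\mathbf 1*w=w*\mathbf 1=w$, $y_iu*y_jv=y_i(u*y_jv)+y_j(y_iu*v)+y_{i+j}(u*v)$. Let $\iota:\mathbb Q\langle\mathcal Y\rangle\to\mathbb Q\langle\mathcal X\rangle$, $y_{k_1}\cdots y_{k_d}\mapsto x_0^{k_1-1}x_1\cdots x_0^{k_d-1}x_1$, $\mathfrak h^0=\mathbb Q\mathbf 1+x_0\mathbb Q\langle\mathcal X\rangle x_1$, $\mathfrak h^1=\mathbb Q\mathbf 1+\mathbb Q\langle\mathcal X\rangle x_1$. The algebra of formal multiple zeta values is $\mathcal Z^{\mathfrak f}=(\mathbb Q\langle\mathcal X\rangle,ш)/R$, where $R$ is the ideal generated by $x_0$, $x_1$ and all $u ш v-\iota(\iota^{-1}(u)*\iota^{-1}(v))$ with $u\in\mathfrak h^0$, $v\in\mathfrak h^1$; $\zeta^{\mathfrak f}(w)$ denotes the class of $w$, and $\zeta^{\mathfrak f}(k_1,\dots,k_d)=\zeta^{\mathfrak f}(x_0^{k_1-1}x_1\cdots x_0^{k_d-1}x_1)$.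 $\mathcal Z^{\mathfrak f}$ is graded by weight. For letters $\varepsilon_a,\varepsilon_b\in\mathcal X$ and $f\in\mathbb Q\langle\mathcal X\rangle$ put $I(\varepsilon_a;f;\varepsilon_b)=f$ if $(\varepsilon_a,\varepsilon_b)=(x_1,x_0)$, $=S(f)$ if $(\varepsilon_a,\varepsilon_b)=(x_0,x_1)$, and $=c_{\mathbf 1}(f)\mathbf 1$ if $\varepsilon_a=\varepsilon_b$, where $c_{\mathbf 1}(f)$ is the coefficient of the empty word and $S(\varepsilon_1\cdots\varepsilon_n)=(-1)^n\varepsilon_n\cdots\varepsilon_1$. The Goncharov coproduct $\Delta_{\mathrm{Gon}}:\mathbb Q\langle\mathcal X\rangle\to\mathbb Q\langle\mathcal X\rangle\otimes\mathbb Q\langle\mathcal X\rangle$ is the linear map $\Delta_{\mathrm{Gon}}(\varepsilon_1\cdots\varepsilon_n)=\sum_{k=0}^n\sum_{0<i_1<\dots<i_k<n+1}\Big(\mathop{ш}_{p=0}^{k} I(\varepsilon_{i_p};\varepsilon_{i_p+1}\cdots\varepsilon_{i_{p+1}-1};\varepsilon_{i_{p+1}})\Big)\otimes\varepsilon_{i_1}\cdots\varepsilon_{i_k}$, with $i_0=0$, $i_{k+1}=n+1$, $\varepsilon_0=x_1$, $\varepsilon_{n+1}=x_0$ (and $ш$-product of the factors). *)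

(* Defs.v *)
From HB Require Import structures.
From mathcomp Require Import all_boot all_order all_algebra.
From mathcomp Require Import finmap.
From mathcomp.multinomials Require Import monalg.

Set Implicit Arguments.
Unset Strict Implicit.
Unset Printing Implicit Defensive.

Import GRing.Theory.
Local Open Scope ring_scope.

Definition letter := bool.
Definition x0 : letter := false.
Definition x1 : letter := true.
Definition word := seq letter.

(* Q<X> : the free Q-vector space on words (finitely supported
   functions word -> rat); Q<X> (x) Q<X> : free Q-vector space on pairs
   of words; Q<X>^{(x)3} : free Q-vector space on triples of words.     *)
Definition QX := {malg rat[word]}.
Definition QX2 := {malg rat[(word * word)%type]}.
Definition QX3 := {malg rat[(word * word * word)%type]}.
(* Q<Y> : free Q-vector space on words in Y (y_k encoded by k : nat). *)
Definition QY := {malg rat[seq nat]}.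

Definition linext (K : choiceType) (V : lmodType rat)
  (f : K -> V) (g : {malg rat[K]}) : V :=
  \sum_(k <- msupp g) g@_k *: f k.

Definition bilext (K1 K2 : choiceType) (V : lmodType rat)
  (f : K1 -> K2 -> V) (g : {malg rat[K1]}) (h : {malg rat[K2]}) : V :=
  \sum_(k <- msupp g) \sum_(l <- msupp h) (g@_k * h@_l) *: f k l.

Definition unitX : QX := << [::] >>.

Definition lcons (a : letter) (p : QX) : QX := linext (fun w => << a :: w >>) p.

Fixpoint shw (u : word) : word -> QX :=
  match u with
  | [::] => fun v => << v >>
  | a :: u' =>
      fix shv (v : word) : QX :=
        match v with
        | [::] => << a :: u' >>
        | b :: v' => lcons a (shw u' v) + lcons b (shv v')
        end
  end.

Definition sh (p q : QX) : QX := bilext shw p q.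

Definition lconsY (k : nat) (p : QY) : QY := linext (fun w => << k :: w >>) p.

Fixpoint stw (u : seq nat) : seq nat -> QY :=
  match u with
  | [::] => fun v => << v >>
  | i :: u' =>
      fix stv (v : seq nat) : QY :=
        match v with
        | [::] => << i :: u' >>
        | j :: v' => lconsY i (stw u' v) + lconsY j (stv v')
                     + lconsY (i + j)%N (stw u' v')
        end
  end.

Definition st (p q : QY) : QY := bilext stw p q.

Definition iota_word (s : seq nat) : word :=
  flatten [seq rcons (nseq k.-1 x0) x1 | k <- s].
Definition iotaL (p : QY) : QX := linext (fun s => << iota_word s >>) p.

(* inverse of iota on words of h^1 (empty or ending with x1); the value on
   other words is irrelevant since iotainvL is only applied to h^1 *)
Fixpoint iinv_aux (cnt : nat) (w : word) : seq nat :=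
  match w with
  | [::] => [::]
  | a :: w' => if a == x1 then cnt.+1 :: iinv_aux 0 w' else iinv_aux cnt.+1 w'
  end.
Definition iotainvL (p : QX) : QY := linext (fun w => << iinv_aux 0 w >>) p.

Definition in_h0 (p : QX) : Prop :=
  forall w, w \in msupp p -> (w == [::]) || ((head x1 w == x0) && (last x0 w == x1)).
Definition in_h1 (p : QX) : Prop :=
  forall w, w \in msupp p -> (w == [::]) || (last x0 w == x1).

Inductive in_ideal (G : QX -> Prop) : QX -> Prop :=
  | ideal_0 : in_ideal G 0
  | ideal_gen g : G g -> in_ideal G g
  | ideal_add a b : in_ideal G a -> in_ideal G b -> in_ideal G (a + b)
  | ideal_mul p a : in_ideal G a -> in_ideal G (sh p a).

Definition Rgen (g : QX) : Prop :=
  g = << [:: x0] >> \/ g = << [:: x1] >> \/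
  exists u v, in_h0 u /\ in_h1 v /\ g = sh u v - iotaL (st (iotainvL u) (iotainvL v)).

(* R = kernel of zeta^f : Q<X> -> Z^f *)
Definition Rf : QX -> Prop := in_ideal Rgen.

Definition zeta2_word : word := [:: x0; x1].

(* kernel of alpha o zeta^f : Q<X> -> A^f = Z^f / (zeta^f(2)),
   i.e. the ideal generated by R and x0 x1 *)
Definition RA : QX -> Prop := in_ideal (fun g => Rgen g \/ g = << zeta2_word >>).

Inductive in_span (V : lmodType rat) (S : V -> Prop) : V -> Prop :=
  | span_0 : in_span S 0
  | span_gen v : S v -> in_span S v
  | span_add a b : in_span S a -> in_span S b -> in_span S (a + b)
  | span_scale (c : rat) a : in_span S a -> in_span S (c *: a).

Definition tens (p q : QX) : QX2 := bilext (fun u v => << (u, v) >>) p q.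
Definition tens3 (p q r : QX) : QX3 :=
  bilext (fun (uv : word * word) w => << (uv.1, uv.2, w) >>) (tens p q) r.

(* kernel of f (x) g : Q<X>(x)Q<X> -> (Q<X>/K1) (x) (Q<X>/K2) *)
Definition ker2 (K1 K2 : QX -> Prop) : QX2 -> Prop :=
  in_span (fun t => exists a b, (K1 a \/ K2 b) /\ t = tens a b).
Definition ker3 (K1 K2 K3 : QX -> Prop) : QX3 -> Prop :=
  in_span (fun t => exists a b c, (K1 a \/ K2 b \/ K3 c) /\ t = tens3 a b c).

Definition sh2 (s t : QX2) : QX2 :=
  bilext (fun (uv u'v' : word * word) => tens (shw uv.1 u'v'.1) (shw uv.2 u'v'.2)) s t.

Definition Iw (ea : letter) (f : word) (eb : letter) : QX :=
  if (ea == x1) && (eb == x0) then << f >>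
  else if (ea == x0) && (eb == x1) then (-1) ^+ size f *: << rev f >>
  else if ea == eb then (if f == [::] then unitX else 0)
  else 0.

(* Given the letters eps_1 .. eps_{n+1} (with eps_{n+1} = x0 appended) and
   the selection mask (with position n+1 selected), starting from the
   previously selected letter a (initially eps_0 = x1), list the triples
   (eps_{i_p}, eps_{i_p+1} ... eps_{i_{p+1}-1}, eps_{i_{p+1}}), p = 0..k. *)
Fixpoint gaps (a : letter) (acc : word) (xs : word) (bs : bitseq)
  : seq (letter * word * letter) :=
  match xs, bs with
  | x :: xs', b :: bs' =>
      if b then (a, acc, x) :: gaps x [::] xs' bs'
      else gaps a (rcons acc x) xs' bs'
  | _, _ => [::]
  end.

Definition DGon_word (w : word) : QX2 :=
  \sum_(m : (size w).-tuple bool)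
    tens (foldr sh unitX
            [seq Iw t.1.1 t.1.2 t.2 | t <- gaps x1 [::] (rcons w x0) (rcons m true)])
         << mask m w >>.

Definition DGon (p : QX) : QX2 := linext DGon_word p.

Definition DGon_id (t : QX2) : QX3 :=
  linext (fun uv : word * word =>
    bilext (fun (ab : word * word) c => << (ab.1, ab.2, c) >>)
           (DGon << uv.1 >>) << uv.2 >>) t.
Definition id_DGon (t : QX2) : QX3 :=
  linext (fun uv : word * word =>
    bilext (fun a (bc : word * word) => << (a, bc.1, bc.2) >>)
           << uv.1 >> (DGon << uv.2 >>)) t.

Definition hcomp (n : nat) (p : QX) : QX :=
  \sum_(w <- msupp p | size w == n) p@_w *: << w >>.

Definition linform (e : word -> rat) (p : QX) : rat :=
  \sum_(w <- msupp p) p@_w * e w.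

Definition form_id (e : word -> rat) (t : QX2) : QX :=
  linext (fun uv : word * word => e uv.1 *: << uv.2 >>) t.
Definition id_form (e : word -> rat) (t : QX2) : QX :=
  linext (fun uv : word * word => e uv.2 *: << uv.1 >>) t.

Definition mul_s_id (s : word -> QX) (t : QX2) : QX :=
  linext (fun uv : word * word => sh (s uv.1) << uv.2 >>) t.
Definition mul_id_s (s : word -> QX) (t : QX2) : QX :=
  linext (fun uv : word * word => sh << uv.1 >> (s uv.2)) t.

(* Main.v *)
Require Import Defs.
From HB Require Import structures.
From mathcomp Require Import all_boot all_order all_algebra.
From mathcomp Require Import finmap boolp ring zify.
From mathcomp.multinomials Require Import monalg.
Import GRing.Theory.
Local Open Scope ring_scope.

Set Implicit Arguments.
Unset Strict Implicit.
Unset Printing Implicit Defensive.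

(** Linear functionals on Q<X> are noncommutative power series.  Pairing the
    Goncharov coproduct with a shuffle character Phi on the left and a series
    Psi on the right gives Phi * Psi := b(Psi) Phi, where b is the substitution
    x_0 -> Phi x_0 Phi^-1, x_1 -> x_1.  Evaluating at the universal characters of
    quotients of Q<X>^{(x)3}, multiplicativity of the coproduct says that * of
    two characters is a character and coassociativity says that * is
    associative, while well-definedness becomes Racinet's theorem: the double
    shuffle equations, together with the vanishing of the coefficient of x_0 x_1
    in Phi, are stable under *.

    For the latter, multiply Phi by the series Gamma in x_1 making
    F := Gamma Phi a stuffle character after projection to words in Y.  A
    generating function argument with the derivation y_n -> n y_(n+1), coming
    from multiplication by x_0 on the right, shows first, using
    zeta(2) = 0, that F^-1 is the shuffle antipode of F, and then that the
    projections L_m of F x_0^(m-1) F^-1 x_1 form the coefficients of a stuffle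
    grouplike series.  So y_m -> L_m respects the stuffle coproduct; on the
    other side it is the substitution b conjugated by Gamma.

    The antipode is the geometric series sum_k (-1)^k (id - eps)^k for the
    convolution product; it preserves the ideal because every term does. *)

(** * Noncommutative formal power series *)

(** Let S be the shuffle antipode and E := Gamma S(Gamma). Since Phi is a shuffle character, F S(F)
    = E, so F^-1 = S(F) amounts to E = 1. The relation y_1 * y_1 = 2 y_1 y_1 + y_2 gives E(x_1^2) =
    -Phi(x_0 x_1), which is where zeta(2) = 0 enters; once this coefficient vanishes, the stuffle
    relations force the others to vanish. Classically this is the reflection formula, which
    expresses Gamma(1+s) Gamma(1-s) through zeta(2). Only the left series Phi is inverted, so only
    it has to satisfy zeta(2) = 0: hence A^f on the left of the coaction and all of Z^f on the
    right.

    The obstacle is that substitutions, coproducts and their tensor squares are infinite sums over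
    letters. One principle governs them: such a map Z satisfies Z(P) = P(1) + sum_i M_i Z(a_i^-1 P)
    modulo every step of a filtration, the M_i raise the filtration, and therefore at most one map
    satisfies the equation. *)

Definition series (T : Type) (R : Type) := seq T -> R.

HB.instance Definition _ (T R : Type) := gen_eqMixin (series T R).
HB.instance Definition _ (T R : Type) := gen_choiceMixin (series T R).

Definition lq (T R : Type) (a : T) (f : series T R) : series T R :=
  fun w => f (a :: w).

Definition addser (T : Type) (V : zmodType) (f g : series T V) : series T V :=
  fun w => f w + g w.
Definition oppser (T : Type) (V : zmodType) (f : series T V) : series T V :=
  fun w => - f w.
Definition zeroser (T : Type) (V : zmodType) : series T V := fun=> 0.

Section SeriesZmod.
Variables (T : Type) (V : zmodType).

Fact addserA : associative (@addser T V).
Proof. by move=> f g h; apply/funext => w; rewrite /addser addrA. Qed.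
Fact addserC : commutative (@addser T V).
Proof. by move=> f g; apply/funext => w; rewrite /addser addrC. Qed.
Fact add0ser : left_id (@zeroser T V) (@addser T V).
Proof. by move=> f; apply/funext => w; rewrite /addser /zeroser add0r. Qed.
Fact addNser : left_inverse (@zeroser T V) (@oppser T V) (@addser T V).
Proof. by move=> f; apply/funext => w; rewrite /addser /oppser addNr. Qed.

HB.instance Definition _ :=
  GRing.isZmodule.Build (series T V) addserA addserC add0ser addNser.

Lemma serD (f g : series T V) w : (f + g) w = f w + g w. Proof. by []. Qed.
Lemma serN (f : series T V) w : (- f) w = - f w. Proof. by []. Qed.
Lemma serB (f g : series T V) w : (f - g) w = f w - g w. Proof. by []. Qed.
Lemma ser0 w : (0 : series T V) w = 0. Proof. by []. Qed.

Lemma ser_sum I (r : seq I) (P : pred I) (F : I -> series T V) w :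
  (\sum_(i <- r | P i) F i) w = \sum_(i <- r | P i) F i w.
Proof. by elim/big_rec2: _ => // i y x Pi <-. Qed.

Lemma serMn (f : series T V) n w : (f *+ n) w = f w *+ n.
Proof. by elim: n => [|n IH]; rewrite ?mulr0n // !mulrS serD IH. Qed.

End SeriesZmod.

Section SeriesRing.
Variables (T : eqType) (R : pzRingType).
Implicit Types (f g h : series T R).

(** The concatenation product, that is the sum of f(u) g(v) over the cuts w = u v, organised by
    first letters so that it fits the recursions on [lq]. *)
Fixpoint conv (f g : series T R) (w : seq T) : R :=
  if w is a :: w' then f [::] * g w + conv (lq a f) g w' else f [::] * g [::].

Definition cst (c : R) : series T R := fun w => if w is [::] then c else 0.

Lemma conv_ext f f' g g' w :
  (forall u, size u <= size w -> f u = f' u)%N ->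
  (forall u, size u <= size w -> g u = g' u)%N -> conv f g w = conv f' g' w.
Proof.
elim: w f f' => [|a w IH] f f' Hf Hg /=; first by rewrite Hf // Hg.
by rewrite Hf // Hg // (IH _ (lq a f')) // => u Hu; [apply: Hf|apply/Hg/leqW].
Qed.

Lemma convDl f f' g w : conv (fun u => f u + f' u) g w = conv f g w + conv f' g w.
Proof. by elim: w f f' => [|a w IH] f f' /=; rewrite mulrDl // IH addrACA. Qed.

Lemma convDr f g g' w : conv f (fun u => g u + g' u) w = conv f g w + conv f g' w.
Proof. by elim: w f => [|a w IH] f /=; rewrite mulrDr // IH addrACA. Qed.

Lemma convZl c f g w : conv (fun u => c * f u) g w = c * conv f g w.
Proof. by elim: w f => [|a w IH] f /=; rewrite ?mulrDr -?mulrA // IH. Qed.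

Lemma conv0l g w : conv (fun=> 0) g w = 0.
Proof. by elim: w => [|a w IH] /=; rewrite mul0r // IH addr0. Qed.

Lemma convA f g h w : conv f (conv g h) w = conv (conv f g) h w.
Proof.
elim: w f => [|a w IH] f /=; first by rewrite mulrA.
rewrite {}IH mulrDr mulrA -addrA; congr (_ + _).
by rewrite /lq /= convDl convZl.
Qed.

Lemma conv_cstl c g w : conv (cst c) g w = c * g w.
Proof. by case: w => [|a w] //=; rewrite /lq /= conv0l addr0. Qed.

Lemma conv_cstr f c w : conv f (cst c) w = f w * c.
Proof. by elim: w f => [|a w IH] f //=; rewrite IH mulr0 add0r. Qed.

Fact serMA : associative (conv : series T R -> series T R -> series T R).
Proof. by move=> f g h; apply/funext => w; rewrite convA. Qed.
Fact ser1M : left_id (cst 1) (conv : series T R -> series T R -> series T R).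
Proof. by move=> f; apply/funext => w; rewrite conv_cstl mul1r. Qed.
Fact serM1 : right_id (cst 1) (conv : series T R -> series T R -> series T R).
Proof. by move=> f; apply/funext => w; rewrite conv_cstr mulr1. Qed.
Fact serDM : left_distributive (conv : series T R -> series T R -> series T R) +%R.
Proof. by move=> f g h; apply/funext => w; rewrite convDl. Qed.
Fact serMD : right_distributive (conv : series T R -> series T R -> series T R) +%R.
Proof. by move=> f g h; apply/funext => w; rewrite convDr. Qed.

HB.instance Definition _ :=
  GRing.Zmodule_isPzRing.Build (series T R) serMA ser1M serM1 serDM serMD.

Lemma serME f g w : (f * g) w = conv f g w. Proof. by []. Qed.
Lemma serM_nil f g : (f * g) [::] = f [::] * g [::]. Proof. by []. Qed.
Lemma serM_cons f g a w : (f * g) (a :: w) = f [::] * g (a :: w) + (lq a f * g : series T R) w.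
Proof. by []. Qed.
Lemma cstM_E c f w : (cst c * f) w = c * f w. Proof. exact: conv_cstl. Qed.
Lemma Mcst_E c f w : (f * cst c) w = f w * c. Proof. exact: conv_cstr. Qed.
Lemma lqM f g a : lq a (f * g) = cst (f [::]) * lq a g + lq a f * g :> series T R.
Proof. by apply/funext => w; rewrite serD cstM_E. Qed.
Lemma ser1E w : (1 : series T R) w = (w == [::])%:R. Proof. by case: w. Qed.

Fact cst_is_additive : {morph cst : x y / x - y}.
Proof. by move=> x y; apply/funext => -[|a w] //=; rewrite serB /= subrr. Qed.
Fact cst_is_multiplicative : GRing.monoid_morphism (cst : R -> series T R).
Proof. by split=> // x y; apply/funext => w; rewrite cstM_E; case: w => //= a w; rewrite mulr0. Qed.
HB.instance Definition _ := GRing.isZmodMorphism.Build R (series T R) cst cst_is_additive.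
HB.instance Definition _ := GRing.isMonoidMorphism.Build R (series T R) cst cst_is_multiplicative.

Definition let_ (a : T) : series T R := fun w => (w == [:: a])%:R.

Lemma let_nil a : let_ a [::] = 0. Proof. by []. Qed.
Lemma lq_let a b : lq b (let_ a) = (if b == a then 1 else 0) :> series T R.
Proof.
apply/funext => w; rewrite /lq /let_ eqseq_cons.
by case: eqP => _ //=; rewrite ser1E.
Qed.
Lemma letM_nil a f : (let_ a * f) [::] = 0. Proof. by rewrite serM_nil let_nil mul0r. Qed.
Lemma letM_cons a f b w : (let_ a * f) (b :: w) = if b == a then f w else 0.
Proof.
rewrite serM_cons let_nil mul0r add0r lq_let.
by case: eqP => _; rewrite ?mul1r ?mul0r.
Qed.

Lemma serM_rcons f g w a :
  (f * g) (rcons w a) = f (rcons w a) * g [::] + (f * (fun u => g (rcons u a)) : series T R) w.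
Proof.
elim: w f => [|b w IH] f /=.
  by rewrite serM_cons addrC !serM_nil.
by rewrite serM_cons [in RHS]serM_cons IH /lq /= addrCA.
Qed.

Lemma Mlet_nil a f : (f * let_ a) [::] = 0. Proof. by rewrite serM_nil let_nil mulr0. Qed.
Lemma Mlet_rcons a f b w : (f * let_ a) (rcons w b) = if b == a then f w else 0.
Proof.
rewrite serM_rcons let_nil mulr0 add0r.
have -> : (fun u => let_ a (rcons u b)) = (if b == a then 1 else 0) :> series T R.
  apply/funext => u; rewrite /let_ -[[:: a]]/(rcons [::] a) eqseq_rcons.
  by case: (b == a); rewrite ?andbT ?andbF // ser1E.
by case: eqP => _; rewrite ?mulr1 ?mulr0.
Qed.

(** Induction on the length: in (f * g)(w) the value g(w) meets only the constant term of f, and the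
    other terms involve g at shorter words. *)
Lemma ser_nonzerodiv f g : f [::] = 1 -> f * g = 0 -> g = 0.
Proof.
move=> f1 fg0; apply/funext => w; rewrite ser0.
have [n] := ubnP (size w); elim: n w => // n IH w lt_w_n.
have := congr1 (fun h : series T R => h w) fg0; rewrite ser0.
case: w lt_w_n => [|a w] lt_w_n; first by rewrite serM_nil f1 mul1r.
rewrite serM_cons f1 mul1r => <-; rewrite -[LHS]addr0; congr (_ + _).
apply/esym; rewrite serME (@conv_ext _ (lq a f) _ (fun=> 0)) //.
  by elim: w {lt_w_n} (lq a f) => [|b w IHw] h /=; rewrite mulr0 // add0r IHw.
by move=> u le_u; apply: IH; apply: leq_ltn_trans le_u _.
Qed.

Lemma expr_ser_eq0 f k w : f [::] = 0 -> (size w < k)%N -> (f ^+ k) w = 0.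
Proof.
move=> f0; elim: k w => // k IH [|a w] lt_w_k; rewrite exprS.
  by rewrite serM_nil f0 mul0r.
rewrite serM_cons f0 mul0r add0r serME (@conv_ext _ (lq a f) _ (fun=> 0)) //.
  by elim: w {lt_w_k} (lq a f) => [|b w IHw] h /=; rewrite mulr0 // add0r IHw.
by move=> u le_u; rewrite IH //; move: lt_w_k => /=; lia.
Qed.

(** The geometric series in 1 - f: at a word of length n only its first n + 1 terms count, so the
    inverse is read off from partial sums. *)
Lemma ser_inv_exists f : f [::] = 1 -> exists g, f * g = 1.
Proof.
move=> f1; pose h := 1 - f.
have h0 : h [::] = 0 by rewrite /h serB f1 ser1E subrr.
pose G n : series T R := \sum_(k < n) h ^+ k.
have GE n w : (size w < n)%N -> G n w = G (size w).+1 w.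
  elim: n => // n IH; rewrite ltnS leq_eqVlt => /predU1P[-> //|lt_w_n].
  by rewrite -IH // /G big_ord_recr /= serD expr_ser_eq0 ?addr0.
exists (fun w => G (size w).+1 w); apply/funext => w.
rewrite serME (@conv_ext f f _ (G (size w).+1)) //; last first.
  by move=> u le_u; rewrite [RHS]GE.
have -> : conv f (G (size w).+1) w = (f * G (size w).+1) w by [].
have -> : f * G (size w).+1 = 1 - h ^+ (size w).+1.
  have -> : f = - (h - 1) by rewrite /h opprB subKr.
  by rewrite mulNr -subrX1 opprB.
by rewrite serB expr_ser_eq0 ?subr0.
Qed.
End SeriesRing.

(** * Filtrations and substitution *)

(** Equalities are proved modulo every step and concluded by [Fil_sep]. The notion is abstract
    because it is iterated: series with coefficients in series are filtered by total weight. *)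
Record filtration (R : pzRingType) := Filtration {
  Fil :> nat -> R -> Prop;
  Fil_0 : forall x, Fil 0 x;
  Fil_zero : forall n, Fil n 0;
  FilB : forall n x y, Fil n x -> Fil n y -> Fil n (x - y);
  FilS : forall n x, Fil n.+1 x -> Fil n x;
  FilM : forall m n x y, Fil m x -> Fil n y -> Fil (m + n) (x * y);
  Fil_sep : forall x, (forall n, Fil n x) -> x = 0 }.

Section FiltrationTheory.
Variables (R : pzRingType) (F : filtration R).

Lemma FilN n x : F n x -> F n (- x).
Proof. by move=> Fx; rewrite -sub0r; apply: FilB => //; apply: Fil_zero. Qed.

Lemma FilD n x y : F n x -> F n y -> F n (x + y).
Proof. by move=> Fx Fy; rewrite -[y]opprK; apply/FilB/FilN. Qed.

Lemma Fil_le m n x : (m <= n)%N -> F n x -> F m x.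
Proof. by move=> /subnK <-; elim: (n - m)%N => // k IH /FilS. Qed.

Lemma FilMr n x y : F n y -> F n (x * y).
Proof. by move=> Fy; rewrite -[n]add0n; apply: FilM Fy; apply: Fil_0. Qed.

Lemma FilMl n x y : F n x -> F n (x * y).
Proof. by move=> Fx; rewrite -[n]addn0; apply: FilM => //; apply: Fil_0. Qed.

Lemma Fil_sum n I (r : seq I) (P : pred I) (E : I -> R) :
  (forall i, P i -> F n (E i)) -> F n (\sum_(i <- r | P i) E i).
Proof.
by move=> FE; elim/big_rec: _ => [|i x Pi Fx]; [apply: Fil_zero|apply: FilD; auto].
Qed.

Lemma Fil_trans n y x z : F n (x - y) -> F n (y - z) -> F n (x - z).
Proof. by move=> Fxy Fyz; rewrite -(subrKA y x (- z)); apply: FilD. Qed.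

Lemma Fil_sym n x y : F n (x - y) -> F n (y - x).
Proof. by move/FilN; rewrite opprB. Qed.

Lemma FilB2 n x x' y y' : F n (x - x') -> F n (y - y') -> F n (x - y - (x' - y')).
Proof.
move=> Fx Fy; have -> : x - y - (x' - y') = x - x' - (y - y').
  by rewrite !opprB addrACA [RHS]addrACA [- y + _]addrC.
exact: FilB.
Qed.

Lemma Fil_eq x y : (forall n, F n (x - y)) -> x = y.
Proof. by move/Fil_sep/subr0_eq. Qed.

End FiltrationTheory.

Section TrivialFiltration.
Variable R : pzRingType.
Let Tr n (x : R) := n = 0%N \/ x = 0.
Fact triv_0 x : Tr 0 x. Proof. by left. Qed.
Fact triv_zero n : Tr n 0. Proof. by right. Qed.
Fact trivB n x y : Tr n x -> Tr n y -> Tr n (x - y).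
Proof. by case=> [|->]; [left|case=> [|->]; [left|right; rewrite subrr]]. Qed.
Fact trivS n x : Tr n.+1 x -> Tr n x. Proof. by case=> // ->; right. Qed.
Fact trivM m n x y : Tr m x -> Tr n y -> Tr (m + n) (x * y).
Proof.
case=> [->|->]; last by right; rewrite mul0r.
by case=> [->|->]; [left|right; rewrite mulr0].
Qed.
Fact triv_sep x : (forall n, Tr n x) -> x = 0. Proof. by case/(_ 1%N). Qed.
Definition trivF := Filtration triv_0 triv_zero trivB trivS trivM triv_sep.
End TrivialFiltration.
Arguments trivF {R}.

(* The quasi-shuffle product on words over such an alphabet merges two letters
   with [op] when [merge] is set, and is the plain shuffle product otherwise. *)
Record alphabet := Alphabet {
  letters :> eqType;
  wt : letters -> nat;
  lw : nat -> seq letters;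
  op : letters -> letters -> letters;
  merge : bool;
  wt_gt0 : forall a, (0 < wt a)%N;
  lw_uniq : forall n, uniq (lw n);
  mem_lw : forall n a, (a \in lw n) = (wt a == n);
  op_assoc : associative op;
  op_comm : commutative op;
  wt_op : forall a b, merge -> wt (op a b) = (wt a + wt b)%N }.

Section Weight.
Variable A : alphabet.

Definition wtw (w : seq A) : nat := sumn [seq wt a | a <- w].

Lemma wtw_cons a w : wtw (a :: w) = (wt a + wtw w)%N. Proof. by []. Qed.

Lemma wtw_eq0 w : (wtw w == 0%N) = (w == [::]).
Proof. by case: w => //= a w; rewrite wtw_cons addn_eq0 -leqn0 leqNgt wt_gt0. Qed.

Fixpoint ls n : seq A := if n is m.+1 then ls m ++ lw A m else [::].

Lemma mem_ls n a : (a \in ls n) = (wt a < n)%N.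
Proof.
by elim: n => //= n IH; rewrite mem_cat IH mem_lw ltnS [RHS]leq_eqVlt orbC.
Qed.

Lemma ls_uniq n : uniq (ls n).
Proof.
elim: n => //= n IH; rewrite cat_uniq IH lw_uniq andbT /=.
by apply/hasPn => a; rewrite mem_lw mem_ls => /eqP->; rewrite ltnn.
Qed.

Lemma sum_ls_pick (V : nmodType) n b (E : A -> V) :
  (wt b < n)%N -> \sum_(a <- ls n) (if b == a then E a else 0) = E b.
Proof.
move=> lt_b; rewrite (bigD1_seq b) ?mem_ls ?ls_uniq //= eqxx big1 ?addr0 //.
by move=> a; rewrite eq_sym => /negPf->.
Qed.

Section SeriesFiltration.
Variables (R : pzRingType) (F : filtration R).
(** The weight of the word is added to the filtration of the coefficient. Truncated subtraction
    leaves words of weight at least n unconstrained; over [trivF], step n consists of the series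
    without terms of weight below n. *)
Let Sr n (f : series A R) := forall u, F (n - wtw u)%N (f u).
Fact serF_0 f : Sr 0 f. Proof. by move=> u; apply: Fil_0. Qed.
Fact serF_zero n : Sr n 0. Proof. by move=> u; apply: Fil_zero. Qed.
Fact serFB n f g : Sr n f -> Sr n g -> Sr n (f - g).
Proof. by move=> Ff Fg u; apply: FilB. Qed.
Fact serFS n f : Sr n.+1 f -> Sr n f.
Proof. by move=> Ff u; apply: Fil_le (Ff u); lia. Qed.
Fact serFM m n f g : Sr m f -> Sr n g -> Sr (m + n) (f * g).
Proof.
move=> Ff Fg u; elim: u m f Ff => [|a u IH] m f Ff.
  rewrite serM_nil; have := FilM (Ff [::]) (Fg [::]).
  by apply: Fil_le; rewrite !subn0.
rewrite serM_cons; apply: FilD.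
  have := FilM (Ff [::]) (Fg (a :: u)); apply: Fil_le.
  by move: (wtw _) => k; rewrite subn0; lia.
have Flq : Sr (m - wt a) (lq a f).
  by move=> v; have := Ff (a :: v); apply: Fil_le; rewrite wtw_cons; lia.
by apply: Fil_le (IH _ _ Flq); rewrite wtw_cons; lia.
Qed.
Fact serF_sep f : (forall n, Sr n f) -> f = 0.
Proof.
move=> Ff; apply/funext => u; apply: (@Fil_sep _ F) => n.
by have := Ff (n + wtw u)%N u; rewrite addnK.
Qed.
Definition serF := Filtration serF_0 serF_zero serFB serFS serFM serF_sep.

Lemma serFP n f : serF n f <-> forall u, F (n - wtw u)%N (f u).
Proof. by []. Qed.

Lemma serF_lq n f a : serF n f -> serF (n - wt a)%N (lq a f).
Proof. by move=> Ff v; have := Ff (a :: v); apply: Fil_le; rewrite wtw_cons; lia. Qed.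

Lemma serF_cst n c : F n c -> serF n (cst c).
Proof. by move=> Fc [|a u] /=; [rewrite subn0|apply: Fil_zero]. Qed.

Lemma serF_let a : serF (wt a) (let_ R a).
Proof.
move=> u; rewrite /let_; case: eqP => [->|_]; last exact: Fil_zero.
by rewrite wtw_cons addn0 subnn; apply: Fil_0.
Qed.

End SeriesFiltration.

End Weight.

(** * Continuous maps determined by a recursion on first letters *)

Section RecursiveMaps.
Variables (A : alphabet) (R S : pzRingType) (F : filtration S) (k : {rmorphism R -> S}).
Variables (I : Type) (IN : nat -> seq I) (M : I -> S) (t : I -> A).
Hypothesis FM : forall i, F 1 (M i).
Hypothesis Mk : forall i c, M i * k c = k c * M i.

(* A map Z satisfying this equation to every order is the continuous extension
   of a prescription on letters; the index i runs over the monomials of the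
   images of the letters, [t i] being the letter concerned. *)
Definition recursive (Z : series A R -> S) := forall N P,
  F N (Z P - (k (P [::]) + \sum_(i <- IN N) M i * Z (lq (t i) P))).

Lemma Fil_step n x i : F n x -> F n.+1 (M i * x).
Proof. by move=> Fx; rewrite -add1n; apply: FilM. Qed.

(** Contraction: every M i lies in step 1, so two solutions that agree modulo step n agree modulo
    step n + 1. *)
Lemma recursive_uniq Z1 Z2 : recursive Z1 -> recursive Z2 -> Z1 =1 Z2.
Proof.
move=> r1 r2 P; apply: (@Fil_eq _ F) => n; elim: n P => [|n IH] P; first exact: Fil_0.
apply: Fil_trans (r1 _ _) _; apply: Fil_sym; apply: Fil_trans (r2 _ _) _.
rewrite opprD addrACA subrr add0r -sumrB; apply: Fil_sum => i _.
by rewrite -mulrBr; apply/Fil_step/Fil_sym.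
Qed.

Variable Z : series A R -> S.
Hypothesis rZ : recursive Z.

Lemma recursiveB P Q : Z (P - Q) = Z P - Z Q.
Proof.
apply: (@Fil_eq _ F) => n; elim: n P Q => [|n IH] P Q; first exact: Fil_0.
apply: Fil_trans (rZ _ _) _; apply: Fil_sym; apply: Fil_trans (FilB2 (rZ _ _) (rZ _ _)) _.
have subE (a b c d s : S) : a + b - (c + d) - (a - c + s) = b - d - s.
  by rewrite [- (c + d)]opprD [a + b + _]addrACA [- (_ + s)]opprD [LHS]addrACA subrr add0r.
rewrite serB rmorphB subE -!sumrB.
apply: Fil_sum => i _; rewrite -!mulrBr; apply/Fil_step/Fil_sym/IH.
Qed.

Lemma recursive0 : Z 0 = 0.
Proof. by rewrite -[0 in LHS](subrr 0) recursiveB subrr. Qed.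

Lemma recursiveD P Q : Z (P + Q) = Z P + Z Q.
Proof. by rewrite -[Q in LHS]opprK -[- Q]sub0r !recursiveB recursive0 sub0r opprK. Qed.

Lemma recursive_sum J (r : seq J) (E : J -> series A R) :
  Z (\sum_(j <- r) E j) = \sum_(j <- r) Z (E j).
Proof. by elim/big_rec2: _ => [|j y x _ <-]; rewrite ?recursive0 ?recursiveD. Qed.

Lemma recursive_cst c : Z (cst c) = k c.
Proof.
apply: (@Fil_eq _ F) => n; apply: Fil_trans (rZ _ _) _.
rewrite big1 ?addr0 ?subrr; first exact: Fil_zero.
by move=> i _; rewrite (_ : lq _ _ = 0) ?recursive0 ?mulr0.
Qed.

Lemma recursive1 : Z 1 = 1.
Proof. by rewrite -[1 in LHS]/(cst 1) recursive_cst rmorph1. Qed.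

Lemma recursiveZ c P : Z (cst c * P) = k c * Z P.
Proof.
apply: (@Fil_eq _ F) => n; elim: n P => [|n IH] P; first exact: Fil_0.
apply: Fil_trans (rZ _ _) _; apply: Fil_sym.
have := FilMr (k c) (rZ n.+1 P); rewrite mulrBr => /Fil_trans; apply.
rewrite cstM_E rmorphM mulrDr opprD addrACA subrr add0r mulr_sumr -sumrB.
apply: Fil_sum => i _; rewrite mulrA -Mk -mulrA -mulrBr; apply/Fil_step/Fil_sym.
by rewrite lqM (_ : lq _ (cst c) = 0) // mul0r addr0.
Qed.

Lemma recursiveM P Q : Z (P * Q) = Z P * Z Q.
Proof.
apply: (@Fil_eq _ F) => n; elim: n P => [|n IH] P; first exact: Fil_0.
apply: Fil_trans (rZ _ _) _; apply: Fil_sym.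
have := FilMl (Z Q) (rZ n.+1 P); rewrite mulrBl => /Fil_trans; apply.
have := FilMr (k (P [::])) (rZ n.+1 Q); rewrite mulrBr mulrDl => FQ.
rewrite [X in F _ (X - _)]addrC; set X := (\sum_(i <- _) _) * _.
rewrite -[X + _](subrK (X + k (P [::]) * (k (Q [::]) + \sum_(i <- IN n.+1) M i * Z (lq (t i) Q)))).
rewrite -addrA; apply: FilD; first by rewrite opprD addrACA subrr add0r.
rewrite mulrDr -rmorphM serM_nil [X + _]addrCA opprD addrACA subrr add0r.
rewrite {}/X mulr_suml mulr_sumr -big_split -sumrB; apply: Fil_sum => i _ /=.
rewrite lqM recursiveD recursiveZ mulrDr !mulrA Mk opprD [X in F _ X]addrA.
by rewrite addrK -!mulrA -mulrBr; apply/Fil_step/Fil_sym.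
Qed.

End RecursiveMaps.

Lemma recursive_let (A : alphabet) (R S : pzRingType) (F : filtration S)
    (k : {rmorphism R -> S}) (M : A -> S) (Z : series A R -> S) :
  (forall a, F 1%N (M a)) -> recursive F k (@ls A) M id Z ->
  forall a, Z (let_ R a) = M a.
Proof.
move=> FM rZ a; apply: (@Fil_eq _ F) => n.
apply: (@Fil_le _ _ _ (maxn n (wt a).+1)); first exact: leq_maxl.
apply: Fil_trans (rZ _ _) _; rewrite let_nil rmorph0 add0r.
rewrite -(sum_ls_pick M (leq_maxr n (wt a).+1)).
rewrite -sumrB; apply: Fil_sum => b _ /=; rewrite lq_let eq_sym.
case: eqP => _; last by rewrite (recursive0 FM rZ) mulr0 subrr; apply: Fil_zero.
by rewrite (recursive1 FM rZ) mulr1 subrr; apply: Fil_zero.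
Qed.

Section Substitution.
Variables (A B : alphabet) (R : pzRingType) (L : A -> series B R).
Hypothesis wtL : forall a, serF B trivF (wt a) (L a).
Hypothesis Lc : forall a c, L a * cst c = cst c * L a.

(** The approximation of index n is correct at all words of weight below n ([subst_substk]), so
    [subst] reads the coefficient of u from the approximation of index wt u + 1. *)
Fixpoint substk n (P : series A R) : series B R :=
  if n is m.+1 then cst (P [::]) + \sum_(a <- ls A n) L a * substk m (lq a P)
  else 0.

Definition subst (P : series A R) : series B R :=
  locked (fun u => substk (wtw u).+1 P u).

Lemma substkS n P :
  substk n.+1 P = cst (P [::]) + \sum_(a <- ls A n.+1) L a * substk n (lq a P).
Proof. by []. Qed.

Lemma substk_stable n P : serF B trivF n (substk n.+1 P - substk n P).
Proof.
elim: n P => [|n IH] P; first exact: Fil_0.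
rewrite substkS [X in _ - X]substkS opprD addrACA subrr add0r.
rewrite [ls A n.+2]/(ls A n.+1 ++ lw A n.+1) big_cat addrAC -sumrB; apply: FilD.
  apply: Fil_sum => a _; rewrite -mulrBr -(add1n n); apply: FilM => //.
  by apply: Fil_le (wtL a); apply: wt_gt0.
rewrite big_seq; apply: Fil_sum => a; rewrite mem_lw => /eqP <-.
exact: FilMl (wtL a).
Qed.

Lemma subst_substk n P : serF B trivF n (subst P - substk n P).
Proof.
move=> u; have [lt_u|ge_u] := ltnP (wtw u) n; last by left; apply/eqP; rewrite subn_eq0.
right; rewrite serB /subst -lock; apply/eqP; rewrite subr_eq0; apply/eqP.
elim: n lt_u => // n IH; rewrite ltnS leq_eqVlt => /predU1P[<-//|lt_u].
rewrite IH //; case: (substk_stable n P u) => [/eqP|]; first by rewrite subn_eq0 leqNgt lt_u.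
by rewrite serB => /subr0_eq.
Qed.

Lemma subst_recursive : recursive (serF B trivF) (@cst B R) (@ls A) L id subst.
Proof.
case=> [|n] P; first exact: Fil_0.
apply: Fil_trans (subst_substk _ _) _; rewrite substkS opprD addrACA subrr add0r.
rewrite -sumrB; apply: Fil_sum => a _; rewrite -mulrBr -(add1n n); apply: FilM.
  by apply: Fil_le (wtL a); apply: wt_gt0.
exact/Fil_sym/subst_substk.
Qed.

Lemma wtL1 a : serF B trivF 1 (L a).
Proof. by apply: Fil_le (wtL a); apply: wt_gt0. Qed.

Lemma substB P Q : subst (P - Q) = subst P - subst Q.
Proof. exact: (recursiveB wtL1 subst_recursive). Qed.
Lemma substD P Q : subst (P + Q) = subst P + subst Q.
Proof. exact: (recursiveD wtL1 subst_recursive). Qed.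
Lemma subst0 : subst 0 = 0. Proof. exact: (recursive0 wtL1 subst_recursive). Qed.
Lemma subst1 : subst 1 = 1. Proof. exact: (recursive1 wtL1 subst_recursive). Qed.
Lemma subst_cst c : subst (cst c) = cst c.
Proof. exact: (recursive_cst wtL1 subst_recursive). Qed.
Lemma substM P Q : subst (P * Q) = subst P * subst Q.
Proof. exact: (recursiveM wtL1 Lc subst_recursive). Qed.
Lemma subst_sum J (r : seq J) (E : J -> series A R) :
  subst (\sum_(j <- r) E j) = \sum_(j <- r) subst (E j).
Proof. exact: (recursive_sum wtL1 subst_recursive). Qed.
Lemma subst_let a : subst (let_ R a) = L a.
Proof. exact: (recursive_let wtL1 subst_recursive). Qed.

(** A general filtration F of the coefficients is allowed because the tensor square of a
    substitution is itself a substitution over [series B K], controlled by total weight. *)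
Lemma subst_Fil (F : filtration R) n P :
  (forall a, serF B F (wt a) (L a)) -> serF A F n P -> serF B F n (subst P).
Proof.
move=> FL; suff H m : forall n P, serF A F n P -> serF B F n (substk m P).
  by move=> FP; apply/serFP => u; rewrite /subst -lock; apply: H.
elim: m => [|m IH] {}n {}P FP; first exact: Fil_zero.
apply: FilD; first by apply: serF_cst; have := FP [::]; rewrite subn0.
by apply: Fil_sum => a _; apply: Fil_le (FilM (FL a) (IH _ _ (serF_lq a FP))); lia.
Qed.

End Substitution.

(** * Quasi-shuffle products *)

Section QuasiShuffle.
Variable A : alphabet.

Section Functional.
Variable V : zmodType.
Implicit Types (P : series A V) (u v w : seq A).

(* [qst P u v] is the linear functional P evaluated at the product of u and v. *)
Fixpoint qst P u v {struct u} : V :=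
  match u with
  | [::] => P v
  | a :: u' =>
    (fix qstv P v {struct v} : V :=
      match v with
      | [::] => P (a :: u')
      | b :: v' => qst (lq a P) u' (b :: v') + qstv (lq b P) v'
                   + qst (lq (op a b) P) u' v' *+ merge A
      end) P v
  end.

Lemma qst0u P v : qst P [::] v = P v. Proof. by []. Qed.
Lemma qstu0 P u : qst P u [::] = P u. Proof. by case: u. Qed.
Lemma qst_cons P a u b v :
  qst P (a :: u) (b :: v) = qst (lq a P) u (b :: v) + qst (lq b P) (a :: u) v
                            + qst (lq (op a b) P) u v *+ merge A.
Proof. by []. Qed.

Lemma qstD P Q u v : qst (P + Q) u v = qst P u v + qst Q u v.
Proof.
elim: u v P Q => [|a u IHu] v P Q //; elim: v P Q => [|b v IHv] P Q //.
rewrite !qst_cons -!/(lq _ P + lq _ Q) !IHu IHv mulrnDl.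
by rewrite [RHS]addrACA [X in X + _ = _]addrACA.
Qed.

Lemma qst0 u v : qst 0 u v = 0.
Proof.
elim: u v => [|a u IHu] v //; elim: v => [|b v IHv] //.
by rewrite qst_cons -!/(0 : series A V) !IHu IHv mul0rn !addr0.
Qed.

Lemma qstN P u v : qst (- P) u v = - qst P u v.
Proof. by apply/eqP; rewrite -subr_eq0 opprK -qstD addNr qst0. Qed.

Lemma qstB P Q u v : qst (P - Q) u v = qst P u v - qst Q u v.
Proof. by rewrite qstD qstN. Qed.

Lemma qstMn P n u v : qst (P *+ n) u v = qst P u v *+ n.
Proof. by elim: n => [|n IH]; rewrite ?mulr0n ?qst0 // !mulrS qstD IH. Qed.

Lemma qst_wt P Q u v :
  (forall w, wtw w = (wtw u + wtw v)%N -> P w = Q w) -> qst P u v = qst Q u v.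
Proof.
elim: u v P Q => [|a u IHu] v P Q PQ; first by rewrite /= PQ.
elim: v P Q PQ => [|b v IHv] P Q PQ; first by rewrite /= PQ ?addn0.
rewrite !qst_cons; congr (_ + _ + _).
- by apply: IHu => w wE; apply: PQ; rewrite !wtw_cons wE wtw_cons addnA.
- by apply: IHv => w wE; apply: PQ; rewrite !wtw_cons wE wtw_cons; lia.
- case E: (merge A); last by rewrite !mulr0n.
  congr (_ *+ _); apply: IHu => w wE; apply: PQ.
  by rewrite !wtw_cons wE wt_op //; lia.
Qed.

Lemma qstC P u v : qst P u v = qst P v u.
Proof.
elim: u v P => [|a u IHu] v P; first by rewrite qstu0.
elim: v P => [|b v IHv] P //.
by rewrite !qst_cons IHu IHv (IHu v) op_comm [X in X + _]addrC.
Qed.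

(** The coproduct dual to the product; [series A (series A V)] serves as the completed tensor
    square, the outer word being the left factor. *)
Definition delta P : series A (series A V) := fun u v => qst P u v.
Definition qr P v : series A V := fun u => qst P u v.

Lemma lq_qr P a c z : lq a (qr P (c :: z)) =
  qr (lq a P) (c :: z) + lq a (qr (lq c P) z) + qr (lq (op a c) P) z *+ merge A.
Proof. by apply/funext => w; rewrite !serD serMn. Qed.

Lemma lq_delta P a u b : lq b (delta P (a :: u)) =
  lq b (delta (lq a P) u) + delta (lq b P) (a :: u) + delta (lq (op a b) P) u *+ merge A.
Proof. by apply/funext => w; rewrite !serD serMn. Qed.

(** Associativity in transposed form: the two sides are P at (u v) z and at u (v z). *)
Lemma qstA P u v z : qst (qr P z) u v = qst (delta P u) v z.
Proof.
elim: u v z P => [|a u IHu] v z P; first by [].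
elim: v z P => [|b v IHv] z P; first by [].
elim: z P => [|c z IHz] P.
  by rewrite qstu0; apply: (@congr1 _ _ (fun Q => qst Q _ _)); apply/funext => w; rewrite /qr qstu0.
rewrite [LHS]qst_cons [RHS]qst_cons !lq_qr !lq_delta !qstD !qstMn.
rewrite !IHu !IHv op_assoc !mulrnDl.
have := IHz (lq c P); rewrite [LHS]qst_cons => <-.
rewrite [qst (delta (lq a P) u) _ _]qst_cons.
by rewrite !addrA [LHS](ACl (1*6*9*2*4*7*10*5*3*8*11)%AC).
Qed.

End Functional.
End QuasiShuffle.

(** f tensor 1; the other embedding 1 tensor g is [cst g]. *)
Definition outer (T U : eqType) (R : pzRingType) (f : series T R) :
  series T (series U R) := fun u => cst (f u).
Arguments outer {T} U {R} f.

Section Outer.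
Variables (T U : eqType).

Lemma outerM (R : pzRingType) (f g : series T R) : outer U (f * g) = outer U f * outer U g.
Proof.
apply/funext => x; elim: x f => [|a x IH] f; rewrite /outer ?serM_nil ?rmorphM //.
by rewrite !serM_cons rmorphD rmorphM; congr (_ + _); exact: IH.
Qed.

Lemma outerM2_E (R : pzRingType) (f : series T R) (g : series U R) u v :
  (outer U f * cst g) u v = f u * g v.
Proof. by rewrite Mcst_E /outer cstM_E. Qed.

Lemma outerC (K : comPzRingType) (f : series T K) (g : series U K) :
  outer U f * cst g = cst g * outer U f.
Proof.
by apply/funext => u; apply/funext => v; rewrite outerM2_E cstM_E Mcst_E mulrC.
Qed.

End Outer.

(** * The coproduct dual to the quasi-shuffle product *)

Section DeltaRecursive.
Variables (A : alphabet) (R : pzRingType).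
Local Notation W := (series A R).
Local Notation W2 := (series A (series A R)).

Definition F2 : filtration W2 := serF A (serF A (@trivF R)).

Definition kk : {rmorphism R -> W2} := @cst A W \o @cst A R.

(** The monomials in the coproduct of a letter: a tensor 1, 1 tensor a, and b tensor c for each pair
    with [op b c] equal to that letter. *)
Definition dI := (A + A + A * A)%type.

Definition dIN N : seq dI :=
  [seq inl (inl a) | a <- ls A N] ++ [seq inl (inr a) | a <- ls A N] ++
  (if merge A then [seq inr p | p <- [seq p <- allpairs pair (ls A N) (ls A N)
                                     | op p.1 p.2 \in ls A N]] else [::]).

Definition dt (i : dI) : A :=
  match i with inl (inl a) => a | inl (inr a) => a | inr p => op p.1 p.2 end.

Definition dM (S : pzRingType) (X Y : A -> S) (i : dI) : S :=
  match i with inl (inl a) => X a | inl (inr a) => Y a | inr p => X p.1 * Y p.2 end.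

Lemma cst2M_E (g : W) (G : W2) u v : (cst g * G) u v = (g * G u) v.
Proof. by rewrite cstM_E. Qed.

Lemma sum_dIN (V : zmodType) N (E : dI -> V) :
  \sum_(i <- dIN N) E i = \sum_(a <- ls A N) E (inl (inl a)) + \sum_(a <- ls A N) E (inl (inr a))
   + (\sum_(a <- ls A N) \sum_(b <- ls A N) if op a b \in ls A N then E (inr (a, b)) else 0) *+ merge A.
Proof.
rewrite /dIN !big_cat !big_map /= addrA; congr (_ + _ + _).
case: (merge A); last by rewrite big_nil mulr0n.
rewrite mulr1n big_map big_filter big_mkcond /= big_allpairs.
by apply: eq_bigr.
Qed.

Lemma delta_recursive : recursive F2 kk dIN (dM (let_ W) (fun a => cst (let_ R a))) dt
                          (@delta A R).
Proof.
move=> N P; apply/serFP => u; apply/serFP => v.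
(* Modulo step N only pairs of total weight below N count; their first letters and, when merging is
   allowed, the merged letter all occur in [ls A N]. *)
have [lt_uv|ge_uv] := ltnP (wtw u + wtw v)%N N; last by left; lia.
right; rewrite serB serB; apply/eqP; rewrite subr_eq0; apply/eqP.
rewrite sum_dIN !(serD, serMn, ser_sum) /=.
rewrite [X in _ = _ + (_ + _ + X *+ _)](_ : _ =
  \sum_(a <- ls A N) \sum_(b <- ls A N) if op a b \in ls A N then
    (let_ W a * (cst (let_ R b) * delta (lq (op a b) P))) u v else 0); last first.
  apply: eq_bigr => a _; rewrite !ser_sum; apply: eq_bigr => b _.
  by case: ifP => // _; rewrite mulrA.
under [X in _ = _ + (_ + X + _)]eq_bigr do rewrite cst2M_E.
case: u lt_uv => [|a u] lt_uv.
  rewrite big1 => [|a _]; last by rewrite letM_nil.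
  rewrite [X in _ + (_ + _ + X *+ _)]big1 => [|a _]; last first.
    by rewrite big1 // => b _; rewrite letM_nil if_same.
  rewrite add0r mul0rn addr0 /kk /=.
  case: v lt_uv => [|b v] lt_uv.
    by rewrite big1 ?addr0 // => b _; rewrite letM_nil.
  under eq_bigr do rewrite letM_cons.
  by rewrite sum_ls_pick ?add0r //; move: lt_uv; rewrite !wtw_cons; lia.
under eq_bigr do rewrite letM_cons.
rewrite (eq_bigr (fun a' => if a == a' then delta (lq a' P) u v else 0)); last first.
  by move=> a' _; case: eqP.
rewrite sum_ls_pick; last by move: lt_uv; rewrite !wtw_cons; lia.
rewrite [X in _ + (_ + _ + X *+ _)](_ : _ =
  \sum_(b <- ls A N) if op a b \in ls A N then (let_ R b * delta (lq (op a b) P) u) v else 0);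
  last first.
  rewrite -[RHS](@sum_ls_pick _ _ N a (fun a => \sum_(b <- ls A N) if op a b \in ls A N
     then (let_ R b * delta (lq (op a b) P) u) v else 0)); last by move: lt_uv; rewrite !wtw_cons; lia.
  apply: eq_bigr => a' _; case: eqP => [<-|ne].
    by apply: eq_bigr => b _; case: ifP => // _; rewrite letM_cons eqxx cst2M_E.
  by rewrite big1 // => b _; case: ifP => // _; rewrite letM_cons; case: eqP => // /ne.
rewrite /kk /= add0r.
case: v lt_uv => [|b v] lt_uv.
  rewrite !big1 ?mul0rn ?addr0 //; first by rewrite /delta qstu0.
    by move=> b _; rewrite letM_nil if_same.
  by move=> b _; rewrite letM_nil.
under eq_bigr do rewrite letM_cons.
rewrite sum_ls_pick; last by move: lt_uv; rewrite !wtw_cons; lia.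
rewrite (eq_bigr (fun b' => if b == b' then (if op a b \in ls A N then delta (lq (op a b) P) u v else 0) else 0)); last first.
  by move=> b' _; rewrite letM_cons; case: (b =P b') => [<-|_]; rewrite ?if_same.
rewrite sum_ls_pick; last by move: lt_uv; rewrite !wtw_cons; lia.
congr (_ + _ + _); case E: (merge A) => //.
by rewrite mem_ls wt_op // ifT //; move: lt_uv; rewrite !wtw_cons; lia.
Qed.

End DeltaRecursive.

Section DeltaHom.
Variables (A : alphabet) (R : pzRingType).
Local Notation W := (series A R).
Local Notation W2 := (series A (series A R)).

Lemma let_cst (S : pzRingType) (a : A) (c : S) : let_ S a * cst c = cst c * let_ S a.
Proof.
apply/funext => u; rewrite Mcst_E cstM_E /let_.
by case: eqP => _; rewrite ?mul1r ?mulr1 ?mul0r ?mulr0.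
Qed.

Lemma dM_kk i (c : R) : let M := dM (let_ W) (fun a => cst (let_ R a)) i in
  M * kk A R c = kk A R c * M.
Proof.
have lc a : let_ W a * cst (cst c) = cst (cst c) * let_ W a := let_cst _ _.
case: i => [[a|a]|[a b]] /=; first exact: lc.
  by rewrite -2!rmorphM let_cst.
by rewrite mulrA -lc -!mulrA; congr (_ * _); rewrite -2!rmorphM let_cst.
Qed.

Lemma dM_Fil1 i : F2 A R 1 (dM (let_ W) (fun a => cst (let_ R a)) i).
Proof.
have F1 a : F2 A R 1 (let_ W a) by apply: Fil_le (serF_let _ _) => //; apply: wt_gt0.
case: i => [[a|a]|[a b]]; [exact: F1| |exact: FilMl (F1 a)].
by apply/serF_cst; apply: Fil_le (serF_let _ _); apply: wt_gt0.
Qed.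

(** Dual to the compatibility of the quasi-shuffle product with deconcatenation. *)
Lemma deltaM (P Q : W) : delta (P * Q) = delta P * delta Q.
Proof. exact: (recursiveM dM_Fil1 dM_kk (@delta_recursive A R)). Qed.

Lemma deltaD (P Q : W) : delta (P + Q) = delta P + delta Q.
Proof. exact: (recursiveD dM_Fil1 (@delta_recursive A R)). Qed.

Lemma deltaB (P Q : W) : delta (P - Q) = delta P - delta Q.
Proof. exact: (recursiveB dM_Fil1 (@delta_recursive A R)). Qed.

Lemma delta_sum J (r : seq J) (E : J -> W) :
  delta (\sum_(j <- r) E j) = \sum_(j <- r) delta (E j).
Proof. exact: (recursive_sum dM_Fil1 (@delta_recursive A R)). Qed.

Lemma delta_cst c : delta (cst c) = kk A R c.
Proof. exact: (recursive_cst dM_Fil1 (@delta_recursive A R)). Qed.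

Lemma delta_Fil n (P : W) : serF A (@trivF R) n P -> F2 A R n (delta P).
Proof.
move=> FP; apply/serFP => u; apply/serFP => v.
have [|ge_uv] := ltnP (wtw u + wtw v)%N n; last by left; lia.
move=> lt_uv; right; rewrite -[RHS](@qst0 A R u v); apply: qst_wt => w wE.
by case: (FP w) => //; lia.
Qed.

End DeltaHom.

(** * Grouplike series and their images under substitutions *)

Section Characters.
Variables (A : alphabet) (K : comPzRingType).
Implicit Types P Q : series A K.

Definition character P := P [::] = 1 /\ forall u v, qst P u v = P u * P v.

(** Characters are the grouplike series, delta P = (P tensor 1)(1 tensor P), and 1 tensor P commutes
    with Q tensor 1 because K is commutative. *)
Lemma characterM P Q : character P -> character Q -> character (P * Q).
Proof.
move=> [P1 cP] [Q1 cQ]; split=> [|u v]; first by rewrite serM_nil P1 Q1 mulr1.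
have dE (X : series A K) : (forall u v, qst X u v = X u * X v) -> delta X = outer A X * cst X.
  by move=> cX; apply/funext => x; apply/funext => y; rewrite outerM2_E -cX.
have -> : qst (P * Q) u v = delta (P * Q) u v by [].
rewrite deltaM !dE // mulrA -[_ * cst P * _]mulrA -outerC mulrA -outerM -mulrA -rmorphM.
exact: outerM2_E.
Qed.

End Characters.

Section SubstCharacter.
Variables (A B : alphabet) (K : comPzRingType) (L : A -> series B K).
Hypothesis wtL : forall a, serF B trivF (wt a) (L a).

Lemma comm_cst (T : eqType) (f : series T K) c : f * cst c = cst c * f.
Proof. by apply/funext => u; rewrite Mcst_E cstM_E mulrC. Qed.

Let Lc a c : L a * cst c = cst c * L a. Proof. exact: comm_cst. Qed.
Let oL a : series B (series B K) := outer B (L a).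
Let oLc a c : oL a * cst c = cst c * oL a. Proof. exact: outerC. Qed.

Let FoL (F : filtration _) a :
  (forall n c, trivF n c -> F n (cst c)) -> serF B F (wt a) (oL a).
Proof. by move=> Fc; apply/serFP => u; apply: Fc; apply: wtL. Qed.

Let wtoL a : serF B trivF (wt a) (oL a).
Proof. by apply: FoL => n c [->|->]; [left|right; rewrite rmorph0]. Qed.

Let FoL2 a : serF B (serF B trivF) (wt a) (oL a).
Proof. by apply: FoL => n c; apply: serF_cst. Qed.

(** [S2] below is the tensor square of [subst L]: [inner] treats the right factor, and a
    substitution over [series B K] then treats the left one. *)
Let inner (Q : series A (series A K)) : series A (series B K) := fun w => subst L (Q w).
Let S2 (Q : series A (series A K)) : series B (series B K) := subst oL (inner Q).

Let innerM F G : inner (F * G) = inner F * inner G.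
Proof.
apply/funext => x; elim: x F => [|a x IH] F; rewrite /inner ?serM_nil ?substM //.
by rewrite !serM_cons substD // substM //; congr (_ + _); exact: IH.
Qed.

Let S2M F G : S2 (F * G) = S2 F * S2 G.
Proof. by rewrite /S2 innerM substM. Qed.

Let S2B F G : S2 (F - G) = S2 F - S2 G.
Proof.
rewrite /S2 -substB //; congr subst; apply/funext => w.
by rewrite /inner serB substB.
Qed.

Let S2_0 : S2 0 = 0.
Proof. by rewrite -[0 in LHS](subrr 0) S2B subrr. Qed.

Let S2D F G : S2 (F + G) = S2 F + S2 G.
Proof. by rewrite -[G in LHS]opprK -[- G]sub0r !S2B S2_0 sub0r opprK. Qed.

Let S2_sum J (r : seq J) (E : J -> series A (series A K)) :
  S2 (\sum_(j <- r) E j) = \sum_(j <- r) S2 (E j).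
Proof. by elim/big_rec2: _ => [|j y x _ <-]; rewrite ?S2_0 ?S2D. Qed.

Let S2_cst g : S2 (cst g) = cst (subst L g).
Proof.
rewrite /S2 -(subst_cst wtoL); congr subst; apply/funext => -[|a w] //=.
by rewrite /inner subst0.
Qed.

Let S2_let a : S2 (let_ (series A K) a) = oL a.
Proof.
rewrite /S2 -(subst_let wtoL); congr subst; apply/funext => w; rewrite /inner /let_.
by case: eqP => _; rewrite ?subst1 ?subst0.
Qed.

Let S2_Fil n Q : F2 A K n Q -> F2 B K n (S2 Q).
Proof.
move=> FQ; apply: subst_Fil; first exact: FoL2.
by apply/serFP => w; apply: subst_Fil; [exact: wtL|exact: FQ].
Qed.

Let M2 := dM oL (fun a => cst (L a)).

Let M2_Fil1 i : F2 B K 1 (M2 i).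
Proof.
have F1 a : F2 B K 1 (oL a) by apply: Fil_le (FoL2 a); apply: wt_gt0.
case: i => [[a|a]|[a b]]; [exact: F1| |exact: FilMl (F1 a)].
by apply/serF_cst; apply: Fil_le (wtL a); apply: wt_gt0.
Qed.

Let S2_recursive : recursive (F2 B K) (kk B K) (@dIN A) M2 (@dt A) (fun P => S2 (delta P)).
Proof.
move=> N P; have := S2_Fil (delta_recursive N P).
rewrite S2B S2D S2_sum [S2 (kk _ _ _)]S2_cst subst_cst //.
rewrite (eq_bigr (fun i => M2 i * S2 (delta (lq (dt i) P)))) // => i _.
by rewrite S2M; congr (_ * _); case: i => [[a|a]|[a b]] /=; rewrite ?S2M ?S2_cst ?subst_let // S2_let.
Qed.

(** The series L a has the coproduct of the letter a; the bound N makes the sum over merging pairs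
    finite. *)
Hypothesis compatL : forall a u v N, (wtw u + wtw v < N)%N -> (wt a < N)%N ->
  qst (L a) u v = L a u * (v == [::])%:R + (u == [::])%:R * L a v +
   (\sum_(b <- ls A N) \sum_(c <- ls A N)
      if op b c == a then L b u * L c v else 0) *+ merge A.

Let delta_subst_recursive :
  recursive (F2 B K) (kk B K) (@dIN A) M2 (@dt A) (fun P => delta (subst L P)).
Proof.
move=> N P; have := delta_Fil (subst_recursive wtL N P).
rewrite deltaB deltaD delta_cst. rewrite delta_sum => /Fil_trans; apply.
rewrite opprD addrACA subrr add0r; set X := fun a => delta (subst L (lq a P)).
(* Regroup the recursion by the letter a = dt i, so that the bracket is the coproduct of L a
   prescribed by [compatL]. *)
have -> : \sum_(i <- dIN A N) M2 i * X (dt i) =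
  \sum_(a <- ls A N) (oL a + cst (L a) +
    (\sum_(b <- ls A N) \sum_(c <- ls A N) if op b c == a then oL b * cst (L c) else 0)
       *+ merge A) * X a.
  rewrite sum_dIN -big_split /=.
  under [RHS]eq_bigr do rewrite mulrDl mulrDl; rewrite [RHS]big_split /=; congr (_ + _).
  under [RHS]eq_bigr do rewrite mulrnAl; rewrite [RHS]sumrMnl; congr (_ *+ _).
  under [RHS]eq_bigr do rewrite mulr_suml; rewrite [RHS]exchange_big /=; apply: eq_bigr => b _.
  under [RHS]eq_bigr do rewrite mulr_suml; rewrite [RHS]exchange_big /=; apply: eq_bigr => c _.
  rewrite mem_ls; case: ifP => [lt_op|/negbT]; last first.
    rewrite -leqNgt => ge_op; rewrite big_seq big1 // => a; rewrite mem_ls => lt_a.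
    by case: eqP => [e|_]; [rewrite -e ltnNge ge_op in lt_a|rewrite mul0r].
  rewrite -(sum_ls_pick (fun a => oL b * cst (L c) * X a) lt_op).
  by apply: eq_bigr => a _; case: eqP; rewrite ?mul0r.
rewrite -sumrB big_seq; apply: Fil_sum => a; rewrite mem_ls => lt_a.
rewrite deltaM -mulrBl; apply: FilMl; apply/serFP => u; apply/serFP => v.
have [lt_uv|ge_uv] := ltnP (wtw u + wtw v)%N N; last by left; lia.
right; apply/eqP; rewrite serB serB subr_eq0; apply/eqP.
rewrite !(serD, serMn, ser_sum) [LHS](compatL lt_uv lt_a); congr (_ + _ + _ *+ _).
- by rewrite /oL /outer; case: v {lt_uv} => [|b v]; rewrite /= ?mulr1 ?mulr0.
- by case: u {lt_uv} => [|b u]; rewrite /= ?mul1r ?mul0r.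
apply: eq_bigr => b _; rewrite !ser_sum; apply: eq_bigr => c _.
by case: eqP => // _; rewrite outerM2_E.
Qed.

(** The coproduct after [subst L] and the tensor square [S2] after the coproduct solve the same
    recursion, hence coincide. *)
Lemma subst_character P : character P -> character (subst L P).
Proof.
move=> [P1 cP]; split=> [|u v].
  have := congr1 (fun f : series B K => f [::]) (subst_cst wtL (P [::])).
  have := subst_recursive wtL 1 P [::]; case=> // /subr0_eq.
  rewrite serD ser_sum big1 ?addr0 /= ?P1 // => a _.
  by rewrite serM_nil; case: (wtL a [::]) => [|->]; rewrite ?mul0r // subn0; have := wt_gt0 a; lia.
have -> : qst (subst L P) u v = delta (subst L P) u v by [].
rewrite (recursive_uniq M2_Fil1 delta_subst_recursive S2_recursive) /S2.
have -> : inner (delta P) = outer B P * cst (subst L P).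
  apply/funext => w; rewrite /inner Mcst_E /outer.
  rewrite -[RHS](recursiveZ (wtL1 wtL) Lc (subst_recursive wtL)); congr subst.
  by apply/funext => w'; rewrite cstM_E /delta cP.
rewrite substM // subst_cst //.
(* Substitution commutes with the extension of scalars from K to [series B K]; this is visible on
   the approximations [substk]. *)
have -> : subst oL (outer B P) = outer B (subst L P).
  apply: (@Fil_eq _ (serF B trivF)) => n.
  apply: Fil_trans (subst_substk wtoL _ _) _; apply: Fil_sym.
  have -> : substk oL n (outer B P) = outer B (substk L n P).
    elim: n P {P1 cP} => [|n IH] P; first by apply/funext => w; rewrite /outer rmorph0.
    rewrite substkS (eq_bigr (fun a => outer B (L a) * outer B (substk L n (lq a P)))); last first.
      by move=> a _; rewrite -IH.
    apply/funext => w; rewrite /outer substkS !(serD, ser_sum) rmorphD rmorph_sum.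
    congr (_ + _); first by case: w => //= a w; rewrite rmorph0.
    by apply: eq_bigr => a _; rewrite -/(outer B (L a)) -outerM.
  apply/serFP => w; case: (subst_substk wtL n P w) => [->|]; first by left.
  by rewrite !serB /outer => /subr0_eq->; right; rewrite subrr.
exact: outerM2_E.
Qed.

End SubstCharacter.

Section SubstComp.
Variables (A B C : alphabet) (K : comPzRingType).
Variables (L : A -> series B K) (M : B -> series C K).
Hypothesis wtL : forall a, serF B trivF (wt a) (L a).
Hypothesis wtM : forall b, serF C trivF (wt b) (M b).

Lemma subst_comp P : subst M (subst L P) = subst (fun a => subst M (L a)) P.
Proof.
have wtML a : serF C trivF (wt a) (subst M (L a)) by apply: subst_Fil.
have Mc b c : M b * cst c = cst c * M b by apply: comm_cst.
pose Z Q := subst M (subst L Q).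
suff rZ : recursive (serF C trivF) (@cst C K) (@ls A) (fun a => subst M (L a)) id Z.
  exact: (recursive_uniq (wtL1 wtML) rZ (subst_recursive wtML)).
move=> N Q; rewrite /Z.
have := subst_Fil wtM (subst_recursive wtL N Q).
rewrite substB // substD // subst_cst // subst_sum //.
by under eq_bigr do rewrite substM //.
Qed.

End SubstComp.

(** * Shuffle characters and the Ihara action *)

Definition lwX n : seq bool := if n == 1%N then [:: false; true] else [::].
Fact lwX_uniq n : uniq (lwX n). Proof. by rewrite /lwX; case: eqP. Qed.
Fact mem_lwX n (a : bool) : (a \in lwX n) = (1%N == n).
Proof. by rewrite /lwX eq_sym; case: eqP => // _; case: a. Qed.
Fact wt_opX (a b : bool) : false -> 1%N = (1 + 1)%N. Proof. by []. Qed.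
Definition alphX : alphabet :=
  @Alphabet bool (fun=> 1%N) lwX andb false (fun=> isT) lwX_uniq mem_lwX andbA andbC wt_opX.

(* The letter k stands for y_(k+1). *)
Definition lwY n : seq nat := if n is m.+1 then [:: m] else [::].
Fact lwY_uniq n : uniq (lwY n). Proof. by case: n. Qed.
Fact mem_lwY n (a : nat) : (a \in lwY n) = (a.+1 == n).
Proof. by case: n => // n; rewrite inE eqSS. Qed.
Definition opY (i j : nat) := (i + j).+1.
Fact opYA : associative opY. Proof. by move=> i j k; rewrite /opY addnS addSn addnA. Qed.
Fact opYC : commutative opY. Proof. by move=> i j; rewrite /opY addnC. Qed.
Fact wt_opY (i j : nat) : true -> (opY i j).+1 = (i.+1 + j.+1)%N.
Proof. by rewrite /opY addSn addnS. Qed.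
Definition alphY : alphabet :=
  @Alphabet nat succn lwY opY true (fun=> isT) lwY_uniq mem_lwY opYA opYC wt_opY.

Lemma wtw_X (w : seq alphX) : wtw w = size w.
Proof. by elim: w => //= a w IH; rewrite wtw_cons IH. Qed.

Section Sign.
Variables (T : eqType) (K : comPzRingType).
Implicit Types f g : series T K.

(* The antipode of the shuffle algebra. *)
Definition sg f : series T K := fun w => (-1) ^+ size w * f (rev w).

Lemma sg_nil f : sg f [::] = f [::]. Proof. by rewrite /sg mul1r. Qed.

Lemma sgM f g : sg (f * g) = sg g * sg f.
Proof.
apply/funext => w; elim: w g => [|a w IH] g.
  by rewrite serM_nil /sg /= serM_nil /= !expr0 !mul1r mulrC.
rewrite serM_cons sg_nil {1}/sg rev_cons serM_rcons mulrDr.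
congr (_ + _); first by rewrite /sg rev_cons mulrA mulrC.
have -> : lq a (sg g) = - sg (fun u => g (rcons u a)).
  by apply/funext => u; rewrite serN /lq /sg /= rev_cons exprS mulN1r mulNr.
by rewrite mulNr serN -IH /sg exprS mulN1r mulNr.
Qed.

Lemma sg1 : sg 1 = 1.
Proof.
apply/funext => w; rewrite /sg !ser1E; case: w => [|a w]; first by rewrite mulr1.
by rewrite rev_cons -size_eq0 size_rcons mulr0.
Qed.

End Sign.

Section ShuffleCharacter.
Variable K : comPzRingType.
Local Notation H := (series alphX K).
Implicit Types f g Phi Psi : H.

Lemma qst1 (A : alphabet) u v : qst (1 : series A K) u v = (u == [::])%:R * (v == [::])%:R.
Proof.
have -> : qst (1 : series A K) u v = delta (1 : series A K) u v by [].
have -> : (1 : series A K) = cst 1 by [].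
by rewrite delta_cst; case: u => [|a u]; case: v => [|b v] /=; rewrite ?mulr0 ?mul0r ?mulr1.
Qed.

Lemma delta1 (A : alphabet) : delta (1 : series A K) = 1.
Proof. by rewrite -[1 in LHS]/(cst 1) delta_cst /= !rmorph1. Qed.

Lemma delta_character (A : alphabet) (P : series A K) :
  character P -> delta P = outer A P * cst P.
Proof. by case=> _ cP; apply/funext => x; apply/funext => y; rewrite outerM2_E -cP. Qed.

Definition primitive f := delta f = outer alphX f + cst f.

Lemma primitiveE f u v : primitive f ->
  qst f u v = f u * (v == [::])%:R + (u == [::])%:R * f v.
Proof.
move=> pf; have -> : qst f u v = delta f u v by [].
rewrite pf !serD; congr (_ + _); first by case: v => [|b v] /=; rewrite ?mulr1 ?mulr0.
by case: u => [|b u] /=; rewrite ?mul1r ?mul0r.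
Qed.

Lemma primitive_let a : primitive (let_ K a).
Proof.
apply/funext => u; apply/funext => v; rewrite !serD.
case: u => [|x u].
  by rewrite /delta /= /outer let_nil /= (_ : cst 0 v = 0) ?add0r //; case: v.
rewrite [cst _ (x :: u)]/= ser0 addr0 /delta.
case: v => [|y v]; first by rewrite qstu0 /outer.
rewrite qst_cons !lq_let mulr0n addr0.
have q0 b : qst (if b then 1 else 0 : H) u (y :: v) = 0.
  by case: b; rewrite ?qst0 // qst1 mulr0.
have q1 b : qst (if b then 1 else 0 : H) (x :: u) v = 0.
  by case: b; rewrite ?qst0 // qst1 mul0r.
by rewrite q0 q1 addr0.
Qed.

(** The alternating sum over the cuts w = u v of f at the shuffle of rev u ++ x with v. By the
    shuffle recursion consecutive terms cancel, leaving one half of the first ([flipsum_cons]); for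
    x empty this is the antipode identity. *)
Fixpoint flipsum f x w : K :=
  if w is a :: w' then qst f x w - flipsum f (a :: x) w' else qst f x [::].

Lemma flipsum_cons f b x w : flipsum f (b :: x) w = qst (lq b f) x w.
Proof.
elim: w x b f => [|a w IH] x b f /=; first by rewrite qstu0.
by rewrite IH mulr0n addr0 addrK.
Qed.

Lemma flipsum_conv f x w : character f ->
  flipsum f x w = conv (fun u => (-1) ^+ size u * f (rev u ++ x)) f w.
Proof.
case=> f1 cf; elim: w x => [|a w IH] x /=.
  by rewrite qstu0 expr0 mul1r f1 mulr1.
rewrite cf expr0 mul1r IH; congr (_ + _).
rewrite -[RHS]opprK; congr (- _); rewrite -[RHS]mulN1r -convZl.
apply: conv_ext => // u _; rewrite /lq /= rev_cons cat_rcons exprS.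
by rewrite !mulN1r mulNr opprK.
Qed.

Lemma sgM1 Phi : character Phi -> sg Phi * Phi = 1.
Proof.
move=> cPhi; apply/funext => w.
transitivity (flipsum Phi [::] w).
  by rewrite flipsum_conv //; apply: conv_ext => // u _; rewrite cats0.
case: w => [|a w]; first by rewrite ser1E /= (proj1 cPhi).
by rewrite ser1E /= flipsum_cons subrr.
Qed.

Lemma M1sg Phi : character Phi -> Phi * sg Phi = 1.
Proof.
move=> cPhi; have [g Pg] := ser_inv_exists (proj1 cPhi).
suff -> : sg Phi = g by [].
by rewrite -[LHS]mulr1 -Pg mulrA sgM1 // mul1r.
Qed.

(** [delta] is a ring morphism, so the left side is inverse to delta Phi; the right side is a left
    inverse of it. *)
Lemma delta_sg Phi : character Phi -> delta (sg Phi) = cst (sg Phi) * outer alphX (sg Phi).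
Proof.
move=> cP; set g := sg Phi; set X := cst g * outer alphX g.
have X1 : X * delta Phi = 1.
  rewrite delta_character // /X mulrA -[cst g * _ * _]mulrA -outerM sgM1 //.
  have -> : outer alphX (1 : H) = 1.
    by apply/funext => -[|a u]; rewrite /outer /= ?rmorph1 ?rmorph0.
  by rewrite mulr1 -rmorphM sgM1 // rmorph1.
by rewrite -[LHS]mul1r -X1 -mulrA -deltaM M1sg // delta1 mulr1.
Qed.

Lemma primitive_conj Phi f : character Phi -> primitive f -> primitive (Phi * f * sg Phi).
Proof.
move=> cP pf; rewrite /primitive !deltaM pf delta_sg // delta_character //.
rewrite mulrDr mulrDl; congr (_ + _).
  rewrite -[outer _ Phi * _ * _]mulrA -[cst Phi * outer _ _]outerC !mulrA.
  rewrite -[_ * cst Phi * _]mulrA -rmorphM M1sg // rmorph1 mulr1.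
  by rewrite !outerM.
rewrite -(mulrA (outer _ Phi)) -rmorphM -mulrA [cst _ * (_ * _)]mulrA -rmorphM.
by rewrite -outerC mulrA -outerM M1sg // -[RHS]mul1r; congr (_ * _); apply/funext => -[|a u]; rewrite /outer /= ?rmorph1 ?rmorph0.
Qed.

(* x_0 is conjugated by Phi and x_1 is fixed; conjugating everything by Phi
   gives the usual normalisation of Ihara's action. *)
Definition twist Phi (x : alphX) : H :=
  if x then let_ K true else Phi * let_ K false * sg Phi.

Definition star Phi Psi : H := subst (twist Phi) Psi * Phi.

Lemma wt_twist Phi x : serF alphX trivF (wt x) (twist Phi x).
Proof.
move=> [|a w]; last by left; rewrite wtw_X /=; lia.
by right; case: x; rewrite /= ?let_nil // serM_nil Mlet_nil mul0r.
Qed.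

Lemma primitive_twist Phi x : character Phi -> primitive (twist Phi x).
Proof. by move=> cP; case: x; [|apply: primitive_conj => //]; apply: primitive_let. Qed.

Lemma character_star Phi Psi : character Phi -> character Psi -> character (star Phi Psi).
Proof.
move=> cPhi cPsi; apply: characterM => //; apply: subst_character => //.
  exact: wt_twist.
by move=> a u v N _ _; rewrite mulr0n addr0; apply/primitiveE/primitive_twist.
Qed.

Lemma star_sg Phi Psi : character Phi -> character Psi ->
  sg (star Phi Psi) = sg Phi * subst (twist Phi) (sg Psi).
Proof.
move=> cPhi cPsi; have cS := character_star cPhi cPsi.
have wt1 := wt_twist Phi; have cc x c := @comm_cst _ _ (twist Phi x) c.
rewrite -[RHS]mulr1 -(M1sg cS) {1}/star !mulrA.
rewrite -[_ * subst _ (sg Psi) * _]mulrA -substM // sgM1 // subst1 // mulr1.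
by rewrite sgM1 // mul1r.
Qed.

(** The two substitutions agree on x_0: substituting [twist Phi1] in Phi2 x_0 Phi2^-1 gives x_0
    conjugated by [star Phi1 Phi2]. *)
Lemma starA Phi1 Phi2 Phi3 : character Phi1 -> character Phi2 ->
  star Phi1 (star Phi2 Phi3) = star (star Phi1 Phi2) Phi3.
Proof.
move=> c1 c2; have wt1 := wt_twist Phi1; have wt2 := wt_twist Phi2.
have cc x c := @comm_cst _ _ (twist Phi1 x) c.
rewrite {1}/star {1}/star substM // -mulrA -/(star Phi1 Phi2) {2}/star; congr (_ * _).
rewrite subst_comp //; congr subst; apply/funext => -[] /=; first by rewrite subst_let.
rewrite star_sg // !substM // subst_let // {1}/twist /star.
by rewrite !mulrA.
Qed.

Lemma subst_id (A : alphabet) (P : series A K) : subst (@let_ A K) P = P.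
Proof.
have wtl (a : A) : serF A trivF (wt a) (let_ K a) := serF_let _ a.
have F1 a : serF A trivF 1 (let_ K a) by apply: Fil_le (wtl a); apply: wt_gt0.
suff rid : recursive (serF A trivF) (@cst A K) (@ls A) (@let_ A K) id id.
  exact: (recursive_uniq F1 (subst_recursive wtl) rid).
move=> N Q; apply/serFP => w; have [lt_w|ge_w] := ltnP (wtw w) N; last by left; lia.
right; apply/eqP; rewrite serB subr_eq0; apply/eqP; rewrite serD ser_sum.
case: w lt_w => [|a w] lt_w; first by rewrite big1 ?addr0 // => a _; rewrite letM_nil.
rewrite (eq_bigr (fun b => if a == b then lq b Q w else 0)); last first.
  by move=> b _; rewrite letM_cons.
by rewrite sum_ls_pick ?add0r //; move: lt_w; rewrite wtw_cons; lia.
Qed.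

Lemma star1l Psi : star 1 Psi = Psi.
Proof.
rewrite /star mulr1 -[RHS]subst_id; congr subst; apply/funext => -[] //=.
by rewrite sg1 mul1r mulr1.
Qed.

Lemma star1r Phi : star Phi 1 = Phi.
Proof. by rewrite /star subst1 ?mul1r //; apply: wt_twist. Qed.

End ShuffleCharacter.

(** * Power series in one variable *)

(** K[[r]] as series over a one-letter alphabet, which supplies the ring structure. Below, [euler]
    is r d/dr and [alt] is r -> -r. *)
Definition pser (K : Type) := series unit K.
HB.instance Definition _ (K : pzRingType) := GRing.PzRing.on (pser K).

Section PowerSeries.
Variable K : comPzRingType.
Implicit Types (f g : pser K).

Definition cf f p : K := f (nseq p tt).
Definition mkp (c : nat -> K) : pser K := fun w => c (size w).

Lemma nseq_tt (w : seq unit) : w = nseq (size w) tt.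
Proof. by elim: w => //= -[] w {1}->. Qed.

Lemma cf_mkp c p : cf (mkp c) p = c p. Proof. by rewrite /cf /mkp size_nseq. Qed.

Lemma cfP f g : (forall p, cf f p = cf g p) -> f = g.
Proof. by move=> fg; apply/funext => w; rewrite (nseq_tt w); apply: fg. Qed.

Lemma cfM f g p : cf (f * g) p = \sum_(i < p.+1) cf f i * cf g (p - i).
Proof.
rewrite /cf; elim: p f => [|p IH] f; first by rewrite big_ord1.
rewrite [nseq _ _]/= serM_cons big_ord_recl /= -/(nseq _ tt) IH.
by congr (_ + _); apply: eq_bigr => i _.
Qed.

Lemma cfD f g p : cf (f + g) p = cf f p + cf g p. Proof. by []. Qed.
Lemma cfN f p : cf (- f) p = - cf f p. Proof. by []. Qed.
Lemma cfMn f n p : cf (f *+ n) p = cf f p *+ n. Proof. exact: serMn. Qed.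
Lemma cf0 p : cf 0 p = 0. Proof. by []. Qed.
Lemma cf1 p : cf 1 p = (p == 0%N)%:R. Proof. by rewrite /cf ser1E; case: p. Qed.

Lemma pserMC f g : f * g = g * f.
Proof.
apply/cfP => p; rewrite !cfM (reindex_inj rev_ord_inj) /=; apply: eq_bigr => i _.
by rewrite subSS mulrC subKn // -ltnS.
Qed.
HB.instance Definition _ := GRing.PzRing_hasCommutativeMul.Build (pser K) pserMC.

Definition pX n : pser K := mkp (fun p => (p == n)%:R).

Lemma cf_pXM n f p : cf (pX n * f) p = if (n <= p)%N then cf f (p - n) else 0.
Proof.
rewrite cfM; case: leqP => [le_np|lt_pn].
  rewrite (bigD1 (inord n)) //= cf_mkp inordK // eqxx mul1r big1 ?addr0 // => i ne_i.
  rewrite cf_mkp; case: eqP => [e|_]; last by rewrite mul0r.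
  by case/eqP: ne_i; apply/val_inj; rewrite /= inordK.
rewrite big1 // => i _; rewrite cf_mkp; case: eqP => [e|_]; last by rewrite mul0r.
by have := ltn_ord i; rewrite e ltnS leqNgt lt_pn.
Qed.

Definition euler f : pser K := mkp (fun p => cf f p *+ p).

Lemma eulerM f g : euler (f * g) = euler f * g + f * euler g.
Proof.
apply/cfP => p; rewrite cfD cf_mkp !cfM -big_split -sumrMnl; apply: eq_bigr => i _ /=.
by rewrite !cf_mkp mulrnAl mulrnAr -mulrnDr subnKC // -ltnS.
Qed.

Lemma eulerD f g : euler (f + g) = euler f + euler g.
Proof. by apply/cfP => p; rewrite cfD !cf_mkp cfD mulrnDl. Qed.

Definition alt f : pser K := mkp (fun p => (-1) ^+ p * cf f p).

Lemma altM f g : alt (f * g) = alt f * alt g.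
Proof.
apply/cfP => p; rewrite cf_mkp !cfM mulr_sumr; apply: eq_bigr => i _ /=.
have -> : (-1) ^+ p = (-1) ^+ i * (-1) ^+ (p - i) :> K by rewrite -exprD subnKC // -ltnS.
by rewrite !cf_mkp mulrACA.
Qed.

Lemma altD f g : alt (f + g) = alt f + alt g.
Proof. by apply/cfP => p; rewrite cfD !cf_mkp cfD mulrDr. Qed.

End PowerSeries.

(** * Words in Y and the derivation y_n -> n y_(n+1) *)

Fixpoint iw (s : seq nat) : seq bool :=
  if s is n :: s' then nseq n false ++ true :: iw s' else [::].

Lemma size_iw (s : seq alphY) : size (iw s) = wtw s.
Proof. by elim: s => //= n s IH; rewrite size_cat size_nseq /= IH wtw_cons /= addnS addSn. Qed.

Lemma iw_cat s t : iw (s ++ t) = iw s ++ iw t.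
Proof. by elim: s => //= n s ->; rewrite -catA. Qed.

Lemma rev_iw s : true :: iw s = rcons (rev (iw (rev s))) true.
Proof.
elim: s => //= n s IH; rewrite rev_cons -[rcons (rev s) n]cats1 iw_cat rev_cat rcons_cat -IH.
by rewrite /= rev_cat rev_nseq.
Qed.

Section DT.
Variable V : zmodType.
Implicit Types (P Q : series alphY V) (u v w : seq alphY).

(** The derivation is transposed: P is evaluated at the image of w. The letter n is y_(n+1), whence
    the factor n + 1. *)
Fixpoint dT P w : V :=
  if w is n :: w' then P (n.+1 :: w') *+ n.+1 + dT (lq (n : alphY) P) w' else 0.

Lemma dT_cons P (n : alphY) w : dT P (n :: w) = P ((n.+1 : nat) :: w) *+ n.+1 + dT (lq n P) w.
Proof. by []. Qed.

Lemma dTD P Q w : dT (P + Q) w = dT P w + dT Q w.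
Proof.
elim: w P Q => [|n w IH] P Q; first by rewrite /= addr0.
by rewrite !dT_cons -!/(lq _ P + lq _ Q) IH serD mulrnDl addrACA.
Qed.

Lemma dT_wt P Q w :
  (forall w', wtw w' = (wtw w).+1 -> P w' = Q w') -> dT P w = dT Q w.
Proof.
elim: w P Q => [|n w IH] P Q PQ //; rewrite !dT_cons PQ; last by rewrite !wtw_cons.
by congr (_ + _); apply: IH => w' wE; apply: PQ; rewrite !wtw_cons wE addnS.
Qed.

Lemma dT0 w : dT 0 w = 0.
Proof. by elim: w => [|n w IH] //; rewrite dT_cons mul0rn add0r -[RHS]IH. Qed.

Lemma dT_rcons P w (n : alphY) : dT P (rcons w n) =
  dT (fun u => P (rcons u n)) w + P (rcons w (n.+1 : nat)) *+ n.+1.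
Proof.
elim: w P => [|m w IH] P; first by rewrite /= addr0 add0r.
by rewrite [rcons _ _]/= !dT_cons IH addrA.
Qed.

Lemma dT_rev P w : dT (fun u => P (rev u)) w = dT P (rev w).
Proof.
elim: w P => [|n w IH] P //; rewrite rev_cons dT_rcons dT_cons addrC -IH.
congr (_ + _); last by rewrite rev_cons.
by congr (dT _ w); apply/funext => u; rewrite /lq rev_cons.
Qed.

(** The map y_n -> n y_(n+1) is also a derivation for the stuffle, since on merged letters (i+j)
    y_(i+j+1) = i y_((i+1)+j) + j y_(i+(j+1)). *)
Lemma dT_qst P u v : qst (dT P) u v = dT (qr P v) u + dT (delta P u) v.
Proof.
elim: u v P => [|a u IHu] v P; first by rewrite /= add0r.
elim: v P => [|b v IHv] P.
  rewrite qstu0 [dT _ [::]]/= addr0; congr (dT _ _); apply/funext => w; exact/esym/qstu0.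
have lq_dT c (X : series alphY V) : lq c (dT X) = lq (c.+1 : alphY) X *+ c.+1 + dT (lq c X) :> series alphY V.
  by apply/funext => w; rewrite serD serMn.
have m1 (M : zmodType) (x : M) : x *+ merge alphY = x by [].
have [c cE] : {c : alphY | c = op a b} by exists (op a b).
have nE (x : V) : x *+ (c : nat).+1 = x *+ (a : nat).+1 + x *+ (b : nat).+1.
  by rewrite -mulrnDr cE /= /opY addSn addnS.
rewrite qst_cons -cE !lq_dT !qstD !qstMn !IHu IHv !dT_cons !lq_qr !lq_delta !dTD -cE !m1 nE.
rewrite /qr /delta !qst_cons -!/(qr _ _) -!/(delta _ _) !m1 !mulrnDl.
have -> : op (a.+1 : alphY) b = (c : nat).+1 by rewrite cE.
have -> : op a (b.+1 : alphY) = (c : nat).+1 by rewrite cE /= /opY addnS.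
by rewrite !addrA [LHS](ACl (1*6*9*2*7*11*3*5*10*4*8*12)%AC).
Qed.
End DT.

Section ReversalStuffle.
Variables (A : alphabet) (V : zmodType).
Implicit Types (P : series A V) (u v : seq A).

Definition rq (a : A) P : series A V := fun w => P (rcons w a).

(** The product obeys the same recursion from the last letters, which makes reversal of words an
    automorphism ([qst_rev]). *)
Lemma qst_rcons P u a v b : qst P (rcons u a) (rcons v b) =
  qst (rq a P) u (rcons v b) + qst (rq b P) (rcons u a) v + qst (rq (op a b) P) u v *+ merge A.
Proof.
have lqrq x y Q : lq x (rq y Q) = rq y (lq x Q) by [].
have q1 x Q w d : qst Q [:: x] (rcons w d) =
    rq x Q (rcons w d) + qst (rq d Q) [:: x] w + rq (op x d) Q w *+ merge A.
  elim: w Q => [|c w IH] Q; first by rewrite [LHS]/= [X in X + _ = _]addrC.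
  rewrite [rcons _ _]/= !qst_cons IH !qst0u.
  by rewrite !addrA [LHS](ACl (2*1*3*5*4)%AC).
elim: u v P => [|c u IHu] v P; first by rewrite q1 !qst0u.
elim: v P => [|d v IHv] P.
  rewrite qstC q1 qstC !qstu0 op_comm (addrC (rq b P _)).
  by rewrite [qst (rq a P) _ _]qstC.
rewrite ![rcons (_ :: _) _]/= !qst_cons -!rcons_cons IHu IHv IHu.
rewrite !mulrnDl !lqrq !addrA.
by rewrite [LHS](ACl (1*4*7*2*5*8*3*6*9)%AC).
Qed.

Lemma qst_rev P u v : qst (fun w => P (rev w)) u v = qst P (rev u) (rev v).
Proof.
elim: u v P => [|a u IHu] v P //; elim: v P => [|b v IHv] P; first by rewrite qstu0 /= qstu0.
rewrite qst_cons !rev_cons qst_rcons -rev_cons -[rcons (rev u) a]rev_cons -IHu -IHv -IHu.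
have lqE c : lq c (fun w => P (rev w)) = (fun w => rq c P (rev w)) :> series A V.
  by apply/funext => w; rewrite /lq /rq rev_cons.
by rewrite !lqE.
Qed.

End ReversalStuffle.

Lemma sum_ord_tail (V : nmodType) (E : nat -> V) m n :
  (forall i, (m <= i)%N -> E i = 0) -> (forall i, (n <= i)%N -> E i = 0) ->
  \sum_(i < m) E i = \sum_(i < n) E i.
Proof.
wlog le_mn : m n / (m <= n)%N => [IH|] Em En.
  by case/orP: (leq_total m n) => ?; [apply: IH|apply/esym/IH].
rewrite -(subnKC le_mn) big_split_ord /= [X in _ + X]big1 ?addr0 // => i _.
by apply: Em; rewrite leq_addr.
Qed.

(** * Projection to words in Y and generating series in r *)

Section Projection.
Variable K : comPzRingType.
Local Notation H := (series alphX K).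
Local Notation W := (series alphY K).
Implicit Types f g h : H.

Definition pi f : W := fun s => f (iw s).
Definition block (n : nat) f : H := fun w => f (nseq n false ++ true :: w).

Lemma piD f g : pi (f + g) = pi f + pi g. Proof. by []. Qed.

Lemma serM_block f h n v : (f * h) (nseq n false ++ true :: v) =
  \sum_(i < n.+1) f (nseq i false) * h (nseq (n - i) false ++ true :: v)
  + (block n f * h : H) v.
Proof.
elim: n f => [|n IH] f; first by rewrite big_ord1 /= serM_cons.
rewrite [nseq n.+1 false ++ _]/= serM_cons IH [in RHS]big_ord_recl addrA.
by congr (_ + _ + _).
Qed.

Definition Xn n : H := let_ K (false : alphX) ^+ n.

Lemma XnM_E n h m w : (Xn n * h) (nseq m false ++ w) =
  if (n <= m)%N then h (nseq (m - n) false ++ w) else (Xn (n - m) * h) w.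
Proof.
elim: n m => [|n IH] m; first by rewrite /Xn expr0 mul1r subn0.
rewrite /Xn exprS -mulrA; case: m => [|m] /=; first by rewrite exprS mulrA.
by rewrite letM_cons IH subSS.
Qed.

Lemma XnM_small n h w : h [::] = 0 -> (size w <= n)%N -> (Xn n * h) w = 0.
Proof.
move=> h0; elim: n w => [|n IH] w.
  by rewrite leqn0 size_eq0 => /eqP->; rewrite /Xn expr0 mul1r.
rewrite /Xn exprS -mulrA; case: w => [|a w] lt_w; first by rewrite letM_nil.
by rewrite letM_cons; case: eqP => // _; apply: IH.
Qed.

Local Notation x1 := (let_ K (true : alphX)).

Lemma XnM_true n h w : h [::] = 0 -> (Xn n.+1 * h) (true :: w) = 0.
Proof. by move=> h0; rewrite /Xn exprS -mulrA letM_cons. Qed.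

Local Notation W' := (series alphY (pser K)).

(* In tl and tr the variable r of [pser K] records how much weight of F is
   used, so that the infinitely many coefficients F(iw w x_0^i) can be put
   together. *)
Definition tl f : W' := fun w => mkp (fun p =>
  if (wtw w <= p)%N then f (iw w ++ nseq (p - wtw w) false) else 0).
Definition Yone : W' := fun w => (size w <= 1)%N%:R.
Definition tr g : W' := fun w => mkp (fun p =>
  if (wtw w <= p)%N then g (nseq (p - wtw w) false ++ true :: iw w) else 0).

Lemma lq_tl n f : lq (n : alphY) (tl f) = cst (pX K n.+1) * tl (block n f).
Proof.
apply/funext => w; rewrite cstM_E; apply/cfP => p; rewrite cf_pXM !cf_mkp wtw_cons [wt _]/=.
have [le_np|lt_pn] := leqP n.+1 p; last by rewrite ifN //; lia.
rewrite leq_subRL // subnDA; case: ifP => // _.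
by rewrite /block /= -catA.
Qed.

Lemma YoneM (X : W') (n : alphY) w : (Yone * X) (n :: w) = X (n :: w) + X w.
Proof.
rewrite serM_cons mul1r; congr (_ + _).
by have -> : lq n Yone = 1; [apply/funext => -[]|rewrite mul1r].
Qed.

(** A factorisation of iw w for f x_0^a g cuts inside a block: w = w_1 y_(n+1) w_2, where f receives
    iw w_1 x_0^i, g receives x_0^j x_1 iw w_2, and i + a + j = n. The letter y_(n+1) comes from
    [Yone], and the degree p = wt w_1 + i + wt w_2 + j determines a. The constant term of [Yone]
    only contributes in degrees at least wt w > p. *)
Lemma tlYtr f g a p w : (forall m, g (nseq m false) = 0) -> wtw w = (p + a.+1)%N ->
  cf ((tl f * (Yone * tr g)) w) p = (f * (Xn a * g)) (iw w).
Proof.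
move=> g0; elim: w f p => [|n w IH] f p; first by rewrite addnS.
rewrite wtw_cons [wt _]/= => wE.
rewrite serM_cons cfD [RHS]serM_block; congr (_ + _).
  rewrite YoneM cfM.
  have tE (i : 'I_p.+1) : cf (tl f [::]) i * cf (tr g ((n : alphY) :: w) + tr g w) (p - i) =
      if (i + a <= n)%N then f (nseq i false) * g (nseq (n - i - a) false ++ true :: iw w) else 0.
    rewrite cfD !cf_mkp wtw_cons [wt _]/= subn0 ifN ?add0r; last by have := ltn_ord i; lia.
    case: ifP => [le1|/negbT gt1]; last by rewrite ifN ?mulr0 //; have := ltn_ord i; lia.
    have := ltn_ord i => lt_i; rewrite ifT; last by lia.
    by have -> : (p - i - wtw w = n - i - a)%N by lia.
  under eq_bigr do rewrite tE.
  have rE (i : 'I_n.+1) : f (nseq i false) * (Xn a * g) (nseq (n - i) false ++ true :: iw w) =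
      if (i + a <= n)%N then f (nseq i false) * g (nseq (n - i - a) false ++ true :: iw w) else 0.
    rewrite XnM_E leq_subRL ?leq_ord //; case: ifP => // /negbT gt_ia.
    case E: (a - (n - i))%N => [|k]; first by have := ltn_ord i; lia.
    by rewrite XnM_true ?mulr0 // (g0 0%N).
  under [RHS]eq_bigr do rewrite rE.
  pose E i := if (i + a <= n)%N then
    f (nseq i false) * g (nseq (n - i - a) false ++ true :: iw w) else 0.
  apply: (@sum_ord_tail _ E) => i le_i; rewrite /E ifN //; lia.
rewrite -/(iw w) lq_tl -mulrA cstM_E cf_pXM; case: (leqP n.+1 p) => [le_np|lt_pn].
  by apply: IH; lia.
(* The rest of the word has weight at most a, too short for x_0^a g because g has no constant
   term. *)
rewrite mulrA -[_ * g]mulrA; apply/esym.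
suff : serF alphX (@trivF K) (size (iw w)).+1 (block n f * (Xn a * g)).
  by case/(_ (iw w)) => [|//]; rewrite wtw_X subSnn.
apply: FilMr; apply/serFP => u; have [le_ua|lt_au] := leqP (size u) a.
  by right; apply: XnM_small => //; apply: (g0 0%N).
by left; rewrite wtw_X size_iw; lia.
Qed.

End Projection.

Section AdditiveMaps.
Variables (V V' : zmodType) (phi : V -> V').
Hypothesis phiD : {morph phi : x y / x + y}.

Lemma addmap0 : phi 0 = 0.
Proof. by apply: (addrI (phi 0)); rewrite -phiD !addr0. Qed.

Lemma addmapMn x n : phi (x *+ n) = phi x *+ n.
Proof. by elim: n => [|n IH]; rewrite ?mulr0n ?addmap0 // !mulrS phiD IH. Qed.

Lemma qst_map (A : alphabet) (P : series A V) u v :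
  qst (fun w => phi (P w)) u v = phi (qst P u v).
Proof.
elim: u v P => [|a u IHu] v P //; elim: v P => [|b v IHv] P //.
by rewrite !qst_cons !phiD addmapMn -!IHu -IHv.
Qed.

Lemma dT_map (P : series alphY V) w : dT (fun w => phi (P w)) w = phi (dT P w).
Proof.
elim: w P => [|n w IH] P; first by rewrite /= addmap0.
by rewrite !dT_cons phiD addmapMn -IH.
Qed.

End AdditiveMaps.

Section Derivations.
Variables (A : alphabet) (R : pzRingType).
Implicit Types P Q : series A R.

Lemma series_derivation (d : R -> R) : {morph d : x y / x + y} ->
  (forall x y, d (x * y) = d x * y + x * d y) ->
  forall P Q w, d ((P * Q) w) =
    (((fun u => d (P u)) : series A R) * Q) w + (P * ((fun u => d (Q u)) : series A R)) w.
Proof.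
move=> dD dM P Q w; elim: w P => [|a w IH] P; first by rewrite !serM_nil dM.
by rewrite !serM_cons dD dM IH addrACA.
Qed.

Lemma weight_derivation P Q w : (P * Q) w *+ wtw w =
  (((fun u => P u *+ wtw u) : series A R) * Q) w + (P * ((fun u => Q u *+ wtw u) : series A R)) w.
Proof.
elim: w P => [|a w IH] P; first by rewrite !serM_nil /= !mulr0n mul0r mulr0 addr0.
rewrite !serM_cons mulr0n mul0r add0r mulrnDl wtw_cons [(lq a P * Q) w *+ _]mulrnDr IH.
have -> : lq a (fun u => P u *+ wtw u) = lq a P *+ wt a + (fun u => lq a P u *+ wtw u) :> series A R.
  by apply/funext => u; rewrite serD serMn -mulrnDr.
by rewrite mulrDl serD mulrnAl serMn mulrnAr !addrA [LHS](ACl (2*3*1*4)%AC).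
Qed.

Lemma dTM (X Y : series alphY R) w : dT (X * Y) w = ((dT X : series alphY R) * Y) w + (X * (dT Y : series alphY R)) w.
Proof.
elim: w X => [|n w IH] X; first by rewrite !serM_nil /= mul0r mulr0 addr0.
rewrite dT_cons lqM dTD IH !serM_cons [dT X [::]]/= mul0r add0r.
have -> : lq n (dT X) = lq (n.+1 : alphY) X *+ n.+1 + dT (lq n X) :> series alphY R.
  by apply/funext => u; rewrite serD serMn.
have -> : dT (cst (X [::]) * lq n Y) w = X [::] * dT (lq n Y) w.
  rewrite -(dT_map (mulrDr (X [::]))); congr (dT _ w).
  by apply/funext => u; rewrite cstM_E.
rewrite dT_cons mulrDl serD mulrnAl serMn mulrnDl mulrDr mulrnAr.
by rewrite !addrA [LHS](ACl (2*4*1*3*5)%AC).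
Qed.

End Derivations.

(** * The weight equation and its grouplike solutions *)

Section Isobaric.
Variable K : comPzRingType.
Local Notation H := (series alphX K).
Local Notation W := (series alphY K).
Local Notation W' := (series alphY (pser K)).

(** For the coefficient P_p of r^p this reads (wt w - p) P_p(w) = (dT P_p)(w): away from weight p,
    values are governed by those in weight one more. *)
Definition isobaric (P : W') := forall w, euler (P w) + dT P w = P w *+ wtw w.

Lemma isobaricM P Q : isobaric P -> isobaric Q -> isobaric (P * Q).
Proof.
move=> iP iQ w; rewrite weight_derivation.
have -> : (fun u => P u *+ wtw u) = ((fun u => euler (P u)) : W') + dT P :> W'.
  by apply/funext => u; rewrite -iP.
have -> : (fun u => Q u *+ wtw u) = ((fun u => euler (Q u)) : W') + dT Q :> W'.
  by apply/funext => u; rewrite -iQ.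
rewrite mulrDl mulrDr !serD dTM (series_derivation (@eulerD K) (@eulerM K)).
by rewrite addrACA.
Qed.

Lemma cf_dT p (P : W') w : cf (dT P w) p = dT (fun u => cf (P u) p) w.
Proof. by rewrite (dT_map (phi := fun x => cf x p)). Qed.

Lemma cf_qst p (P : W') u v : cf (qst P u v) p = qst (fun w => cf (P w) p) u v.
Proof. by rewrite (qst_map (phi := fun x => cf x p)). Qed.

Lemma isobaric_rev P : isobaric P -> isobaric (fun w => alt (P (rev w))).
Proof.
move=> iP w; have := congr1 (@alt K) (iP (rev w)).
have wrev : wtw (rev w) = wtw w.
  by rewrite /wtw map_rev sumn_rev.
rewrite wrev (addmapMn (@altD K)) altD => <-; congr (_ + _).
  by apply/cfP => p; rewrite !cf_mkp mulrnAr.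
by rewrite -dT_rev (dT_map (@altD K)).
Qed.

Lemma isobaric_Yone : isobaric (@Yone K).
Proof.
have e1 : euler (1 : pser K) = 0.
  by apply/cfP => -[|p]; rewrite cf_mkp cf1 ?mulr0n // mul0rn.
have e0 : euler (0 : pser K) = 0 by rewrite (addmap0 (@eulerD K)).
move=> [|n [|m w]]; first by rewrite /= addr0 e1.
  by rewrite !dT_cons /Yone /= e1 add0r addr0 wtw_cons addn0.
have Y0 a b x : Yone K (a :: b :: x) = 0 by [].
rewrite !dT_cons {2}/lq !Y0 e0 !mul0rn !add0r.
exact: (dT0 (pser K) w).
Qed.

Lemma qst_small (A : alphabet) (V : zmodType) (P : series A V) u v :
  (forall w, (size u <= size w)%N -> P w = 0) -> qst P u v = 0.
Proof.
elim: u v P => [|a u IHu] v P P0; first exact: P0.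
elim: v P P0 => [|b v IHv] P P0; first by rewrite qstu0 P0.
rewrite qst_cons IHu ?IHv ?IHu ?mul0rn ?addr0 // => w lt_w; apply: P0 => //.
exact: leqW.
Qed.

(** The series 1 + sum_n y_n is grouplike: at a pair of letters the merged letter alone accounts for
    the product 1 * 1. *)
Lemma character_Yone : character (@Yone K).
Proof.
split=> // u v.
have big x y : (1 < size x)%N -> qst (@Yone K) x y = Yone K x * Yone K y.
  move=> gt1; rewrite {2}/Yone leqNgt gt1 mul0r; apply: qst_small => w le_w.
  by rewrite /Yone leqNgt (leq_trans gt1 le_w).
have [/big//|] := ltnP 1 (size u); have [gt1 _|] := ltnP 1 (size v).
  by rewrite qstC mulrC big.
case: u => [|a [|//]] sv su; first by rewrite mul1r.
case: v sv => [|b [|//]] sv; first by rewrite qstu0 mulr1.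
by rewrite /= /Yone /lq /= !mulr1n !mul1r !add0r.
Qed.

Local Notation x0w := [:: false : alphX].

Lemma qst_x0_nseq (f : H) i : qst f x0w (nseq i false) = f (nseq i.+1 false) *+ i.+1.
Proof.
elim: i f => [|i IH] f; first by rewrite qstu0.
rewrite [nseq i.+1 _]/= qst_cons qst0u mulr0n addr0.
by rewrite IH [in RHS]mulrS.
Qed.

Lemma qst_x0_block (f : H) n v : qst f x0w (nseq n false ++ true :: v) =
  f (nseq n.+1 false ++ true :: v) *+ n.+1 + qst (block n f) x0w v.
Proof.
elim: n f => [|n IH] f; first by rewrite [_ ++ _]/= qst_cons qst0u mulr0n addr0.
rewrite [nseq n.+1 _ ++ _]/= qst_cons qst0u mulr0n addr0 IH.
by rewrite addrA [in RHS]mulrS.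
Qed.

(** An inserted x_0 lengthens a block x_0^n x_1 in n + 1 ways, which is the derivation, or the tail
    x_0^i in i + 1 ways. *)
Lemma qst_x0_dT (f : H) (w : seq alphY) i : qst f x0w (iw w ++ nseq i false) =
  f (iw w ++ nseq i.+1 false) *+ i.+1 + dT (fun u : seq alphY => f (iw u ++ nseq i false)) w.
Proof.
elim: w f => [|n w IH] f; first by rewrite qst_x0_nseq addr0.
rewrite [iw (n :: w)]/= -catA [_ ++ _]/= qst_x0_block {}IH dT_cons addrCA.
rewrite /block -!catA; congr (_ + (_ *+ n.+1 + dT _ w)).
by apply/funext => u; rewrite /lq /= -catA.
Qed.

Hypothesis tf : forall n (x : K), x *+ n.+1 = 0 -> x = 0.

Section TL.
Variable f : H.
Hypothesis f0 : forall v, qst f x0w v = 0.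

Lemma isobaric_tl : isobaric (tl f).
Proof.
move=> w; apply/cfP => p; rewrite cfD cfMn cf_mkp cf_dT.
have [lt_pw|le_wp] := ltnP p (wtw w).
  rewrite cf_mkp ifN; last by rewrite -ltnNge.
  rewrite !mul0rn add0r -[RHS](dT0 K w); apply: dT_wt => w' wE.
  by rewrite cf_mkp ifN // -ltnNge wE; lia.
have [k pE] : {k | p = (wtw w + k)%N} by exists (p - wtw w)%N; lia.
case: k pE => [|i] pE.
  rewrite pE addn0 -[RHS]addr0 -[X in _ = _ + X](dT0 K w); congr (_ + _); apply: dT_wt => w' wE.
  by rewrite cf_mkp ifN // -ltnNge wE.
have -> : dT (fun u => cf (tl f u) p) w = dT (fun u : seq alphY => f (iw u ++ nseq i false)) w.
  apply: dT_wt => w' wE; rewrite cf_mkp ifT ?wE ?pE; last by lia.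
  by congr (f (_ ++ nseq _ _)); lia.
have := qst_x0_dT f w i; rewrite f0 => /esym/eqP; rewrite addrC addr_eq0 => /eqP->.
rewrite cf_mkp ifT //; have -> : (p - wtw w)%N = i.+1 by lia.
by rewrite pE mulrnDr addrK.
Qed.

Hypothesis cf0' : character (pi f).

(** Induction on n = p - wt u - wt v. For n < 0 both sides vanish, and n = 0 is the stuffle equation
    of [pi f]. Otherwise both sides obey the weight equation, so n times their difference is
    expressed at larger weights, where they agree. *)
Lemma character_tl : character (tl f).
Proof.
have [f1 cpf] := cf0'; split=> [|u v].
  apply/cfP => p; rewrite cf_mkp cf1 subn0 /=; case: p => [|p]; first exact: f1.
  by apply: (tf (n := p)); rewrite -qst_x0_nseq f0.
apply/cfP => p.
have small u' v' : (p < wtw u' + wtw v')%N -> cf (qst (tl f) u' v') p = cf (tl f u' * tl f v') p.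
  move=> lt_p; rewrite cf_qst cfM big1 => [|i _].
    rewrite -[RHS](qst0 K u' v'); apply: qst_wt => w wE.
    by rewrite cf_mkp ifN // -ltnNge wE.
  rewrite !cf_mkp; have := ltn_ord i => lt_i; case: ifP => [le1|_]; last by rewrite mul0r.
  by rewrite ifN ?mulr0 //; lia.
have [/small//|/subnKC pE] := ltnP p (wtw u + wtw v).
move: (p - _)%N pE => n; elim: n u v => [|n IH] u v pE.
  rewrite cf_qst cfM (bigD1 (inord (wtw u))) //= big1 => [|i ne_i].
    rewrite !cf_mkp inordK ?ltnS; last by lia.
    rewrite leqnn subnn cats0 -pE addn0 addKn leqnn subnn cats0 addr0.
    rewrite -[RHS](cpf u v); apply: qst_wt => w wE.
    by rewrite cf_mkp wE leqnn subnn cats0.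
  have ne_u : (i : nat) != wtw u.
    by apply: contraNneq ne_i => e; rewrite -e inord_val.
  rewrite !cf_mkp; have := ltn_ord i => lt_i; case: ifP => [le1|_]; last by rewrite mul0r.
  by rewrite ifN ?mulr0 //; lia.
pose Z := tl f; pose q x y := cf (qst Z x y) p.
have iZ x : euler (Z x) = Z x *+ wtw x - dT Z x by rewrite -isobaric_tl addrK.
suff: (q u v - cf (Z u * Z v) p) *+ n.+1 = 0 by move/tf/eqP; rewrite subr_eq0 => /eqP.
have qE : q u v *+ p + (cf (dT Z u * Z v) p + cf (Z u * dT Z v) p) = q u v *+ (wtw u + wtw v).
  rewrite /q cf_qst; set Zp : series alphY K := fun w => cf (Z w) p.
  have -> : cf (dT Z u * Z v) p = dT (qr Zp v) u.
    rewrite -(dT_map (phi := fun x => cf (x * Z v) p)) => [|x y]; last by rewrite mulrDl cfD.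
    by apply: dT_wt => w wE; rewrite /qr -cf_qst IH // wE -pE; lia.
  have -> : cf (Z u * dT Z v) p = dT (delta Zp u) v.
    rewrite -(dT_map (phi := fun x => cf (Z u * x) p)) => [|x y]; last by rewrite mulrDr cfD.
    by apply: dT_wt => w wE; rewrite /delta -cf_qst IH // wE -pE; lia.
  rewrite -dT_qst -!qstMn -qstD; apply: qst_wt => w wE.
  rewrite serD !serMn -wE /Zp -cf_dT.
  by have := congr1 (fun x : pser K => cf x p) (isobaric_tl w); rewrite /= cfD cfMn cf_mkp.
have zE : cf (Z u * Z v) p *+ p + (cf (dT Z u * Z v) p + cf (Z u * dT Z v) p) =
    cf (Z u * Z v) p *+ (wtw u + wtw v).
  have -> : cf (Z u * Z v) p *+ p = cf (euler (Z u * Z v)) p by rewrite cf_mkp.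
  rewrite eulerM !iZ mulrBl mulrBr !(cfD, cfN) mulrnAl mulrnAr !cfMn mulrnDr.
  by rewrite addrACA !subrK.
have aux (y D : K) : y *+ p + D = y *+ (wtw u + wtw v) -> y *+ n.+1 = - D.
  rewrite -pE mulrnDr -addrA => e; have /addrI/eqP := etrans e (esym (addr0 _)).
  by rewrite addr_eq0 => /eqP.
by rewrite mulrnBl (aux _ _ qE) (aux _ _ zE) subrr.
Qed.
End TL.
End Isobaric.

(** * One-letter series *)

Section OneLetter.
Variables (T : eqType) (K : comPzRingType) (a : T).
Implicit Types f g : series T K.

Definition onel f := forall w, ~~ all (pred1 a) w -> f w = 0.

Lemma onel_lq b f : onel f -> onel (lq b f).
Proof. by move=> of_ w nw; apply: of_; rewrite /= negb_and nw orbT. Qed.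

Lemma onel_lq_ne b f : b != a -> onel f -> lq b f = 0.
Proof. by move=> ne of_; apply/funext => w; apply: of_; rewrite /= negb_and ne. Qed.

Lemma onelM f g : onel f -> onel g -> onel (f * g).
Proof.
move=> of_ og w; elim: w f of_ => [|b w IH] f of_ //= nw.
rewrite serM_cons og // mulr0 add0r; move: nw; rewrite negb_and => /orP[ne|nw].
  by rewrite onel_lq_ne // mul0r.
by apply: IH => //; apply: onel_lq.
Qed.

Lemma onel_sg f : onel f -> onel (sg f).
Proof. by move=> of_ w nw; rewrite /sg of_ ?mulr0 // all_rev. Qed.

Lemma onelE f w : onel f -> f w = if all (pred1 a) w then f (nseq (size w) a) else 0.
Proof.
by move=> of_; case: ifP => [/all_pred1P <- //|/negbT]; apply: of_.
Qed.

Lemma onel_inv f g : f [::] = 1 -> onel f -> f * g = 1 -> onel g.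
Proof.
move=> f1 of_ fg w; have [n] := ubnP (size w); elim: n w => // n IH w lt_n nw.
case: w nw lt_n => [//|b w] nw lt_n.
have := congr1 (fun h : series T K => h (b :: w)) fg.
rewrite serM_cons f1 mul1r => /eqP; rewrite addr_eq0 => /eqP->.
apply/eqP; rewrite oppr_eq0; apply/eqP.
have [ba|ne] := eqVneq b a; last by rewrite onel_lq_ne // mul0r.
have nw' : ~~ all (pred1 a) w by move: nw; rewrite /= ba eqxx.
have ol := onel_lq b of_; move: (lq b f) ol => h oh.
have sz u : (size u <= size w)%N -> ~~ all (pred1 a) u -> g u = 0.
  by move=> le_u; apply: IH; move: lt_n => /=; lia.
elim: w {lt_n nw} nw' h oh sz => [|c w IHw] //= nw h oh sz.
rewrite serM_cons sz // mulr0 add0r; move: nw; rewrite negb_and => /orP[ne|nw].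
  by rewrite onel_lq_ne // mul0r.
by apply: IHw => //; [apply: onel_lq|move=> u le_u; apply: sz; apply: leqW].
Qed.

End OneLetter.

Lemma all_iw s : all (pred1 true) (iw s) = all (pred1 0%N) s.
Proof.
by elim: s => //= n s IH; rewrite all_cat /= IH all_nseq /= orbF.
Qed.

(** * The key computation *)

Section KeyComputation.
Variable K : comPzRingType.
Hypothesis tf : forall n (x : K), x *+ n.+1 = 0 -> x = 0.
Local Notation H := (series alphX K).
Local Notation x0 := (let_ K (false : alphX)).
Local Notation x1 := (let_ K (true : alphX)).

Lemma qst_onel_x0 (f : H) v : onel true f -> qst f [:: false : alphX] v = 0.
Proof.
elim: v f => [|b v IH] f of_; first by rewrite qstu0 of_.
rewrite qst_cons (onel_lq_ne _ of_) // qst0 mulr0n add0r addr0.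
exact/IH/onel_lq.
Qed.

Lemma nseq_rcons (T : Type) n (x : T) : nseq n.+1 x = rcons (nseq n x) x.
Proof. by elim: n => //= n <-. Qed.

Lemma iw_rcons n s : exists v, iw (n :: s) = rcons v true.
Proof.
elim: s n => [|m s IH] n; first by exists (nseq n false); rewrite /= cats1.
have [v vE] := IH m; exists (nseq n false ++ true :: v).
by rewrite [LHS]/= -/(iw (m :: s)) vE rcons_cat.
Qed.

(** The word x_1 iw(w) is the reversal of iw(rev w) followed by x_1; the sign (-1)^p of the antipode
    is the substitution r -> -r. *)
Lemma tr_alt (F : H) :
  tr (sg F * x1) = fun w => alt (tl F (rev w)).
Proof.
apply/funext => w; apply/cfP => p; rewrite !cf_mkp.
have -> : wtw (rev w) = wtw w by rewrite /wtw map_rev sumn_rev.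
case: ifP => [le_wp|_]; last by rewrite mulr0.
rewrite rev_iw -rcons_cat Mlet_rcons eqxx /sg rev_cat revK rev_nseq; congr (_ ^+ _ * _).
rewrite size_cat size_nseq size_rev size_iw.
have -> : wtw (rev w : seq alphY) = wtw w by rewrite /wtw map_rev sumn_rev.
by rewrite subnK.
Qed.

Variables (Phi Gam : H).
Hypothesis cPhi : character Phi.
Hypothesis Phi0 : Phi [:: false] = 0.
Hypothesis Phi1 : Phi [:: true] = 0.
Hypothesis Phi01 : Phi [:: false; true] = 0.
Hypothesis oG : onel true Gam.
Hypothesis G0 : Gam [::] = 1.
Hypothesis G1 : Gam [:: true] = 0.
Let F := Gam * Phi.
Hypothesis cF : character (pi F).
Let E := Gam * sg Gam.
Let g := sg F * x1.
(** By [tlYtr] the coefficient of r^p at a word of weight p + a + 1 is that of F x_0^a S(F) x_1, S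
    being the antipode: all these projections are packed into one series, a product of three stuffle
    characters over K[[r]]. *)
Let L := tl F * (@Yone K * tr g).
Let Lc p : series alphY K := fun w => cf (L w) p.
Let e p := E (nseq p true).

Let F0 v : qst F [:: false : alphX] v = 0.
Proof.
have -> : qst F [:: false : alphX] v = delta F [:: false : alphX] v by [].
rewrite deltaM serM_cons serM_nil serD.
have -> : delta Phi [:: false : alphX] = 0.
  by apply/funext => u; rewrite /delta (proj2 cPhi) Phi0 mul0r.
have -> : lq (false : alphX) (delta Gam) [::] = 0.
  by apply/funext => u; apply: qst_onel_x0.
by rewrite mulr0 mul0r addr0.
Qed.

Let g_nseq m : g (nseq m false) = 0.
Proof.
case: m => [|m]; first exact: Mlet_nil.
have -> : nseq m.+1 false = rcons (nseq m false) false by apply: nseq_rcons.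
exact: Mlet_rcons.
Qed.

Let FsgF : F * sg F = E.
Proof. by rewrite /F sgM mulrA -(mulrA Gam) M1sg // mulr1. Qed.

Let L_def : L = tl F * (@Yone K * (fun w => alt (tl F (rev w)))).
Proof. by rewrite /L /g tr_alt. Qed.

Let cL : character L.
Proof.
have [c1 cc] := character_tl tf F0 cF.
rewrite L_def; apply: characterM; first by split.
apply: characterM; first exact: character_Yone.
split=> [|u v]; first by rewrite c1; apply/cfP => -[|p]; rewrite cf_mkp ?mul1r // cf1 mulr0.
rewrite (qst_map (@altD K) (fun w => tl F (rev w))) qst_rev cc.
exact: altM.
Qed.

Let iL w : euler (L w) + dT L w = L w *+ wtw w.
Proof.
rewrite L_def; apply: isobaricM; first exact: isobaric_tl.
apply: isobaricM; first exact: isobaric_Yone.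
exact/isobaric_rev/isobaric_tl.
Qed.

Let Lc_pos a p w : wtw w = (p + a.+1)%N -> Lc p w = (F * (Xn K a * g)) (iw w).
Proof. exact: tlYtr. Qed.

Let oE : onel true E. Proof. by apply/onelM/onel_sg. Qed.

(** For a = 0 the series is F S(F) x_1 = E x_1, supported on powers of x_1. *)
Let Lc_a1 p w : wtw w = p.+1 -> Lc p w = if all (pred1 0%N) w then e p else 0.
Proof.
move=> wE; rewrite (@Lc_pos 0) ?wE ?addn1 // /Xn expr0 mul1r /g mulrA FsgF.
have sz := size_iw w.
case: w wE sz => [//|n w] wE sz; rewrite -all_iw.
have [v vE] := iw_rcons n w; rewrite vE Mlet_rcons eqxx all_rcons /= (onelE _ oE).
move: sz; rewrite vE size_rcons wE => -[->]; exact: erefl.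
Qed.

(** At r = 0 the outer factors of L become 1 and [Yone] remains. *)
Let Lc_0 w : Lc 0 w = (size w <= 1)%N%:R.
Proof.
pose c0 (X : series alphY (pser K)) : series alphY K := fun u => cf (X u) 0.
have c0M X Y : c0 (X * Y) = c0 X * c0 Y.
  have cM (x y : pser K) : cf (x * y) 0 = cf x 0 * cf y 0 by rewrite cfM big_ord1.
  apply/funext => u; rewrite /c0; elim: u X => [|a u IH] X.
    by rewrite !serM_nil cM.
  by rewrite !serM_cons cfD cM IH.
have F_nil : F [::] = 1 by rewrite /F serM_nil G0 (proj1 cPhi) mulr1.
have t0 u : cf (tl F u) 0 = (u == [::])%:R.
  by rewrite cf_mkp leqn0 wtw_eq0; case: eqP => // ->.
have -> : Lc 0 w = c0 L w by [].
rewrite L_def !c0M.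
have -> : c0 (tl F) = 1 by apply/funext => u; rewrite ser1E -t0.
have -> : c0 (fun u => alt (tl F (rev u))) = 1.
  apply/funext => u; rewrite ser1E /c0 cf_mkp expr0 mul1r t0.
  by rewrite -!size_eq0 size_rev.
rewrite mul1r mulr1 /c0 /Yone; case: (_ <= _)%N; [exact: cf1|exact: cf0].
Qed.

Let Lc_nil p : (0 < p)%N -> Lc p [::] = 0.
Proof. by case: p => // p _; rewrite /Lc (proj1 cL) cf1. Qed.

Let Lc_char p u v : qst (Lc p) u v = \sum_(q < p.+1) Lc q u * Lc (p - q) v.
Proof. by rewrite /Lc -cf_qst (proj2 cL) cfM. Qed.

Let Lc_dT p w : Lc p w *+ p + dT (Lc p) w = Lc p w *+ wtw w.
Proof.
have := congr1 (fun x : pser K => cf x p) (iL w).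
by rewrite cfD cfMn cf_mkp cf_dT.
Qed.

Let e1 : e 1 = 0.
Proof.
by rewrite /e /E serM_cons serM_nil /sg /lq /= G0 G1 expr1 !(mulr0, mul0r) addr0.
Qed.

(** Here zeta(2) = 0 enters: y_1 * y_1 = 2 y_1 y_1 + y_2 forces Gam to vanish at x_1 x_1. *)
Let e2 : e 2 = 0.
Proof.
have [_ cc] := cF; have := cc [:: 0%N] [:: 0%N].
have F1 : pi F [:: 0%N] = 0.
  by rewrite /pi /= /F serM_cons serM_nil /lq G0 G1 Phi1 mulr0 mul0r addr0.
rewrite F1 mul0r /= /lq /opY /= !addn0 mulr1n.
have -> : pi F [:: 1%N] = 0.
  by rewrite /pi /= /F serM_cons Phi01 mulr0 add0r (onel_lq_ne _ oG) // mul0r.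
have P11 : Phi [:: true; true] = 0.
  have := (proj2 cPhi) [:: true] [:: true]; rewrite Phi1 mul0r /= mulr0n addr0.
  by rewrite /lq -mulr2n => /tf.
have -> : pi F [:: 0%N; 0%N] = Gam [:: true; true].
  rewrite /pi /= /F !serM_cons serM_nil /lq /= Phi1 P11 (proj1 cPhi).
  by rewrite !mulr0 mulr1 !add0r.
rewrite addr0 -mulr2n => /tf GG.
rewrite /e /E !serM_cons serM_nil /sg /lq /= G0 G1 GG.
by rewrite !(mulr0, mul0r, addr0).
Qed.

Let qst_ones (x : K) m n :
  qst ((fun w : seq nat => if all (pred1 0%N) w then x else 0) : series alphY K)
    (nseq m (0%N : alphY)) (nseq n (0%N : alphY)) = x *+ 'C(m + n, m).
Proof.
elim: m n => [|m IHm] n.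
  by rewrite bin0 /= all_nseq orbT mulr1n.
elim: n => [|n IHn].
  by rewrite addn0 binn qstu0 all_nseq orbT.
rewrite [nseq m.+1 _]/= [nseq n.+1 _]/= qst_cons.
set Q : series alphY K := fun w => _; have -> : lq (0%N : alphY) Q = Q by [].
have -> : lq (op (0%N : alphY) (0%N : alphY)) Q = 0 by [].
rewrite qst0 mul0rn addr0 [qst Q (nseq _ _) _](IHm n.+1) [qst Q _ _]IHn.
by rewrite [(m.+1 + n)%N]addSnnS [(m.+1 + n.+1)%N]addSn binS mulrnDr addrC.
Qed.

(** Strong induction on p. On short words [Lc_char] then keeps only its terms q = 0 and q = p;
    testing it on powers of y_1 gives e p = 0, that is vanishing in weight p + 1, from which weight
    p and the lower weights follow. *)
Let Lc_vanish p : (0 < p)%N -> e p = 0 /\ forall w, (wtw w <= p)%N -> Lc p w = 0.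
Proof.
have [N] := ubnP p; elim: N p => // N IH p; rewrite ltnS => le_pN p_gt0.
(* For 0 < q < p either wt u <= q or wt v <= p - q, so the induction hypothesis kills the term. *)
have mid u v : (0 < size u)%N -> (0 < size v)%N -> (wtw u + wtw v <= p.+1)%N ->
    qst (Lc p) u v = Lc 0 u * Lc p v + Lc p u * Lc 0 v.
  move=> su sv le_uv; rewrite Lc_char; case: p p_gt0 le_pN le_uv => // p _ le_pN le_uv.
  rewrite big_ord_recl big_ord_recr /= subn0 subnn addrA big1 ?addr0 // => i _.
  have := ltn_ord i; rewrite /bump /= add1n => lt_i.
  have [le1|gt1] := leqP (wtw u) i.+1.
    by rewrite (proj2 (IH i.+1 _ _)) ?mul0r //; lia.
  by rewrite (proj2 (IH (p.+1 - i.+1)%N _ _)) ?mulr0 //; lia.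
(* For p >= 3 both y_1^2 and y_1^(p-1) have at least two letters, where [Lc 0] vanishes, while their
   product yields a positive binomial multiple of e p. *)
have ones_case : (1 < p)%N -> e p = 0.
  case: p p_gt0 le_pN mid => [//|[//|[_ _ _ _|p _ _ mid _]]]; first exact: e2.
  have wn k : wtw (nseq k (0%N : alphY)) = k by elim: k => //= k IHk; rewrite wtw_cons IHk.
  have : qst (Lc p.+3) (nseq 2 (0%N : alphY)) (nseq p.+2 (0%N : alphY)) = 0.
    by rewrite mid ?wn // !Lc_0 /= mul0r mulr0 addr0.
  have -> : qst (Lc p.+3) (nseq 2 (0%N : alphY)) (nseq p.+2 (0%N : alphY)) =
      e p.+3 *+ 'C(2 + p.+2, 2).
    rewrite -qst_ones; apply: qst_wt => w wE; apply: Lc_a1.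
    by rewrite wE !wn.
  have: (0 < 'C(2 + p.+2, 2))%N by rewrite bin_gt0.
  by case: 'C(_, _) => // k _ /tf.
have ep : e p = 0.
  have [/ones_case//|le1] := ltnP 1 p.
  by have -> : p = 1%N; [lia|exact: e1].
have Lp1 w : wtw w = p.+1 -> Lc p w = 0 by move=> wE; rewrite Lc_a1 // ep if_same.
have mid1 u v : (0 < size u)%N -> (0 < size v)%N -> (wtw u + wtw v)%N = p.+1 ->
    Lc 0 u * Lc p v + Lc p u * Lc 0 v = 0.
  move=> su sv wuv; rewrite -mid ?wuv //; rewrite -[RHS](qst0 K u v); apply: qst_wt => w wE.
  by apply: Lp1; rewrite wE.
(* Below weight p descend by [Lc_dT]: up to sign, (p - wt w) Lc p w is a value of dT (Lc p), hence
   involves weight one more. *)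
suff top w : wtw w = p -> Lc p w = 0.
  split=> // w /subnKC; move: (p - _)%N => k; elim: k w => [|k IHk] w wE.
    by apply: top; rewrite -wE addn0.
  apply: (tf (n := k)); have := Lc_dT p w.
  have -> : dT (Lc p) w = 0.
    by rewrite -[RHS](dT0 K w); apply: dT_wt => u uE; apply: IHk; rewrite uE -wE addnS addSn.
  have -> : Lc p w *+ p = Lc p w *+ wtw w + Lc p w *+ k.+1 by rewrite -mulrnDr wE.
  by rewrite addr0 => e'; have := addrI _ (etrans e' (esym (addr0 _))).
have L1 : wtw [:: 0%N : alphY] = 1%N by [].
(* Use y_1 as the other factor: [Lc 0] is 1 at y_1 and 0 at w'. *)
have big w' : wtw w' = p -> (1 < size w')%N -> Lc p w' = 0.
  move=> wE sz; have := mid1 [:: 0%N] w' isT (ltnW sz); rewrite L1 wE => /(_ (erefl _)).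
  by rewrite !Lc_0 [(size w' <= 1)%N]leqNgt sz /= mul1r mulr0 addr0.
case: w => [|n [|m w]] wE; first by rewrite -wE in p_gt0.
  2: exact: big.
rewrite wtw_cons addn0 [wt _]/= in wE.
have s0 : Lc p [:: n] + Lc p [:: 0%N] = 0.
  have := mid1 [:: 0%N] [:: n] isT isT; rewrite !Lc_0 mul1r mulr1 L1 wtw_cons addn0 [wt _]/= wE.
  exact.
case: n wE s0 => [|n] wE s0; first by apply: (tf (n := 1)); rewrite mulr2n.
(* For a single letter put X = Lc p at y_p. The relations s0 from y_1 * y_p, s1 from the weight
   equation at y_(p-1) and s2 from y_1 * y_(p-1) combine to (p + 1) X = 0. *)
subst p; set p := n.+2.
have s1 : Lc p [:: n] + Lc p [:: n.+1] *+ n.+1 = 0.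
  have := Lc_dT p [:: n]; rewrite dT_cons addr0 wtw_cons addn0 [wt _]/=.
  have -> : Lc p [:: n] *+ p = Lc p [:: n] *+ n.+1 + Lc p [:: n] by rewrite -mulrSr.
  by rewrite -addrA => e'; have := addrI _ (etrans e' (esym (addr0 _))).
have s2 : Lc p [:: n.+1] = Lc p [:: n] + Lc p [:: 0%N].
  have := mid [:: 0%N] [:: n] isT isT; rewrite L1 wtw_cons addn0 [wt _]/= => /(_ (leqnSn _)).
  rewrite !Lc_0 mul1r mulr1 [qst _ _ _]/= /lq /opY mulr1n !add0n => <-.
  rewrite (big [:: 0%N; n]) ?(big [:: n; 0%N]) ?add0r // !wtw_cons addn0 //=.
  by rewrite /p; lia.
apply: (tf (n := n.+2)).
transitivity ((Lc p [:: n] + Lc p [:: 0%N]) + (Lc p [:: n.+1] + Lc p [:: n.+1] *+ n.+1)).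
  by rewrite -s2 -!mulrS.
by rewrite addrC [X in _ + X]addrC addrACA s0 add0r addrC s1.
Qed.

Lemma F_invl : F * sg F = 1.
Proof.
rewrite FsgF; apply/funext => w; rewrite (onelE w oE) ser1E.
case: w => [|b w]; first by rewrite /= /E serM_nil sg_nil G0 mulr1.
by rewrite -/(e _) (proj1 (@Lc_vanish (size (b :: w)) isT)) if_same.
Qed.

Lemma F_invr : sg F * F = 1.
Proof.
have F1 : F [::] = 1 by rewrite /F serM_nil G0 (proj1 cPhi) mulr1.
apply/eqP; rewrite -subr_eq0; apply/eqP; apply: (ser_nonzerodiv F1).
by rewrite mulrBr mulrA F_invl mul1r mulr1 subrr.
Qed.

(* L_(m+1) of the header. *)
Definition Lm (m : alphY) : series alphY K := pi (F * Xn K m * sg F * x1).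

Lemma Lm_small m w : (wtw w <= m)%N -> Lm m w = 0.
Proof.
move=> le_wm; have -> : Lm m w = (F * (Xn K m * g)) (iw w) by rewrite /Lm /pi /g !mulrA.
suff : serF alphX (@trivF K) m.+1 (F * (Xn K m * g)).
  by case/(_ (iw w)) => [|//]; rewrite wtw_X size_iw; lia.
apply: FilMr; apply/serFP => u; have [le_um|lt_mu] := leqP (size u) m.
  by right; apply: XnM_small => //; apply: (g_nseq 0).
by left; rewrite wtw_X; lia.
Qed.

Lemma wtLm m : serF alphY trivF (wt m) (Lm m).
Proof.
move=> w; have [le_wm|lt_mw] := leqP (wtw w) m; first by right; apply: Lm_small.
by left; rewrite /=; lia.
Qed.

Let LmE m p w : wtw w = (p + m.+1)%N -> Lm m w = Lc p w.
Proof. by move=> wE; rewrite (Lc_pos wE) /Lm /pi /g !mulrA. Qed.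

Lemma sum_lsY (V : nmodType) N (X : nat -> V) :
  \sum_(b <- ls alphY N.+1) X b = \sum_(b < N) X b.
Proof.
elim: N => [|N IH]; first by rewrite big_ord0 big_nil.
by rewrite [ls _ _]/(ls alphY N.+1 ++ [:: N]) big_cat big_seq1 IH big_ord_recr.
Qed.

(** This is [Lc_char] with q = wt u - 1 - b. The terms with q >= wt u correspond to no letter b, and
    [Lc_vanish] removes them. *)
Let Lm_char a u v : (0 < size u)%N -> (0 < size v)%N ->
  qst (Lm a) u v = \sum_(b < a) Lm (b : nat) u * Lm (a - b.+1)%N v.
Proof.
move=> su sv; have wpos x : (0 < size x)%N -> (0 < wtw (x : seq alphY))%N.
  by case: x => // b x _; rewrite wtw_cons.
have [le_a|lt_a] := leqP (wtw u + wtw v) a.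
  rewrite big1 => [|b _].
    rewrite -[RHS](qst0 K u v); apply: qst_wt => w wE; apply: Lm_small.
    by rewrite wE.
  have := ltn_ord b => lt_b; have [le_b|gt_b] := leqP (wtw u) b.
    by rewrite (Lm_small le_b) mul0r.
  by rewrite [X in _ * X]Lm_small ?mulr0 //; lia.
have [p pE] : {p | (wtw u + wtw v = p + a.+1)%N} by exists (wtw u + wtw v - a.+1)%N; lia.
have -> : qst (Lm a) u v = qst (Lc p) u v.
  by apply: qst_wt => w wE; apply: LmE; rewrite wE.
rewrite Lc_char; pose f q := if (q <= p)%N then Lc q u * Lc (p - q) v else 0.
pose h b := if (b < a)%N then Lm b u * Lm (a - b.+1)%N v else 0.
have van q w : (0 < size w)%N -> (wtw w <= q)%N -> Lc q w = 0.
  move=> sw le_q; apply: (proj2 (@Lc_vanish q _) _ le_q).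
  exact: leq_trans (wpos _ sw) le_q.
transitivity (\sum_(q < wtw u) f q).
  rewrite (eq_bigr (fun q : 'I_p.+1 => f q)) => [|q _]; last by rewrite /f leq_ord.
  apply: (@sum_ord_tail _ f) => q le_q; rewrite /f; first by rewrite leqNgt le_q.
  by rewrite van // mul0r if_same.
transitivity (\sum_(b < wtw u) h b); last first.
  rewrite [RHS](eq_bigr (fun b : 'I_a => h b)) => [|b _]; last by rewrite /h ltn_ord.
  apply: (@sum_ord_tail _ h) => b le_b; rewrite /h; last by rewrite ltnNge le_b.
  by rewrite Lm_small // mul0r if_same.
rewrite (reindex_inj rev_ord_inj) /=; apply: eq_bigr => b _; have := ltn_ord b => lt_b.
rewrite /f /h; case: ifP => [le_qp|/negbT gt_qp]; case: ifP => [lt_ba|/negbT ge_ba] //.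
- by congr (_ * _); apply/esym/LmE; lia.
- by rewrite [X in _ * X]van ?mulr0 //; have := wpos _ sv; lia.
- by rewrite [X in _ * X]Lm_small ?mulr0 //; lia.
Qed.

Lemma Lm_compat (a : alphY) u v N : (wtw u + wtw v < N)%N -> (wt a < N)%N ->
  qst (Lm a) u v = Lm a u * (v == [::])%:R + (u == [::])%:R * Lm a v +
   (\sum_(b <- ls alphY N) \sum_(c <- ls alphY N)
      if op b c == a then Lm b u * Lm c v else 0) *+ merge alphY.
Proof.
have L0 m : Lm m [::] = 0 by apply: Lm_small.
case: u => [|x u].
  rewrite L0 mul0r add0r mul1r big1 ?addr0 // => b _; rewrite big1 // => c _.
  by rewrite L0 mul0r if_same.
case: v => [|y v].
  rewrite mulr1 mul0r addr0 qstu0 big1 ?addr0 // => b _; rewrite big1 // => c _.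
  by rewrite L0 mulr0 if_same.
case: N => [//|N] _; rewrite Lm_char // [wt a]/= ltnS => lt_aN.
rewrite mulr0 mul0r !add0r mulr1n.
rewrite (sum_lsY N (fun b => \sum_(c <- ls alphY N.+1) if opY b c == a then Lm b (x :: u) * Lm c (y :: v) else 0)).
pose h b := if (b < a)%N then Lm b (x :: u) * Lm (a - b.+1)%N (y :: v) else 0.
transitivity (\sum_(b < N) h b).
  rewrite (eq_bigr (fun b : 'I_a => h b)) => [|b _]; last by rewrite /h ltn_ord.
  apply: (@sum_ord_tail _ h) => b le_b; rewrite /h; first by rewrite ltnNge le_b.
  by rewrite ltnNge (leq_trans (ltnW lt_aN) le_b).
apply: eq_bigr => b _; rewrite /h; case: ifP => [lt_ba|/negbT ge_ba]; last first.
  by rewrite big1 // => c _; case: eqP => // e'; move: ge_ba; rewrite -e' /opY; lia.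
rewrite -(@sum_ls_pick alphY _ N.+1 (a - b.+1)%N (fun c : nat => Lm b (x :: u) * Lm c (y :: v))) /=; last by lia.
by apply: eq_bigr => c _; congr (if _ then _ else _); apply/eqP/eqP; rewrite /opY; lia.
Qed.

End KeyComputation.

(** * Stability of the double shuffle equations *)

Section YinX.
Variable K : comPzRingType.
Local Notation H := (series alphX K).
Local Notation W := (series alphY K).
Local Notation x0 := (let_ K (false : alphX)).
Local Notation x1 := (let_ K (true : alphX)).

Definition yx (m : alphY) : H := Xn K m * x1.
Definition jX : W -> H := subst yx.

Lemma wt_yx m : serF alphX trivF (wt m) (yx m).
Proof.
move=> u; have [le_um|lt_mu] := leqP (size u) m.
  by right; apply: XnM_small => //; apply: let_nil.
by left; move: lt_mu; rewrite wtw_X /=; lia.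
Qed.

(** Prefixing whole blocks x_0^m x_1 leaves the block decomposition of the rest unchanged, so [pi]
    is left linear over series in Y. *)
Lemma pi_jXM P (f : H) : pi (jX P * f) = P * pi f.
Proof.
apply/funext => w; elim: w P => [|n w IH] P.
  rewrite /pi /= serM_nil [RHS]serM_nil; congr (_ * _).
  have := subst_recursive wt_yx 1 P [::]; case=> // /subr0_eq; rewrite -/(jX P) => ->.
  rewrite serD ser_sum big1 ?addr0 // => m _.
  by rewrite serM_nil /yx XnM_small ?mul0r //; apply: let_nil.
set N := (size (iw (n :: w))).+1.
have := FilMl f (subst_recursive wt_yx N P) => /(_ (iw (n :: w))).
case=> [|e]; first by rewrite wtw_X subSnn.
have -> : pi (jX P * f) (n :: w) = P [::] * pi f (n :: w) +
    \sum_(m <- ls alphY N) if n == m then (jX (lq m P) * f) (iw w) else 0.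
  move: e; rewrite mulrBl => /subr0_eq; rewrite /pi => ->.
  rewrite mulrDl serD cstM_E mulr_suml ser_sum; congr (_ + _).
  apply: eq_bigr => m _; rewrite /yx -!mulrA XnM_E.
  have [lt_nm|lt_mn|e'] := ltngtP n m.
  - by case E: (m - n)%N => [|k]; [lia|rewrite XnM_true ?letM_nil].
  - by case E: (n - m)%N => [|k]; [lia|rewrite letM_cons].
  - by rewrite -e' subnn letM_cons eqxx.
rewrite (sum_ls_pick (fun m => (jX (lq m P) * f) (iw w))); last first.
  by rewrite /N /= size_cat size_nseq /=; lia.
by rewrite serM_cons; congr (_ + _); apply: IH.
Qed.

Lemma jX_iw P s : jX P (iw s) = P s.
Proof.
have := congr1 (fun f : W => f s) (pi_jXM P 1).
rewrite mulr1 {1}/pi => ->; rewrite (_ : pi 1 = 1) ?mulr1 //.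
apply/funext => -[|n w] //; rewrite /pi; have [v ->] := iw_rcons n w.
by rewrite !ser1E -size_eq0 size_rcons.
Qed.

Lemma iw_exists v : exists s, iw s = rcons v true.
Proof.
elim: v => [|[] v [s sE]]; first by exists [:: 0%N].
  by exists (0%N :: s); rewrite /= sE.
case: s sE => [|n s] sE; first by case: v sE.
by exists (n.+1 :: s); rewrite /= -sE.
Qed.

Lemma word_X (v : seq bool) : (exists s, v = iw s) \/ exists u, v = rcons u false.
Proof.
case/lastP: v => [|v []]; first by left; exists [::].
  by left; have [s sE] := iw_exists v; exists s.
by right; exists v.
Qed.

Lemma jX_rcons P v : jX P (rcons v false) = 0.
Proof.
pose rho (f : H) : H := fun u => f (rcons u false).
suff r0 : rho (jX P) = 0 by have := congr1 (fun f : H => f v) r0.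
apply: (@Fil_sep _ (serF alphX trivF)) => n; elim: n P => [|n IH] P; first exact: Fil_0.
have FP : serF alphX trivF n.+1 (rho (jX P) -
    rho (cst (P [::]) + \sum_(m <- ls alphY n.+2) yx m * jX (lq m P))).
  move=> u; have := subst_recursive wt_yx n.+2 P (rcons u false).
  by apply: Fil_le; rewrite !wtw_X size_rcons; lia.
rewrite -[rho _]subr0; apply: Fil_trans FP _; rewrite subr0.
have -> : rho (cst (P [::]) + \sum_(m <- ls alphY n.+2) yx m * jX (lq m P)) =
    \sum_(m <- ls alphY n.+2) yx m * rho (jX (lq m P)).
  apply/funext => u; rewrite /rho serD !ser_sum.
  rewrite (_ : cst _ _ = 0) ?add0r; last by case: u.
  apply: eq_bigr => m _; rewrite serM_rcons /yx Mlet_rcons mul0r add0r.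
  by [].
apply: Fil_sum => m _; rewrite -add1n; apply: FilM; last exact: IH.
by apply: Fil_le (wt_yx m).
Qed.

Lemma jX_pi (f : H) : (forall v, f (rcons v false) = 0) -> jX (pi f) = f.
Proof.
move=> f0; apply/funext => v; have [[s ->]|[u ->]] := word_X v; first exact: jX_iw.
by rewrite jX_rcons f0.
Qed.

Lemma pi_Mx0 (f : H) : pi (f * x0) = 0.
Proof.
apply/funext => -[|n w]; rewrite /pi; first by rewrite Mlet_nil.
by have [v ->] := iw_rcons n w; rewrite Mlet_rcons.
Qed.

Lemma split_x0 (f : H) : f = jX (pi f) + ((fun u => f (rcons u false)) : H) * x0.
Proof.
apply/funext => v; rewrite serD; have [[s ->]|[u ->]] := word_X v.
  by rewrite jX_iw -[X in _ + X]/(pi _ s) pi_Mx0 addr0.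
by rewrite jX_rcons Mlet_rcons add0r.
Qed.

Lemma pi_let1 : pi x1 = let_ K (0%N : alphY).
Proof.
apply/funext => -[|n w] //; rewrite /pi /let_ eqseq_cons.
case: n => [|n] //=; rewrite eqseq_cons /=.
by case: w => [|m w] //=; case: m.
Qed.

Lemma onel_pi (f : H) : onel true f -> onel 0%N (pi f).
Proof. by move=> of_ w nw; apply: of_; rewrite all_iw. Qed.

Lemma onel_jX_pi (f : H) : onel true f -> jX (pi f) = f.
Proof. by move=> of_; apply: jX_pi => v; apply: of_; rewrite all_rcons. Qed.

Lemma onel_letC (T : eqType) (a : T) (f : series T K) : onel a f -> f * let_ K a = let_ K a * f.
Proof.
move=> of_; apply/funext => w; elim: w f of_ => [|b w IH] f of_.
  by rewrite letM_nil Mlet_nil.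
rewrite serM_cons letM_cons; have [ba|ne] := eqVneq b a; last first.
  by rewrite (onel_lq_ne ne of_) mul0r addr0 /let_ eqseq_cons (negPf ne) mulr0.
rewrite IH; last exact: onel_lq.
case: w {IH} => [|c w]; first by rewrite letM_nil addr0 ba /let_ eqxx mulr1.
rewrite letM_cons /let_ eqseq_cons andbF mulr0 add0r ba.
case: eqP => [->|/eqP ne] //; apply/esym/of_.
by rewrite /= negb_and ne.
Qed.

End YinX.

Lemma conjM (R : pzRingType) (f g a b : R) :
  g * f = 1 -> f * (a * b) * g = f * a * g * (f * b * g).
Proof. by move=> gf; rewrite !mulrA -(mulrA _ g f) gf mulr1. Qed.

(** * The product star after projection to words in Y *)

Section StarPi.
Variable K : comPzRingType.
Hypothesis tf : forall n (x : K), x *+ n.+1 = 0 -> x = 0.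
Local Notation H := (series alphX K).
Local Notation W := (series alphY K).
Local Notation x0 := (let_ K (false : alphX)).
Local Notation x1 := (let_ K (true : alphX)).

Variables (Phi Gam Psi : H) (C P : W).
Hypothesis cPhi : character Phi.
Hypothesis Phi0 : Phi [:: false] = 0.
Hypothesis Phi1 : Phi [:: true] = 0.
Hypothesis Phi01 : Phi [:: false; true] = 0.
Hypothesis oG : onel true Gam.
Hypothesis G0 : Gam [::] = 1.
Hypothesis G1 : Gam [:: true] = 0.
Let F := Gam * Phi.
Hypothesis cF : character (pi F).
Hypothesis oC : onel 0%N C.
Hypothesis cP : character P.
Hypothesis Psi_CP : pi Psi = C * P.

Let FsgF : F * sg F = 1. Proof. exact: F_invl. Qed.
Let sgFF : sg F * F = 1. Proof. exact: F_invr. Qed.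

Let GsgG : Gam * sg Gam = 1.
Proof. by rewrite -FsgF /F sgM mulrA -(mulrA Gam) (M1sg cPhi) mulr1. Qed.

Let sgGG : sg Gam * Gam = 1.
Proof.
apply/eqP; rewrite -subr_eq0; apply/eqP; apply: (ser_nonzerodiv G0).
by rewrite mulrBr mulrA GsgG mul1r mulr1 subrr.
Qed.

(** Conjugating by Gam replaces Phi by F ([Gb_B]) and still fixes x_1, because Gam is a series in
    x_1. *)
Let LB (x : alphX) : H := if x then x1 else F * x0 * sg F.
Let B := subst LB.
Let beta := subst (Lm Phi Gam).

Let wtB x : serF alphX trivF (wt x) (LB x).
Proof.
move=> [|a w]; last by left; rewrite wtw_X /=; lia.
by right; case: x; rewrite /= ?let_nil // serM_nil Mlet_nil mul0r.
Qed.

Let wtb : forall m, serF alphY trivF (wt m) (Lm Phi Gam m).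
Proof. exact: wtLm. Qed.

Let cc (A : alphabet) (L : A -> H) a c : L a * cst c = cst c * L a.
Proof. exact: comm_cst. Qed.

(** B maps x_0^m x_1 to F x_0^m F^-1 x_1; this ends in x_1 and is therefore recovered from its
    projection [Lm m]. *)
Let B_jX Q : B (jX Q) = jX (beta Q).
Proof.
rewrite /B /jX /beta !subst_comp //; try exact: wt_yx.
congr subst; apply/funext => m; rewrite /yx substM // subst_let //.
have -> : subst LB (Xn K m) = F * Xn K m * sg F.
  rewrite /Xn; elim: (m : nat) => [|n IH]; first by rewrite !expr0 subst1 // mulr1 FsgF.
  rewrite exprSr substM // IH subst_let // /LB.
  by rewrite (conjM _ _ sgFF).
by rewrite -[LHS]jX_pi // => v; rewrite Mlet_rcons.
Qed.

Let Gb_B Q : Gam * subst (twist Phi) Q * sg Gam = B Q.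
Proof.
have wt1 := wt_twist Phi.
pose Z Q := Gam * subst (twist Phi) Q * sg Gam.
suff rZ : recursive (serF alphX trivF) (@cst alphX K) (@ls alphX) LB id Z.
  exact: (recursive_uniq (wtL1 wtB) rZ (subst_recursive wtB)).
move=> N {}Q; have := FilMl (sg Gam) (FilMr Gam (subst_recursive wt1 N Q)).
rewrite mulrBr mulrBl mulrDr mulrDl comm_cst -[cst _ * _ * _]mulrA GsgG mulr1.
rewrite mulr_sumr mulr_suml /Z.
under eq_bigr => x _.
  have -> : Gam * (twist Phi x * subst (twist Phi) (lq x Q)) * sg Gam =
      LB x * (Gam * subst (twist Phi) (lq x Q) * sg Gam).
    rewrite (conjM _ _ sgGG); congr (_ * _); case: x.
      by rewrite /twist onel_letC // -mulrA GsgG mulr1.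
    by rewrite /twist /LB /F sgM !mulrA.
  over.
by [].
Qed.

(** The first letter is fixed, since pi (F F^-1 x_1) = y_1. *)
Let beta_onel D : onel 0%N D -> beta D = D.
Proof.
have L0 : Lm Phi Gam (0%N : alphY) = let_ K (0%N : alphY).
  by rewrite /Lm /Xn expr0 mulr1 FsgF mul1r pi_let1.
have lcc a c : Lm Phi Gam a * cst c = cst c * Lm Phi Gam a by apply: comm_cst.
move=> oD; apply: (@Fil_eq _ (serF alphY trivF)) => n; elim: n D oD => [|n IH] D oD.
  exact: Fil_0.
have DE : D = cst (D [::]) + let_ K (0%N : alphY) * lq (0%N : alphY) D.
  apply/funext => -[|m w]; rewrite serD ?letM_nil ?addr0 // letM_cons add0r.
  by case: eqP => [->|/eqP ne] //; apply: oD; rewrite /= negb_and ne.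
rewrite {1 2}DE /beta substD // subst_cst // substM // subst_let // L0.
rewrite opprD addrACA subrr add0r -mulrBr -add1n; apply: FilM.
  exact: serF_let.
exact/IH/onel_lq.
Qed.

(** Here star Phi Psi = Gam^-1 B(Psi) F. Splitting off the part psi x_0 of Psi ending in x_0 gives
    B(psi x_0) F = B(psi) F x_0, which [pi] kills; the rest comes from words in Y. *)
Lemma pi_star : pi (star Phi Psi) = (pi (sg Gam) * C) * (beta P * pi F).
Proof.
have lcc a c : Lm Phi Gam a * cst c = cst c * Lm Phi Gam a by apply: comm_cst.
have -> : star Phi Psi = sg Gam * (B Psi * F).
  rewrite -Gb_B /star /F !mulrA sgGG mul1r.
  by rewrite -(mulrA _ (sg Gam) Gam) sgGG mulr1.
rewrite [Psi in B Psi]split_x0 /B substD // substM // subst_let // -/B.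
set psi := (fun u => _) : H.
have -> : (B (jX (pi Psi)) + B psi * LB false) * F = B (jX (pi Psi)) * F + B psi * F * x0.
  by rewrite mulrDl /LB -!mulrA sgFF mulr1.
rewrite mulrDr piD [sg Gam * (_ * x0)]mulrA pi_Mx0 addr0.
rewrite -[sg Gam in LHS]onel_jX_pi; last exact: onel_sg.
rewrite pi_jXM B_jX pi_jXM Psi_CP /beta substM // -/beta beta_onel //.
by rewrite !mulrA.
Qed.

Lemma character_beta : character (beta P * pi F).
Proof.
apply: characterM => //; apply: subst_character => //.
by move=> a u v N ? ?; apply: Lm_compat.
Qed.

End StarPi.

(** * Regularization *)

Section Regularization.
Variable K : comPzRingType.
Hypothesis tf : forall n (x : K), x *+ n.+1 = 0 -> x = 0.
Local Notation H := (series alphX K).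
Local Notation W := (series alphY K).
Implicit Types (P Q Z Theta C : W) (u v w : seq alphY).

Definition convergent u := if u is a :: _ then a != 0%N else true.

(** P and Z are kept apart so that [Dy Psi] and Gam Psi can play the role of Z for the same P =
    Psi. *)
Definition h0linear P Z := forall u v, convergent u -> qst Z u v = P u * Z v.

(** For u nonempty and convergent, a term of u * v starts with y_1 only if that letter comes from v,
    as merged letters have index at least 2. So a left factor in y_1 acts through v alone. *)
Lemma h0linear_onel P Z C : P [::] = 1 -> h0linear P Z -> onel 0%N C -> h0linear P (C * Z).
Proof.
move=> P1 lZ oC [|a u] v cu; first by rewrite P1 mul1r.
elim: v C oC => [|b v IH] C oC.
  rewrite qstu0 serM_cons (onel_lq_ne cu oC) mul0r addr0 serM_nil.
  by rewrite -[Z (a :: u)]qstu0 lZ // mulrCA.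
have qZ c (X : W) x y : qst (cst c * X) x y = c * qst X x y.
  rewrite -(qst_map (mulrDr c)); apply: qst_wt => w _; exact: cstM_E.
have cab : op a b != 0%N by [].
rewrite qst_cons !lqM (onel_lq_ne cu oC) (onel_lq_ne cab oC) !mul0r !addr0.
rewrite qstD IH; last exact: onel_lq.
rewrite !qZ serM_cons mulrDr [P _ * (_ * _)]mulrCA -lZ // qst_cons.
by rewrite [in RHS]mulrDr [in RHS]mulrDr [in RHS]mulrnAr addrA [LHS](ACl (1*2*4*3)%AC).
Qed.

Lemma qst_ones_lead Theta k a u : (a : nat) != 0%N ->
  (forall i x, (i < k)%N -> convergent x -> Theta (nseq i 0%N ++ x) = 0) ->
  qst Theta (a :: u) (nseq k (0%N : alphY)) = Theta (nseq k 0%N ++ a :: u).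
Proof.
move=> a0; elim: k Theta => [|k IH] Theta T0; first by rewrite qstu0.
have l0 b : (b : nat) != 0%N -> lq (b : alphY) Theta = 0.
  by move=> b0; apply/funext => x; apply: (T0 0%N (b :: x)).
have lop : lq (op (a : alphY) (0%N : alphY)) Theta = 0 by apply: l0.
rewrite [nseq _ _]/= qst_cons (l0 a a0) lop !qst0 mul0rn add0r addr0 IH // => i x lt_i cx.
exact: (T0 i.+1).
Qed.

Lemma split_ones u : exists k x, u = nseq k 0%N ++ x /\ convergent x.
Proof.
elim: u => [|a u [k [x [-> cx]]]]; first by exists 0%N, [::].
have [->|ne] := eqVneq a 0%N; first by exists k.+1, x.
by exists 0%N, (a :: nseq k 0%N ++ x).
Qed.

(** Modulo words with fewer leading y_1, the word y_1^k x is the product x * y_1^k, on which Theta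
    is P(x) Theta(y_1^k) = 0. *)
Lemma h0linear_eq0 P Theta : h0linear P Theta -> (forall n, Theta (nseq n 0%N) = 0) -> Theta = 0.
Proof.
move=> lT T0; apply/funext => w; have [k [x [-> cx]]] := split_ones w.
have [n] := ubnP k; elim: n k x cx => // n IH k [|a u] cx lt_k; first by rewrite cats0 T0.
rewrite -qst_ones_lead //; first by rewrite lT // T0 mulr0.
by move=> i x lt_i cx'; apply: IH => //; lia.
Qed.

(** The k + 1 positions of y_1 among the leading ones all give y_1^(k+1) x; the remaining terms have
    at most k leading y_1. *)
Lemma qst_y1_lead Theta k x : convergent x ->
  (forall i y, (i <= k)%N -> convergent y -> Theta (nseq i 0%N ++ y) = 0) ->
  qst Theta [:: 0%N : alphY] (nseq k 0%N ++ x) = Theta (nseq k.+1 0%N ++ x) *+ k.+1.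
Proof.
move=> cx; elim: k Theta => [|k IH] Theta T0.
  case: x cx => [|a x] cx; first by rewrite qstu0.
  have l0 b : (b : nat) != 0%N -> lq (b : alphY) Theta = 0.
    by move=> b0; apply/funext => y; apply: (T0 0%N (b :: y)).
  have lop : lq (op (0%N : alphY) (a : alphY)) Theta = 0 by apply: l0.
  by rewrite [_ ++ _]/= qst_cons (l0 a cx) lop !qst0 mul0rn !addr0.
have l1 : lq (op (0%N : alphY) (0%N : alphY)) Theta = 0.
  by apply/funext => y; apply: (T0 0%N (1%N :: y)).
rewrite [nseq k.+1 _ ++ _]/= qst_cons l1 qst0 mul0rn addr0 IH; last first.
  by move=> i y le_i cy; apply: (T0 i.+1).
by rewrite [in RHS]mulrS.
Qed.

Lemma y1_kernel Theta : (forall x, convergent x -> Theta x = 0) ->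
  (forall v, qst Theta [:: 0%N : alphY] v = 0) -> Theta = 0.
Proof.
move=> T0 T1; apply/funext => w; have [k [x [-> cx]]] := split_ones w.
have [n] := ubnP k; elim: n k x cx => // n IH [|k] x cx lt_k; first exact: T0.
apply: (tf (n := k)); rewrite -qst_y1_lead ?T1 // => i y le_i cy.
by apply: IH => //; lia.
Qed.

(** The transpose of stuffle multiplication by y_1, a derivation because a one-letter word is cut
    only at its ends. *)
Definition Dy (P : W) : W := delta P [:: 0%N : alphY].

Lemma DyM P Q : Dy (P * Q) = P * Dy Q + Dy P * Q.
Proof. by rewrite /Dy deltaM serM_cons serM_nil. Qed.

Lemma Dy_swap P u v : qst (Dy P) u v = qst (delta P u) [:: 0%N : alphY] v.
Proof. by rewrite /Dy -qstA qstC qstA. Qed.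

Lemma Dy_onel C : onel 0%N C -> onel 0%N (Dy C).
Proof.
rewrite /Dy /delta => oC w; elim: w C oC => [|b w IH] C oC // nw.
have o1 : lq (op (0%N : alphY) b) C = 0 by apply: (onel_lq_ne _ oC).
have c0 : lq (0%N : alphY) C (b :: w) = 0 by apply: oC.
rewrite qst_cons qst0u o1 qst0 mul0rn addr0 c0 add0r.
have [b0|ne] := eqVneq b 0%N.
  by apply: IH; [apply: onel_lq|move: nw; rewrite /= b0 eqxx].
by rewrite (onel_lq_ne ne oC) qst0.
Qed.

Lemma Dy_ones C n : onel 0%N C -> Dy C (nseq n 0%N) = C (nseq n.+1 0%N) *+ n.+1.
Proof.
rewrite /Dy /delta; elim: n C => [|n IH] C oC; first by rewrite qstu0.
have o1 : lq (op (0%N : alphY) (0%N : alphY)) C = 0 by apply: (onel_lq_ne _ oC).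
rewrite [nseq n.+1 _]/= qst_cons qst0u o1 qst0 mul0rn addr0 (IH (lq _ C)); last exact: onel_lq.
by rewrite [in RHS]mulrS.
Qed.

Lemma mul_ones P Q n : (forall m, Q (nseq m 0%N) = (m == 0%N)%:R) ->
  (P * Q) (nseq n 0%N) = P (nseq n 0%N).
Proof.
move=> Q1; elim: n P => [|n IH] P; first by rewrite serM_nil (Q1 0%N) mulr1.
by rewrite serM_cons (IH (lq _ P)) -[_ :: _]/(nseq n.+1 0%N) Q1 mulr0 add0r.
Qed.

Lemma ser_inv_comm (T : eqType) (f g : series T K) : f [::] = 1 -> f * g = 1 -> g * f = 1.
Proof.
move=> f1 fg; apply/eqP; rewrite -subr_eq0; apply/eqP; apply: (ser_nonzerodiv f1).
by rewrite mulrBr mulrA fg mul1r mulr1 subrr.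
Qed.

Variable d : nat -> K -> K.
Hypothesis dE : forall n x, d n x *+ n.+1 = x.

Section Ode.
Variable k : nat -> K.
(** The coefficients of the solution of y' = - y k with y(0) = 1; the list keeps the earlier ones
    available to the recursion. *)
Fixpoint odel n : seq K :=
  if n is m.+1 then rcons (odel m) (d m (- \sum_(i < m.+1) (odel m)`_i * k (m - i))) else [:: 1].
Definition ode n := (odel n)`_n.

Lemma size_odel n : size (odel n) = n.+1.
Proof. by elim: n => //= n IH; rewrite size_rcons IH. Qed.

Lemma nth_odel m i : (i <= m)%N -> (odel m)`_i = ode i.
Proof.
elim: m => [|m IH]; first by case: i.
rewrite leq_eqVlt => /predU1P[-> //|lt_i]; rewrite /= nth_rcons size_odel lt_i.
exact: IH.
Qed.

Lemma odeS n : ode n.+1 *+ n.+1 = - \sum_(i < n.+1) ode i * k (n - i).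
Proof.
rewrite {1}/ode /= nth_rcons size_odel ltnn eqxx dE; congr (- _).
by apply: eq_bigr => i _; rewrite nth_odel // -ltnS.
Qed.
End Ode.

Definition onelY (c : nat -> K) : W := fun w => if all (pred1 0%N) w then c (size w) else 0.

Lemma onel_onelY c : onel 0%N (onelY c).
Proof. by move=> w; rewrite /onelY => /negPf->. Qed.

Lemma onelYM c c' n : (onelY c * onelY c') (nseq n 0%N) = \sum_(i < n.+1) c i * c' (n - i)%N.
Proof.
have o1 (e : nat -> K) m : onelY e (nseq m 0%N) = e m by rewrite /onelY all_nseq orbT size_nseq.
elim: n c => [|n IH] c; first by rewrite serM_nil big_ord1 (o1 _ 0%N) (o1 _ 0%N).
rewrite serM_cons -[_ :: _]/(nseq n.+1 0%N) o1 big_ord_recl (o1 _ 0%N) subn0; congr (_ + _).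
have -> : lq (0%N : alphY) (onelY c) = onelY (fun i => c i.+1) by [].
by rewrite IH; apply: eq_bigr.
Qed.

(** [Dy Psi] satisfies the same linearity as Psi, hence equals kap Psi for a series kap in y_1.
    Solving Dy Gam = - Gam kap makes Dy (Gam Psi) vanish, so Q = Gam Psi is zero on all products y_1
    * v. *)
Theorem regularization (Psi : W) : Psi [::] = 1 -> (forall n, Psi (nseq n.+1 0%N) = 0) ->
  h0linear Psi Psi ->
  exists Gam : W, [/\ onel 0%N Gam, Gam [::] = 1, Gam [:: 0%N] = 0 & character (Gam * Psi)].
Proof.
move=> Psi1 PsiS lPsi.
have Psi_ones m : Psi (nseq m 0%N) = (m == 0%N)%:R by case: m.
pose kap := onelY (fun n => Dy Psi (nseq n 0%N)).
have o1 (e : nat -> K) m : onelY e (nseq m 0%N) = e m by rewrite /onelY all_nseq orbT size_nseq.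
have ok : onel 0%N kap by apply: onel_onelY.
have lD : h0linear Psi (Dy Psi).
  move=> u v cu; rewrite Dy_swap -(qst_map (mulrDr (Psi u))); apply: qst_wt => w _.
  exact: lPsi.
have DPsi : Dy Psi = kap * Psi.
  apply/eqP; rewrite -subr_eq0; apply/eqP; apply: (@h0linear_eq0 Psi) => [u v cu|n].
    by rewrite qstB serB mulrBr lD // (h0linear_onel Psi1 lPsi ok).
  by rewrite serB mul_ones // /kap o1 subrr.
pose Gam := onelY (ode (fun n => kap (nseq n 0%N))).
have oG : onel 0%N Gam by apply: onel_onelY.
have DG : Dy Gam = - (Gam * kap).
  apply/funext => w; rewrite (onelE w (Dy_onel oG)) serN (onelE w (onelM oG ok)).
  case: ifP => _; last by rewrite oppr0.
  rewrite Dy_ones // /Gam o1 odeS; congr (- _); rewrite /kap onelYM; apply: eq_bigr => i _.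
  by rewrite o1.
pose Q := Gam * Psi.
have DQ v : qst Q [:: 0%N : alphY] v = 0.
  have -> : qst Q [:: 0%N : alphY] v = Dy Q v by [].
  by rewrite /Q DyM DPsi DG mulNr mulrA subrr.
have G1 : Gam [::] = 1 by [].
have Q1 : Q [::] = 1 by rewrite /Q serM_nil G1 Psi1 mulr1.
have lQ : h0linear Psi Q by apply: h0linear_onel.
have Qc u : convergent u -> Q u = Psi u by move=> cu; rewrite -[LHS]qstu0 lQ // Q1 mulr1.
exists Gam; split=> //.
  rewrite -[LHS]mulr1n -(Dy_ones 0 oG) /= DG serN serM_nil.
  by rewrite /kap (o1 _ 0%N) /Dy /delta /= (PsiS 0%N) mulr0 oppr0.
split=> // u v.
(* The defect of multiplicativity vanishes at convergent words by [lQ], and on multiples of y_1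
   because Q does. *)
pose Th : W := qr Q v - cst (Q v) * Q.
suff T0 : Th = 0.
  have : Th u = 0 by rewrite T0.
  by rewrite /Th serB cstM_E mulrC => /subr0_eq.
apply: y1_kernel => [x cx|x].
  by rewrite /Th serB cstM_E /qr (lQ _ _ cx) (Qc _ cx) mulrC subrr.
rewrite /Th qstB.
have -> : qst (cst (Q v) * Q) [:: 0%N : alphY] x = 0.
  rewrite -[RHS](mulr0 (Q v)) -(DQ x) -(qst_map (mulrDr (Q v))).
  by apply: qst_wt => w _; rewrite cstM_E.
rewrite subr0 qstA -[RHS](qst0 K x v); apply: qst_wt => w _.
exact: DQ.
Qed.

Lemma h0linear_reg C P : onel 0%N C -> C [::] = 1 -> character P -> h0linear (C * P) (C * P).
Proof.
move=> oC C1 [P1 cP] u v cu.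
have -> : (C * P) u = P u.
  case: u cu => [|a u] cu; first by rewrite serM_nil C1 mul1r.
  by rewrite serM_cons C1 mul1r (onel_lq_ne cu oC) mul0r addr0.
by rewrite (@h0linear_onel P).
Qed.

Lemma onel_jX C : onel 0%N C -> onel true (jX C).
Proof.
move=> oC v nv; have [[s sE]|[u ->]] := word_X v; last exact: jX_rcons.
by rewrite sE jX_iw oC // -all_iw -sE.
Qed.

Lemma qst_x1_nseq (f : H) i :
  qst f [:: true : alphX] (nseq i true) = f (nseq i.+1 true) *+ i.+1.
Proof.
elim: i f => [|i IH] f; first by rewrite qstu0.
rewrite [nseq i.+1 _]/= qst_cons qst0u mulr0n addr0.
by rewrite IH [in RHS]mulrS.
Qed.

(** Over a commutative Q-algebra these are the characters that kill [Rgen] ([ds_Rgen],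
    [Rgen_ds]). *)
Record double_shuffle (Phi : H) := DoubleShuffle {
  ds_char : character Phi;
  ds_x0 : Phi [:: false] = 0;
  ds_x1 : Phi [:: true] = 0;
  ds_stuffle : h0linear (pi Phi) (pi Phi) }.

Lemma ds_regularization Phi : double_shuffle Phi ->
  exists Gam : W, [/\ onel 0%N Gam, Gam [::] = 1, Gam [:: 0%N] = 0 & character (Gam * pi Phi)].
Proof.
case=> [[P1 cP]] _ Px1 lP; apply: regularization => // n.
have iw_ones m : iw (nseq m 0%N) = nseq m true by elim: m => //= m ->.
(* The shuffle of x_1 with x_1^n is (n + 1) x_1^(n+1), and Phi vanishes at x_1. *)
apply: (tf (n := n)); rewrite /pi iw_ones -qst_x1_nseq cP.
by rewrite Px1 mul0r.
Qed.

(** The correction of Psi enters through its inverse C, which [pi_star] carries to the left. The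
    result is a series in y_1 times a stuffle character, and [h0linear_reg] returns to products with
    a convergent factor. *)
Theorem star_stuffle Phi Psi : double_shuffle Phi -> Phi [:: false; true] = 0 ->
  double_shuffle Psi -> h0linear (pi (star Phi Psi)) (pi (star Phi Psi)).
Proof.
move=> dPhi Phi01 dPsi.
have [G [oG G1 G0 cG]] := ds_regularization dPhi.
have [D [oD D1 _ cD]] := ds_regularization dPsi.
have [C DC] := ser_inv_exists D1; have CD := ser_inv_comm D1 DC.
have oC : onel 0%N C := onel_inv D1 oD DC.
have C1 : C [::] = 1 by have := congr1 (fun f : W => f [::]) DC; rewrite serM_nil D1 mul1r.
have PsiE : pi Psi = C * (D * pi Psi) by rewrite mulrA CD mul1r.
have piG : pi (jX G) = G by apply/funext => s; apply: jX_iw.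
have cF : character (pi (jX G * Phi)) by rewrite pi_jXM.
have ojG := onel_jX oG.
have jG1 : jX G [::] = 1 by rewrite -[[::]]/(iw [::]) jX_iw.
have jG0 : jX G [:: true] = 0 by rewrite -[[:: true]]/(iw [:: 0%N]) jX_iw.
have [cPhi P0 P1 _] := dPhi.
rewrite (pi_star tf cPhi P0 P1 Phi01 ojG jG1 jG0 cF oC PsiE).
apply: h0linear_reg; last exact: character_beta.
  by apply: onelM => //; apply/onel_pi/onel_sg.
by rewrite serM_nil C1 mulr1 /pi sg_nil.
Qed.

End Regularization.

(** * Linear extension *)

Section Linext.
Variables (I : choiceType) (V : lmodType rat).
Implicit Types (f : I -> V) (p q : {malg rat[I]}).

Lemma linextEw f p (D : {fset I}) : (msupp p `<=` D)%fset ->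
  linext f p = \sum_(k <- D) p@_k *: f k.
Proof.
move=> sD; rewrite /linext (big_fset_incl _ sD) // => k _ /mcoeff_outdom ->.
exact: scale0r.
Qed.

Fact linext_is_linear f : linear (linext f).
Proof.
move=> c p q; pose D := (msupp p `|` msupp q `|` msupp (c *: p + q))%fset.
have sp : (msupp p `<=` D)%fset by rewrite /D -fsetUA fsubsetUl.
have sq : (msupp q `<=` D)%fset by rewrite /D fsetUAC fsubsetUr.
rewrite (linextEw f sp) (linextEw f sq) (linextEw f (fsubsetUr _ _ : _ `<=` D)%fset).
rewrite scaler_sumr -big_split /=; apply: eq_bigr => k _.
by rewrite mcoeffD mcoeffZ scalerDl scalerA.
Qed.
HB.instance Definition _ f :=
  GRing.isLinear.Build rat {malg rat[I]} V *:%R (linext f) (linext_is_linear f).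

Lemma linextU f k : linext f << k >> = f k.
Proof. by rewrite /linext msuppU oner_eq0 big_seq_fset1 mcoeffUU scale1r. Qed.

Lemma malgE p : p = \sum_(k <- msupp p) p@_k *: << k >>.
Proof.
rewrite {1}[p]monalgE; apply: eq_bigr => k _; apply/malgP => l.
by rewrite mcoeffZ !mcoeffU mulrnAr mulr1.
Qed.

Lemma linear_eq (f g : {linear {malg rat[I]} -> V}) :
  (forall k, f << k >> = g << k >>) -> f =1 g.
Proof.
move=> fg p; rewrite [p]malgE !linear_sum; apply: eq_bigr => k _.
by rewrite !linearZ fg.
Qed.

Lemma linear_linext (V' : lmodType rat) (g : {linear V -> V'}) f p :
  g (linext f p) = linext (g \o f) p.
Proof. by rewrite /linext linear_sum; apply: eq_bigr => k _; rewrite linearZ. Qed.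

Lemma linext_ext f g p : (forall k, k \in msupp p -> f k = g k) -> linext f p = linext g p.
Proof. by move=> fg; rewrite /linext !big_seq; apply: eq_bigr => k /fg->. Qed.

Lemma linext_id p : linext (fun k => << k >>) p = p.
Proof. by rewrite [RHS]malgE. Qed.

Lemma linext0 p : linext (fun=> 0 : V) p = 0.
Proof. by rewrite /linext big1 // => k _; rewrite scaler0. Qed.

Lemma linextDf f g p : linext (fun k => f k + g k) p = linext f p + linext g p.
Proof. by rewrite /linext -big_split; apply: eq_bigr => k _; rewrite scalerDr. Qed.

Lemma linextZf c f p : linext (fun k => c *: f k) p = c *: linext f p.
Proof.
by rewrite /linext scaler_sumr; apply: eq_bigr => k _; rewrite !scalerA mulrC.
Qed.

Lemma linext_sumf (J : Type) (r : seq J) (F : J -> I -> V) p :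
  linext (fun k => \sum_(j <- r) F j k) p = \sum_(j <- r) linext (F j) p.
Proof. by rewrite /linext exchange_big; apply: eq_bigr => k _; rewrite scaler_sumr. Qed.
End Linext.

Section Bilext.
Variables (I J : choiceType) (V : lmodType rat).
Implicit Types (f : I -> J -> V) (p : {malg rat[I]}) (q : {malg rat[J]}).

Lemma bilextE f p q : bilext f p q = linext (fun k => linext (f k) q) p.
Proof.
rewrite /bilext /linext; apply: eq_bigr => k _; rewrite scaler_sumr.
by apply: eq_bigr => l _; rewrite scalerA.
Qed.

Lemma bilextC f p q : bilext f p q = bilext (fun k l => f l k) q p.
Proof.
rewrite /bilext exchange_big; apply: eq_bigr => k _; apply: eq_bigr => l _.
by rewrite mulrC.
Qed.

End Bilext.

Section BilextTheory.
Variables (I J : choiceType) (V : lmodType rat).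
Implicit Types (f : I -> J -> V) (p : {malg rat[I]}) (q : {malg rat[J]}).

Lemma bilextEr f p q : bilext f p q = linext (fun l => linext (f ^~ l) p) q.
Proof. by rewrite bilextC bilextE. Qed.

Lemma bilextU f k l : bilext f << k >> << l >> = f k l.
Proof. by rewrite bilextE !linextU. Qed.

Lemma bilext_ext f g p q :
  (forall k l, k \in msupp p -> l \in msupp q -> f k l = g k l) -> bilext f p q = bilext g p q.
Proof.
by move=> fg; rewrite !bilextE; apply: linext_ext => k kp; apply: linext_ext => l; apply: fg.
Qed.

Lemma linear_bilext (V' : lmodType rat) (g : {linear V -> V'}) f p q :
  g (bilext f p q) = bilext (fun k l => g (f k l)) p q.
Proof.
rewrite !bilextE linear_linext; apply: linext_ext => k _ /=.
by rewrite linear_linext.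
Qed.

Lemma bilextDl f p p' q : bilext f (p + p') q = bilext f p q + bilext f p' q.
Proof. by rewrite !bilextE linearD. Qed.
Lemma bilextDr f p q q' : bilext f p (q + q') = bilext f p q + bilext f p q'.
Proof. by rewrite !bilextEr linearD. Qed.
Lemma bilextZl f c p q : bilext f (c *: p) q = c *: bilext f p q.
Proof. by rewrite !bilextE linearZ. Qed.
Lemma bilextZr f c p q : bilext f p (c *: q) = c *: bilext f p q.
Proof. by rewrite !bilextEr linearZ. Qed.
Lemma bilext0r f p : bilext f p 0 = 0. Proof. by rewrite bilextEr linear0. Qed.
End BilextTheory.

Lemma bilext_linext (I I' J J' : choiceType) (V : lmodType rat) (f : I -> J -> V)
  (g : I' -> {malg rat[I]}) (h : J' -> {malg rat[J]}) p q :
  bilext f (linext g p) (linext h q) = bilext (fun i j => bilext f (g i) (h j)) p q.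
Proof.
rewrite [LHS]bilextE linear_linext [RHS]bilextE; apply: linext_ext => i _ /=.
rewrite -bilextE bilextEr linear_linext; apply: linext_ext => j _ /=.
by rewrite -bilextEr.
Qed.

Lemma bilext_mul (I J : choiceType) (K : comAlgType rat) (f : I -> K) (g : J -> K) p q :
  bilext (fun i j => f i * g j) p q = linext f p * linext g q.
Proof.
rewrite /bilext /linext mulr_suml; apply: eq_bigr => k _; rewrite mulr_sumr.
by apply: eq_bigr => l _; rewrite -scalerAl -scalerAr scalerA.
Qed.

(** * The shuffle and stuffle products *)

Lemma linext_lcons (V : lmodType rat) (f : word -> V) a p :
  linext f (lcons a p) = linext (fun w => f (a :: w)) p.
Proof. by rewrite /lcons linear_linext; apply: linext_ext => w _ /=; rewrite linextU. Qed.

Lemma linext_lconsY (V : lmodType rat) (f : seq nat -> V) a p :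
  linext f (lconsY a p) = linext (fun w => f (a :: w)) p.
Proof. by rewrite /lconsY linear_linext; apply: linext_ext => w _ /=; rewrite linextU. Qed.

Lemma shw_cons a u b v : shw (a :: u) (b :: v) =
  lcons a (shw u (b :: v)) + lcons b (shw (a :: u) v).
Proof. by []. Qed.

Lemma linext_shw (V : lmodType rat) (f : word -> V) u v :
  linext f (shw u v) = qst (A := alphX) f u v.
Proof.
elim: u v f => [|a u IHu] v f; first by rewrite linextU.
elim: v f => [|b v IHv] f; first by rewrite linextU.
by rewrite shw_cons linearD /= !linext_lcons IHu IHv mulr0n addr0.
Qed.

Lemma shw_qst u v : shw u v = qst (A := alphX) (fun w => << w >> : QX) u v.
Proof. by rewrite -linext_shw linext_id. Qed.

Lemma shwC u v : shw u v = shw v u.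
Proof. by rewrite !shw_qst qstC. Qed.

Lemma shC p q : sh p q = sh q p.
Proof. by rewrite /sh bilextC; apply: bilext_ext => u v _ _; apply: shwC. Qed.

Lemma shU u v : sh << u >> << v >> = shw u v. Proof. exact: bilextU. Qed.

Lemma sh_shwl u v z : sh (shw u v) << z >> = qst (A := alphX) (fun w => shw w z) u v.
Proof. by rewrite /sh bilextE linext_shw; congr qst; apply/funext => w; rewrite linextU. Qed.

Lemma sh_shwr u v z : sh << u >> (shw v z) = qst (A := alphX) (fun w => shw u w) v z.
Proof. by rewrite /sh bilextEr linext_shw; congr qst; apply/funext => w; rewrite linextU. Qed.

Lemma sh_linl (I : choiceType) (f : I -> QX) p q :
  sh (linext f p) q = linext (fun k => sh (f k) q) p.
Proof. by rewrite /sh bilextE linear_linext; apply: linext_ext => k _; rewrite bilextE. Qed.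

Lemma sh_linr (I : choiceType) (f : I -> QX) p q :
  sh q (linext f p) = linext (fun k => sh q (f k)) p.
Proof. by rewrite shC sh_linl; apply: linext_ext => k _; rewrite shC. Qed.

Lemma shA p q r : sh (sh p q) r = sh p (sh q r).
Proof.
rewrite -[p]linext_id !sh_linl; apply: linext_ext => u _.
rewrite -[q]linext_id sh_linr !sh_linl sh_linr; apply: linext_ext => v _.
rewrite -[r]linext_id !sh_linr; apply: linext_ext => z _.
rewrite !shU sh_shwl sh_shwr.
have -> : (fun w => shw w z) = qr (A := alphX) (fun w => << w >> : QX) z.
  by apply/funext => w; rewrite shw_qst.
have -> : (fun w => shw u w) = delta (A := alphX) (fun w => << w >> : QX) u.
  by apply/funext => w; rewrite shw_qst.
exact: qstA.
Qed.

Lemma sh1 p : sh unitX p = p.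
Proof. by rewrite -[p]linext_id sh_linr; apply: linext_ext => u _; rewrite shU. Qed.

Lemma linext_sh (K : comAlgType rat) (f : word -> K) p q :
  character (A := alphX) f -> linext f (sh p q) = linext f p * linext f q.
Proof.
case=> _ cf; rewrite /sh linear_bilext -bilext_mul; apply: bilext_ext => u v _ _.
by rewrite /= linext_shw cf.
Qed.

Lemma iota_word_iw s : iota_word [seq k.+1 | k <- s] = iw s.
Proof.
elim: s => //= n s IH; rewrite /iota_word /= -/(iota_word _) IH.
by rewrite cat_rcons.
Qed.

Lemma iinv_iw s : iinv_aux 0 (iw s) = [seq k.+1 | k <- s].
Proof.
have H n c w : iinv_aux c (nseq n false ++ true :: w) = (c + n).+1 :: iinv_aux 0 w.
  by elim: n c => [|n IH] c /=; [rewrite addn0|rewrite IH addSnnS].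
by elim: s => //= n s IH; rewrite H IH.
Qed.

Lemma linext_stw (V : lmodType rat) (f : seq nat -> V) s t :
  linext f (stw [seq k.+1 | k <- s] [seq k.+1 | k <- t]) =
  qst (A := alphY) (fun w => f [seq k.+1 | k <- w]) s t.
Proof.
elim: s t f => [|a s IHs] t f; first by rewrite linextU.
elim: t f => [|b t IHt] f; first by rewrite linextU.
have -> : stw [seq k.+1 | k <- a :: s] [seq k.+1 | k <- b :: t] =
    lconsY a.+1 (stw [seq k.+1 | k <- s] [seq k.+1 | k <- b :: t]) +
    lconsY b.+1 (stw [seq k.+1 | k <- a :: s] [seq k.+1 | k <- t]) +
    lconsY (a.+1 + b.+1) (stw [seq k.+1 | k <- s] [seq k.+1 | k <- t]) by [].
rewrite !linearD /= !linext_lconsY (IHs (b :: t)) (IHs t) IHt mulr1n.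
by rewrite addSn addnS.
Qed.

Lemma linext_iotaL (V : lmodType rat) (f : word -> V) p :
  linext f (iotaL p) = linext (fun s => f (iota_word s)) p.
Proof. by rewrite /iotaL linear_linext; apply: linext_ext => w _ /=; rewrite linextU. Qed.

Lemma iotaL_stw (V : lmodType rat) (f : word -> V) s t :
  linext f (iotaL (stw (iinv_aux 0 (iw s)) (iinv_aux 0 (iw t)))) =
  qst (A := alphY) (fun w => f (iw w)) s t.
Proof.
rewrite !iinv_iw linext_iotaL linext_stw; congr qst; apply/funext => w.
by rewrite iota_word_iw.
Qed.

Lemma st_iotainv u v : st (iotainvL u) (iotainvL v) =
  bilext (fun w z => stw (iinv_aux 0 w) (iinv_aux 0 z)) u v.
Proof.
rewrite /st /iotainvL bilext_linext; apply: bilext_ext => w z _ _; exact: bilextU.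
Qed.

Lemma h1_iw w : (w == [::]) || (last x0 w == x1) -> exists s, w = iw s.
Proof.
case/orP=> [/eqP->|]; first by exists [::].
have [[s ->]|[u ->]] := word_X w; first by exists s.
by rewrite last_rcons.
Qed.

Lemma h0_iw w : (w == [::]) || ((head x1 w == x0) && (last x0 w == x1)) ->
  exists2 s, w = iw s & convergent s.
Proof.
case/orP=> [/eqP->|/andP[hw lw]]; first by exists [::].
have [|s sE] := @h1_iw w; first by rewrite lw orbT.
by exists s => //; move: hw; rewrite sE; case: (s) => [|[|n] t].
Qed.

(** * Characters killing the ideals of relations *)

Section DoubleShuffleIdeal.
Variables (K : comAlgType rat).
Implicit Types f : word -> K.

Lemma linext_ideal (G : QX -> Prop) f p : character (A := alphX) f ->
  (forall g, G g -> linext f g = 0) -> in_ideal G p -> linext f p = 0.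
Proof.
move=> cf Gf; elim=> [|g /Gf//|a b _ a0 _ b0|q a _ a0]; first exact: linear0.
  by rewrite linearD /= a0 b0 addr0.
by rewrite linext_sh // a0 mulr0.
Qed.

Lemma ds_Rgen f g : double_shuffle f -> Rgen g -> linext f g = 0.
Proof.
case=> cf f0 f1 lf [->|[->|[u [v [hu [hv ->]]]]]]; rewrite ?linextU //.
rewrite linearB /= /sh linear_bilext st_iotainv.
rewrite linext_iotaL linear_bilext; apply/eqP; rewrite subr_eq0; apply/eqP.
apply: bilext_ext => w z wu zv; rewrite /= -linext_iotaL linext_shw.
have [s -> cs] := h0_iw (hu _ wu); have [t ->] := h1_iw (hv _ zv).
by rewrite iotaL_stw (proj2 cf) -[RHS]/(qst (pi f) s t) lf.
Qed.

Lemma Rgen_ds f : character (A := alphX) f -> (forall g, Rgen g -> linext f g = 0) ->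
  double_shuffle f.
Proof.
move=> cf Gf; split=> //.
- by rewrite -(linextU f); apply: Gf; left.
- by rewrite -(linextU f); apply: Gf; right; left.
move=> s t cs; have in1 (w z : word) : z \in msupp (<< w >> : QX) -> z = w.
  by move/(fsubsetP (msuppU_le)); rewrite inE => /eqP.
have Rg : Rgen (sh << iw s >> << iw t >> - iotaL (st (iotainvL << iw s >>) (iotainvL << iw t >>))).
  right; right; exists << iw s >>, << iw t >>; split; last split=> //.
    move=> z /in1 ->; case: s cs => [//|[//|n] s] _; apply/orP; right => /=.
    by have [v vE] := iw_rcons n s; move: vE; rewrite /= => ->; rewrite last_rcons.
  move=> z /in1 ->; case: t => [//|n t]; apply/orP; right.
  by have [v ->] := iw_rcons n t; rewrite last_rcons.
have := Gf _ Rg; rewrite linearB /= st_iotainv bilextU iotaL_stw shU linext_shw (proj2 cf).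
by move/subr0_eq => <-.
Qed.

End DoubleShuffleIdeal.

(** * The Goncharov coproduct is dual to [star] *)

Section GoncharovStar.
Variable K : comPzRingType.
Local Notation H := (series alphX K).
Local Notation X0 := (let_ K (false : alphX)).
Local Notation X1 := (let_ K (true : alphX)).

Definition Ig (f : H) (a b : bool) : H :=
  if a then (if b then 1 else f) else (if b then sg f else 1).

(** The sum over selections, one letter at a time: a is the last selected letter, [acc] the gap
    opened since, and the next letter either joins the gap or is selected. *)
Fixpoint Dg (f : H) (a : bool) (acc xs : seq bool) (g : H) : K :=
  match xs with
  | [::] => Ig f a false acc * g [::]
  | x :: xs' => Dg f a (rcons acc x) xs' g + Ig f a x acc * Dg f x [::] xs' (lq (x : alphX) g)
  end.

Variable f : H.
Hypothesis cf : character f.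

Let J (a : bool) : H := if a then 1 else sg f.
(** What follows a selected letter a: [J a] is the factor to the right of that letter in
    [twist f a]. *)
Let N a g := J a * subst (twist f) g * f.

Lemma subst_X (L : alphX -> H) (g : H) : (forall a, serF alphX trivF (wt a) (L a)) ->
  subst L g = cst (g [::]) + (L false * subst L (lq (false : alphX) g) +
                              L true * subst L (lq (true : alphX) g)).
Proof.
move=> wtL; apply: (@Fil_eq _ (serF alphX trivF)) => n.
apply: (@Fil_le _ _ _ n.+2); first by rewrite ltnW.
have := subst_recursive wtL n.+2 g.
have -> : ls alphX n.+2 = [:: false; true] :> seq bool by elim: n => //= n ->.
by rewrite big_cons big_seq1.
Qed.

(** Between neighbouring letters the factors of [twist] combine to f for (x_1, x_0), f^-1 for (x_0,
    x_1), and 1 for equal letters: the cases of Goncharov's I. The last f closes the gap before the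
    final x_0. *)
Let N_rec a g : N a g = Ig f a false * cst (g [::]) +
  \sum_(x <- [:: false; true]) Ig f a x * (let_ K (x : alphX) * N x (lq (x : alphX) g)).
Proof.
rewrite /N subst_X; last exact: wt_twist.
rewrite !mulrDr !mulrDl big_cons big_seq1 -!mulrA; congr (_ + (_ + _)).
- rewrite -comm_cst mulrA; congr (_ * _); rewrite /J /Ig; case: a; rewrite ?mul1r ?sgM1 //.
- rewrite /J /Ig /twist !mulrA; case: a; rewrite ?mul1r //.
  by rewrite sgM1 // mul1r.
- by rewrite /J /Ig /twist !mulrA; case: a; rewrite ?mul1r ?mulr1.
Qed.

Definition lqw (acc : seq bool) (h : H) : H := fun w => h (acc ++ w).

Lemma lq_lqw acc x h : lq (x : alphX) (lqw acc h) = lqw (rcons acc x) h.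
Proof. by apply/funext => w; rewrite /lq /lqw cat_rcons. Qed.

Lemma Dg_lqw a acc xs g : Dg f a acc xs g = (lqw acc (Ig f a false) * cst (g [::]) +
  \sum_(x <- [:: false; true])
     lqw acc (Ig f a x) * (let_ K (x : alphX) * N x (lq (x : alphX) g))) xs.
Proof.
have [n] := ubnP (size xs); elim: n xs a acc g => // n IH [|y ys] a acc g lt_n.
  rewrite serD ser_sum Mcst_E big1 ?addr0 => [|x _]; first by rewrite /lqw cats0.
  by rewrite serM_nil letM_nil mulr0.
rewrite [Dg _ _ _ _ _]/= IH // IH // -[lqw [::] _]/(Ig f y false).
have -> : (Ig f y false * cst (lq (y : alphX) g [::]) + \sum_(x <- [:: false; true])
   lqw [::] (Ig f y x) * (let_ K (x : alphX) * N x (lq (x : alphX) (lq (y : alphX) g)))) =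
   N y (lq (y : alphX) g) by rewrite N_rec.
rewrite !serD !ser_sum !Mcst_E -addrA; congr (_ + _); first by rewrite /lqw cat_rcons.
rewrite !big_cons !big_nil !addr0.
rewrite [(lqw acc (Ig f a false) * _) (y :: ys)]serM_cons.
rewrite [(lqw acc (Ig f a true) * _) (y :: ys)]serM_cons !letM_cons !lq_lqw.
have lE x : lqw acc (Ig f a x) [::] = Ig f a x acc by rewrite /lqw cats0.
rewrite !lE; case: y lt_n => lt_n /=; rewrite mulr0 add0r.
  by rewrite -addrA; congr (_ + _); exact: addrC.
by rewrite [LHS](ACl (3*1*2)%AC).
Qed.

Lemma Dg_star g w : Dg f true [::] w g = star f g w.
Proof.
have -> : star f g = N true g by rewrite /N /star mul1r.
by rewrite Dg_lqw N_rec.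
Qed.

End GoncharovStar.

Lemma sum_tuple_cons (V : nmodType) n (F : bitseq -> V) :
  \sum_(m : n.+1.-tuple bool) F m =
  \sum_(m : n.-tuple bool) F (false :: m) + \sum_(m : n.-tuple bool) F (true :: m).
Proof.
rewrite (reindex (fun p : bool * n.-tuple bool => cons_tuple p.1 p.2)) /=; last first.
  exists (fun t : n.+1.-tuple bool => (thead t, [tuple of behead t])) => [[b m] _|t _] /=.
    by rewrite theadE; congr pair; apply: val_inj.
  by rewrite [in RHS](tuple_eta t); apply: val_inj.
rewrite -(pair_bigA _ (fun b (m : n.-tuple bool) => F (b :: m))) /=.
by rewrite big_bool addrC.
Qed.

Section GoncharovEval.
Variable K : comAlgType rat.
Variables (f g : word -> K).
Hypothesis cf : character (A := alphX) f.

Definition linext2 : QX2 -> K := linext (fun uv : word * word => f uv.1 * g uv.2).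

Lemma linext2_tens p q : linext2 (tens p q) = linext f p * linext g q.
Proof.
rewrite /linext2 /tens linear_bilext -bilext_mul; apply: bilext_ext => u v _ _ /=.
exact: linextU.
Qed.

Lemma linext_Iw a w b : linext f (Iw a w b) = Ig f a b w.
Proof.
rewrite /Iw /Ig; case: a; case: b; rewrite /= ?linextU //.
- by rewrite ser1E; case: w => [|c w]; rewrite /= ?linextU ?linear0 // (proj1 cf).
- rewrite linearZ /= linextU /sg -signr_odd -[in RHS]signr_odd.
  by case: (odd _); rewrite ?scaleN1r ?scale1r ?mulN1r ?mul1r.
- by rewrite ser1E; case: w => [|c w]; rewrite /= ?linextU ?linear0 // (proj1 cf).
Qed.

Lemma linext_foldr_sh (l : seq QX) : linext f (foldr sh unitX l) = \prod_(p <- l) linext f p.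
Proof.
elim: l => [|p l IH]; first by rewrite big_nil /= linextU (proj1 cf).
by rewrite big_cons /= linext_sh // IH.
Qed.

Lemma linext2_DGon_word w : linext2 (DGon_word w) = star (K := K) f g w.
Proof.
rewrite -Dg_star // /DGon_word /linext2 linear_sum /=.
pose F a acc xs (h : word -> K) (m : bitseq) :=
  \prod_(t <- gaps a acc (rcons xs x0) (rcons m true)) Ig f t.1.1 t.2 t.1.2 * h (mask m xs).
have -> : \sum_(m : (size w).-tuple bool) linext (fun uv : word * word => f uv.1 * g uv.2)
    (tens (foldr sh unitX [seq Iw t.1.1 t.1.2 t.2 | t <- gaps x1 [::] (rcons w x0) (rcons m true)])
       << mask m w >>) = \sum_(m : (size w).-tuple bool) F true [::] w g m.
  apply: eq_bigr => m _; rewrite -/(linext2 _) linext2_tens linext_foldr_sh linextU big_map.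
  by congr (_ * _); apply: eq_bigr => t _; apply: linext_Iw.
have t0 (m : 0.-tuple bool) : m = [tuple] by apply: val_inj; case: m => -[].
suff H xs a acc h : \sum_(m : (size xs).-tuple bool) F a acc xs h m = Dg (K := K) f a acc xs h.
  exact: H.
elim: xs a acc h => [|x xs IH] a acc h.
  rewrite (big_pred1 [tuple]) => [|m]; first by rewrite /F /= big_seq1.
  by apply/esym/eqP; apply: t0.
rewrite [size _]/= sum_tuple_cons [Dg _ _ _ _ _]/= -!IH; congr (_ + _).
rewrite mulr_sumr; apply: eq_bigr => m _.
by rewrite /F /= big_cons -mulrA.
Qed.

Lemma linext2_DGon p : linext2 (DGon p) = linext (star (K := K) f g) p.
Proof.
rewrite /linext2 /DGon linear_linext; apply: linext_ext => w _ /=.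
exact: linext2_DGon_word.
Qed.

End GoncharovEval.

(** * Quotients of tensor powers of the shuffle algebra *)

Lemma tens3E p q r : tens3 p q r =
  linext (fun u => linext (fun v => linext (fun w => << (u, v, w) >> : QX3) r) q) p.
Proof.
rewrite /tens3 bilextE /tens bilextE linear_linext; apply: linext_ext => u _ /=.
by rewrite linear_linext; apply: linext_ext => v _ /=; rewrite linextU.
Qed.

Lemma tens3U u v w : tens3 << u >> << v >> << w >> = << (u, v, w) >>.
Proof. by rewrite tens3E !linextU. Qed.

Lemma linext_swap (I J : choiceType) (V : lmodType rat) (f : I -> J -> V) p q :
  linext (fun i => linext (f i) q) p = linext (fun j => linext (f ^~ j) p) q.
Proof. by rewrite -bilextE bilextEr. Qed.

Section Tens3Linear.
Variables (I : choiceType) (f : I -> QX).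

Lemma tens3_lin1 p q r : tens3 (linext f p) q r = linext (fun k => tens3 (f k) q r) p.
Proof. by rewrite tens3E linear_linext; apply: linext_ext => k _; rewrite tens3E. Qed.

Lemma tens3_lin2 p q r : tens3 q (linext f p) r = linext (fun k => tens3 q (f k) r) p.
Proof.
have -> : (fun k => tens3 q (f k) r) = fun k => linext (fun u =>
    linext (fun v => linext (fun w => << (u, v, w) >> : QX3) r) (f k)) q.
  by apply/funext => k; rewrite tens3E.
by rewrite linext_swap tens3E; apply: linext_ext => u _; rewrite linear_linext.
Qed.

Lemma tens3_lin3 p q r : tens3 q r (linext f p) = linext (fun k => tens3 q r (f k)) p.
Proof.
have -> : (fun k => tens3 q r (f k)) = fun k => linext (fun u =>
    linext (fun v => linext (fun w => << (u, v, w) >> : QX3) (f k)) r) q.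
  by apply/funext => k; rewrite tens3E.
rewrite [RHS]linext_swap tens3E; apply: linext_ext => u _.
by rewrite [RHS]linext_swap; apply: linext_ext => v _; rewrite linear_linext.
Qed.
End Tens3Linear.

Section BilextAssoc.
Variables (I : choiceType) (m : I -> I -> {malg rat[I]}).

Lemma bilext_linl (J : choiceType) (f : J -> {malg rat[I]}) p q :
  bilext m (linext f p) q = linext (fun k => bilext m (f k) q) p.
Proof. by rewrite bilextE linear_linext; apply: linext_ext => k _; rewrite bilextE. Qed.

Lemma bilext_linr (J : choiceType) (f : J -> {malg rat[I]}) p q :
  bilext m q (linext f p) = linext (fun k => bilext m q (f k)) p.
Proof. by rewrite bilextEr linear_linext; apply: linext_ext => k _; rewrite bilextEr. Qed.

Lemma bilextA : (forall x y z, bilext m (m x y) << z >> = bilext m << x >> (m y z)) ->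
  associative (bilext m).
Proof.
move=> mA s t z; rewrite -[s]linext_id !bilext_linl; apply: linext_ext => x _.
rewrite -[t]linext_id bilext_linr !bilext_linl bilext_linr; apply: linext_ext => y _.
rewrite -[z]linext_id !bilext_linr; apply: linext_ext => w _.
by rewrite !bilextU mA.
Qed.
End BilextAssoc.

Lemma linext_mull (I : choiceType) (K : comAlgType rat) (c : K) (f : I -> K) p :
  c * linext f p = linext (fun k => c * f k) p.
Proof. by rewrite /linext mulr_sumr; apply: eq_bigr => k _; rewrite scalerAr. Qed.

Lemma linext_mulr (I : choiceType) (K : comAlgType rat) (c : K) (f : I -> K) p :
  linext f p * c = linext (fun k => f k * c) p.
Proof. by rewrite mulrC linext_mull; apply: linext_ext => k _; rewrite mulrC. Qed.

Section Linext3.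
Variables (K : comAlgType rat) (f g h : word -> K).

Definition linext3 : QX3 -> K :=
  linext (fun x : word * word * word => f x.1.1 * g x.1.2 * h x.2).
HB.instance Definition _ := GRing.Linear.copy linext3 (linext _).

Lemma linext3_tens3 p q r : linext3 (tens3 p q r) = linext f p * linext g q * linext h r.
Proof.
rewrite /linext3 tens3E linear_linext -mulrA linext_mulr; apply: linext_ext => u _ /=.
rewrite linear_linext linext_mulr linext_mull; apply: linext_ext => v _ /=.
rewrite linear_linext !linext_mull; apply: linext_ext => w _ /=.
by rewrite linextU mulrA.
Qed.
End Linext3.

Definition m3 (x y : word * word * word) : QX3 :=
  tens3 (shw x.1.1 y.1.1) (shw x.1.2 y.1.2) (shw x.2 y.2).
Definition sh3 (s t : QX3) : QX3 := bilext m3 s t.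
Definition one3 : QX3 := << ([::], [::], [::]) >>.

Lemma sh3C s t : sh3 s t = sh3 t s.
Proof.
rewrite /sh3 bilextC; apply: bilext_ext => x y _ _.
by rewrite /m3 (shwC x.1.1) (shwC x.1.2) (shwC x.2).
Qed.

Lemma sh3_linl (I : choiceType) (f : I -> QX3) p q :
  sh3 (linext f p) q = linext (fun k => sh3 (f k) q) p.
Proof. by rewrite /sh3 bilextE linear_linext; apply: linext_ext => k _; rewrite bilextE. Qed.

Lemma sh3_linr (I : choiceType) (f : I -> QX3) p q :
  sh3 q (linext f p) = linext (fun k => sh3 q (f k)) p.
Proof. by rewrite sh3C sh3_linl; apply: linext_ext => k _; rewrite sh3C. Qed.

Lemma sh3_tens3 p q r p' q' r' :
  sh3 (tens3 p q r) (tens3 p' q' r') = tens3 (sh p p') (sh q q') (sh r r').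
Proof.
rewrite -[p]linext_id tens3_lin1 sh3_linl sh_linl tens3_lin1; apply: linext_ext => u _.
rewrite -[q]linext_id tens3_lin2 sh3_linl sh_linl tens3_lin2; apply: linext_ext => v _.
rewrite -[r]linext_id tens3_lin3 sh3_linl sh_linl tens3_lin3; apply: linext_ext => w _.
rewrite -[p']linext_id tens3_lin1 sh3_linr sh_linr tens3_lin1; apply: linext_ext => u' _.
rewrite -[q']linext_id tens3_lin2 sh3_linr sh_linr tens3_lin2; apply: linext_ext => v' _.
rewrite -[r']linext_id tens3_lin3 sh3_linr sh_linr tens3_lin3; apply: linext_ext => w' _.
by rewrite !tens3U !shU /sh3 bilextU.
Qed.

Lemma triple_tens3 x : << x >> = tens3 << x.1.1 >> << x.1.2 >> << x.2 >>.
Proof. by rewrite tens3U; case: x => [[]]. Qed.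

Lemma sh3A_tens3 p q r p' q' r' p'' q'' r'' :
  sh3 (sh3 (tens3 p q r) (tens3 p' q' r')) (tens3 p'' q'' r'') =
  sh3 (tens3 p q r) (sh3 (tens3 p' q' r') (tens3 p'' q'' r'')).
Proof.
apply: etrans (congr1 (sh3^~ _) (sh3_tens3 _ _ _ _ _ _)) _.
apply: etrans (sh3_tens3 _ _ _ _ _ _) _; apply/esym.
apply: etrans (congr1 (sh3 _) (sh3_tens3 _ _ _ _ _ _)) _.
apply: etrans (sh3_tens3 _ _ _ _ _ _) _.
by rewrite [in RHS]shA [sh (sh q _) _]shA [sh (sh r _) _]shA.
Qed.

Lemma sh3A s t z : sh3 (sh3 s t) z = sh3 s (sh3 t z).
Proof.
apply/esym/bilextA => x y w; rewrite -[m3 x y]bilextU -[m3 y w]bilextU -!/(sh3 _ _).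
by rewrite (triple_tens3 x) (triple_tens3 y) (triple_tens3 w) sh3A_tens3.
Qed.

Lemma sh31 s : sh3 one3 s = s.
Proof.
rewrite -[s]linext_id sh3_linr; apply: linext_ext => x _.
by rewrite [in LHS](triple_tens3 x) -[one3]tens3U sh3_tens3 !sh1 -triple_tens3.
Qed.

Lemma sh3Dl s t z : sh3 (s + t) z = sh3 s z + sh3 t z. Proof. exact: bilextDl. Qed.
Lemma sh3Dr s t z : sh3 s (t + z) = sh3 s t + sh3 s z. Proof. exact: bilextDr. Qed.
Lemma sh3Zl c s t : sh3 (c *: s) t = c *: sh3 s t. Proof. exact: bilextZl. Qed.

Lemma sh3Br s t z : sh3 s (t - z) = sh3 s t - sh3 s z.
Proof. by rewrite /sh3 bilextDr -scaleN1r bilextZr scaleN1r. Qed.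

(* [Id_proper] makes the quotients below nonzero rings, as [comAlgType] demands. *)
Record ideal := Ideal {
  Id :> QX -> Prop;
  Id0 : Id 0;
  IdD : forall a b, Id a -> Id b -> Id (a + b);
  IdM : forall p a, Id a -> Id (sh p a);
  Id_proper : forall a, Id a -> a@_[::] = 0 }.

Section Spans.
Variables (V : lmodType rat) (S : V -> Prop).

Lemma span_sum (J : Type) (r : seq J) (E : J -> V) :
  (forall j, in_span S (E j)) -> in_span S (\sum_(j <- r) E j).
Proof.
move=> SE; elim/big_rec: _ => [|j x _ Sx]; first exact: span_0.
by apply: span_add.
Qed.

Lemma span_opp x : in_span S x -> in_span S (- x).
Proof. by move=> Sx; rewrite -scaleN1r; apply: span_scale. Qed.

Lemma span_map (V' : lmodType rat) (S' : V' -> Prop) (g : {linear V -> V'}) x :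
  (forall v, S v -> in_span S' (g v)) -> in_span S x -> in_span S' (g x).
Proof.
move=> gS; elim=> [|v /gS//|a b _ Sa _ Sb|c a _ Sa].
- by rewrite linear0; apply: span_0.
- by rewrite linearD; apply: span_add.
- by rewrite linearZ; apply: span_scale.
Qed.

Lemma span_kill (V' : lmodType rat) (g : {linear V -> V'}) x :
  (forall v, S v -> g v = 0) -> in_span S x -> g x = 0.
Proof.
move=> gS; elim=> [|v /gS//|a b _ Sa _ Sb|c a _ Sa].
- by rewrite linear0.
- by rewrite linearD Sa Sb addr0.
- by rewrite linearZ /= Sa scaler0.
Qed.
End Spans.

Section Quotient3.
Variables I1 I2 I3 : ideal.
Notation N := (ker3 I1 I2 I3).

Lemma ker3_sh3 s t : N t -> N (sh3 s t).
Proof.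
move=> Nt; rewrite -[s]linext_id sh3_linl /linext; apply: span_sum => x.
apply: span_scale; rewrite triple_tens3.
elim: Nt => [|v [a [b [c [abc ->]]]]|a b _ Sa _ Sb|c a _ Sa].
- by rewrite /sh3 bilext0r; apply: span_0.
- apply: span_gen; rewrite sh3_tens3; do 3!eexists; split; last reflexivity.
  by case: abc => [/IdM|[/IdM|/IdM]] H; [left|right; left|right; right].
- by rewrite sh3Dr; apply: span_add.
- by rewrite /sh3 bilextZr; apply: span_scale.
Qed.

Lemma ker3_coef0 t : N t -> t@_([::], [::], [::]) = 0.
Proof.
pose e w : rat^o := (w == [::] :> word)%:R.
have eE p : linext e p = p@_[::].
  rewrite {2}[p]malgE raddf_sum; apply: eq_bigr => k _ /=.
  by rewrite mcoeffZ mcoeffU; apply: (congr1 ( *%R _)); rewrite /e; case: k.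
have -> : t@_([::], [::], [::]) = linext3 e e e t.
  rewrite {1}[t]malgE raddf_sum; apply: eq_bigr => k _ /=.
  rewrite mcoeffZ mcoeffU; case: k => [[u v] w]; apply: (congr1 ( *%R _)) => /=.
  by rewrite /e; case: u => [|??]; case: v => [|??]; case: w => [|??];
     rewrite ?mul1r ?mul0r ?mulr0.
apply: (@span_kill _ _ rat^o (linext3 e e e)) => _ [a [b [c [abc ->]]]].
rewrite [LHS]linext3_tens3 !eE.
by case: abc => [/Id_proper|[/Id_proper|/Id_proper]] ->; rewrite ?(mul0r,mulr0).
Qed.

(** Congruent elements define the same predicate, so [choose] picks one representative per class. *)
Definition rep (x : QX3) : QX3 := choose (fun y => `[< N (x - y) >]) x.

Lemma repP x : N (x - rep x).
Proof.
apply/asboolP; apply: (@chooseP _ (fun y => `[< N (x - y) >])).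
by apply/asboolP; rewrite subrr; apply: span_0.
Qed.

Lemma rep_eq x y : N (x - y) -> rep x = rep y.
Proof.
move=> Nxy; have P0 : (fun z => `[< N (x - z) >]) =1 (fun z => `[< N (y - z) >]).
  move=> z; apply/asboolP/asboolP => H.
    by rewrite -(subrKA x); apply: span_add => //; rewrite -opprB; apply: span_opp.
  by rewrite -(subrKA y); apply: span_add.
rewrite /rep (eq_choose P0); apply: choose_id.
  by apply/asboolP; rewrite -opprB; apply: span_opp.
by apply/asboolP; rewrite subrr; apply: span_0.
Qed.

Lemma rep_idem x : rep (rep x) == rep x.
Proof. by apply/eqP/rep_eq; rewrite -opprB; apply: span_opp; apply: repP. Qed.

Definition quot3 := {x : QX3 | rep x == x}.
HB.instance Definition _ := Choice.on quot3.

Definition qpi (x : QX3) : quot3 := exist _ (rep x) (rep_idem x).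

Lemma qpi_eq x y : N (x - y) -> qpi x = qpi y.
Proof. by move=> Nxy; apply: val_inj; apply: rep_eq. Qed.

Lemma qpi_ker x y : qpi x = qpi y -> N (x - y).
Proof.
move=> /(congr1 val) /= E; rewrite -(subrKA (rep x)); apply: span_add; first exact: repP.
by rewrite E -opprB; apply: span_opp; apply: repP.
Qed.

Lemma qpi_val x : qpi (val x) = x.
Proof. by apply: val_inj; apply/eqP; exact: (valP x). Qed.

Lemma qpi_elim (P : quot3 -> Prop) : (forall x, P (qpi x)) -> forall x, P x.
Proof. by move=> H x; rewrite -[x]qpi_val. Qed.

Definition qadd (x y : quot3) := qpi (val x + val y).
Definition qopp (x : quot3) := qpi (- val x).
Definition qscale (c : rat) (x : quot3) := qpi (c *: val x).
Definition qmul (x y : quot3) := qpi (sh3 (val x) (val y)).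

Lemma qpi_add x y : qadd (qpi x) (qpi y) = qpi (x + y).
Proof.
apply: qpi_eq => /=; have -> : rep x + rep y - (x + y) = - ((x - rep x) + (y - rep y)).
  by rewrite [RHS]opprD !opprB addrACA -opprD.
by apply: span_opp; apply: span_add; apply: repP.
Qed.

Lemma qpi_opp x : qopp (qpi x) = qpi (- x).
Proof.
apply: qpi_eq => /=; rewrite opprK addrC.
exact: repP.
Qed.

Lemma qpi_scale c x : qscale c (qpi x) = qpi (c *: x).
Proof. by apply: qpi_eq => /=; rewrite -scalerBr; apply/span_scale; rewrite -opprB; apply/span_opp/repP. Qed.

Lemma qpi_mul x y : qmul (qpi x) (qpi y) = qpi (sh3 x y).
Proof.
have sh3N s t z : N (s - t) -> qpi (sh3 z s) = qpi (sh3 z t).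
  by move=> Nst; apply: qpi_eq; rewrite -sh3Br; apply: ker3_sh3.
have Nr z : N (rep z - z) by rewrite -opprB; apply/span_opp/repP.
apply: etrans (sh3N _ _ (rep x) (Nr y)) _.
apply: etrans (congr1 qpi (sh3C _ _)) _.
apply: etrans (sh3N _ _ y (Nr x)) _.
exact: (congr1 qpi (sh3C _ _)).
Qed.

Fact qaddA : associative qadd.
Proof. by do 3!elim/qpi_elim=> ?; rewrite !qpi_add addrA. Qed.
Fact qaddC : commutative qadd.
Proof. by do 2!elim/qpi_elim=> ?; rewrite !qpi_add addrC. Qed.
Fact qadd0 : left_id (qpi 0) qadd.
Proof. by elim/qpi_elim=> ?; rewrite !qpi_add add0r. Qed.
Fact qaddN : left_inverse (qpi 0) qopp qadd.
Proof. by elim/qpi_elim=> ?; rewrite qpi_opp qpi_add addNr. Qed.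
HB.instance Definition _ := GRing.isZmodule.Build quot3 qaddA qaddC qadd0 qaddN.

Fact qmulA : associative qmul.
Proof. by do 3!elim/qpi_elim=> ?; rewrite !qpi_mul sh3A. Qed.
Fact qmulC : commutative qmul.
Proof. by do 2!elim/qpi_elim=> ?; rewrite !qpi_mul sh3C. Qed.
Fact qmul1 : left_id (qpi one3) qmul.
Proof. by elim/qpi_elim=> ?; rewrite !qpi_mul sh31. Qed.
Fact qmulDl : left_distributive qmul qadd.
Proof. by do 3!elim/qpi_elim=> ?; rewrite !(qpi_mul, qpi_add) sh3Dl. Qed.
Fact qone_neq0 : qpi one3 != qpi 0.
Proof.
apply/eqP => /qpi_ker; rewrite subr0 => /ker3_coef0/eqP.
by rewrite mcoeffUU oner_eq0.
Qed.
HB.instance Definition _ :=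
  GRing.Zmodule_isComNzRing.Build quot3 qmulA qmulC qmul1 qmulDl qone_neq0.

Fact qscaleA a b v : qscale a (qscale b v) = qscale (a * b) v.
Proof. by elim/qpi_elim: v => ?; rewrite !qpi_scale scalerA. Qed.
Fact qscale1 : left_id 1 qscale.
Proof. by elim/qpi_elim => ?; rewrite !qpi_scale scale1r. Qed.
Fact qscaleDr : right_distributive qscale qadd.
Proof. by move=> c; do 2!elim/qpi_elim=> ?; rewrite !(qpi_scale, qpi_add) scalerDr. Qed.
Fact qscaleDl v : {morph qscale^~ v : a b / a + b >-> qadd a b}.
Proof. by elim/qpi_elim: v => ? a b; rewrite !(qpi_scale, qpi_add) scalerDl. Qed.
HB.instance Definition _ :=
  GRing.Zmodule_isLmodule.Build rat quot3 qscaleA qscale1 qscaleDr qscaleDl.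
Fact qscaleAl (a : rat) (u v : quot3) : a *: (u * v) = (a *: u) * v.
Proof.
elim/qpi_elim: u => u; elim/qpi_elim: v => v.
rewrite -[LHS]/(qscale a (qmul _ _)) -[RHS]/(qmul (qscale a _) _).
by rewrite !(qpi_mul, qpi_scale) sh3Zl.
Qed.
HB.instance Definition _ := GRing.Lmodule_isLalgebra.Build rat quot3 qscaleAl.
HB.instance Definition _ := GRing.Lalgebra_isComAlgebra.Build rat quot3.

Fact qpi_is_linear : linear qpi.
Proof. by move=> c x y; rewrite -qpi_add -qpi_scale. Qed.
HB.instance Definition _ := GRing.isLinear.Build rat QX3 quot3 *:%R qpi qpi_is_linear.

Lemma qpi_sh3 x y : qpi (sh3 x y) = qpi x * qpi y.
Proof. by rewrite -qpi_mul. Qed.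

Lemma qpi_0 x : qpi x = 0 <-> N x.
Proof.
split=> [|Nx]; first by rewrite -(linear0 qpi) => /qpi_ker; rewrite subr0.
by rewrite -(linear0 qpi); apply: qpi_eq; rewrite subr0.
Qed.

End Quotient3.

(** * Universal characters *)

Lemma shr1 p : sh p unitX = p. Proof. by rewrite shC sh1. Qed.

Section UniversalCharacters.
Variables I1 I2 I3 : ideal.
Notation K := (quot3 I1 I2 I3).
Notation pi3 := (@qpi I1 I2 I3).

Definition Phi1 (w : word) : K := pi3 << (w, [::], [::]) >>.
Definition Phi2 (w : word) : K := pi3 << ([::], w, [::]) >>.
Definition Phi3 (w : word) : K := pi3 << ([::], [::], w) >>.

Lemma linext_Phi1 p : linext Phi1 p = pi3 (tens3 p unitX unitX).
Proof.
rewrite -[p in RHS]linext_id tens3_lin1 linear_linext; apply: linext_ext => w _ /=.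
by rewrite tens3U.
Qed.

Lemma linext_Phi2 p : linext Phi2 p = pi3 (tens3 unitX p unitX).
Proof.
rewrite -[p in RHS]linext_id tens3_lin2 linear_linext; apply: linext_ext => w _ /=.
by rewrite tens3U.
Qed.

Lemma linext_Phi3 p : linext Phi3 p = pi3 (tens3 unitX unitX p).
Proof.
rewrite -[p in RHS]linext_id tens3_lin3 linear_linext; apply: linext_ext => w _ /=.
by rewrite tens3U.
Qed.

Lemma qpi_tens3M p q r p' q' r' : pi3 (tens3 (sh p p') (sh q q') (sh r r')) =
  pi3 (tens3 p q r) * pi3 (tens3 p' q' r').
Proof. by rewrite -[RHS](@qpi_sh3 I1 I2 I3) -(sh3_tens3 p q r p' q' r'). Qed.

Lemma Phi1_character : character (A := alphX) Phi1.
Proof.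
split=> // u v; rewrite -linext_shw linext_Phi1 -shU -(linextU Phi1 u) -(linextU Phi1 v).
by rewrite !linext_Phi1 -qpi_tens3M (sh1 unitX).
Qed.

Lemma Phi2_character : character (A := alphX) Phi2.
Proof.
split=> // u v; rewrite -linext_shw linext_Phi2 -shU -(linextU Phi2 u) -(linextU Phi2 v).
by rewrite !linext_Phi2 -qpi_tens3M (sh1 unitX).
Qed.

(** The quotient map is evaluation at the universal characters, which turns identities of characters
    into membership in [ker3]. *)
Lemma qpi_linext3 t : pi3 t = linext3 Phi1 Phi2 Phi3 t.
Proof.
move: t; apply: linear_eq => -[[u v] w] /=; rewrite [RHS]linextU /=.
rewrite -(linextU Phi1 u) -(linextU Phi2 v) -(linextU Phi3 w) linext_Phi1 linext_Phi2 linext_Phi3.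
by rewrite -!qpi_tens3M !(sh1, shr1) tens3U.
Qed.

Lemma Phi1_kill p : I1 p -> linext Phi1 p = 0.
Proof.
by move=> Ip; rewrite linext_Phi1; apply/qpi_0/span_gen; do 3!eexists; split; last reflexivity; left.
Qed.

Lemma Phi2_kill p : I2 p -> linext Phi2 p = 0.
Proof.
move=> Ip; rewrite linext_Phi2; apply/qpi_0/span_gen; do 3!eexists.
by split; last reflexivity; right; left.
Qed.

End UniversalCharacters.

(** * The ideals of relations *)

Definition eps (w : word) : rat^o := (w == [::])%:R.

Lemma linext_eps p : linext eps p = p@_[::].
Proof.
rewrite {2}[p]malgE raddf_sum; apply: eq_bigr => k _ /=.
by rewrite mcoeffZ mcoeffU; apply: (congr1 ( *%R _)); rewrite /eps; case: k.
Qed.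

Lemma eps1 : eps = (1 : series alphX rat^o).
Proof. by apply/funext => w; rewrite ser1E. Qed.

Lemma eps_character : character (A := alphX) eps.
Proof. by split=> // u v; rewrite eps1 qst1 !ser1E. Qed.

(** The counit satisfies all relations, which makes the ideals proper. *)
Lemma eps_double_shuffle : double_shuffle (K := rat^o) eps.
Proof.
split=> //; first exact: eps_character.
have -> : pi (K := rat^o) eps = 1.
  by apply/funext => -[|n s]; rewrite ser1E /pi /eps //=; case: n.
by move=> u v _; rewrite qst1 !ser1E.
Qed.

Lemma ideal_coef0 (G : QX -> Prop) p :
  (forall g, G g -> linext eps g = 0) -> in_ideal G p -> p@_[::] = 0.
Proof. by rewrite -linext_eps; apply: linext_ideal eps_character. Qed.

Definition zero_ideal : ideal.
Proof.
apply: (@Ideal (fun p => p = 0)) => //.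
- by move=> a b -> ->; rewrite addr0.
- by move=> p a ->; apply: bilext0r.
- by move=> a ->; apply: mcoeff0.
Defined.

Definition Rf_ideal : ideal.
Proof.
apply: (@Ideal Rf); [exact: ideal_0|exact: ideal_add|exact: ideal_mul|].
by move=> a; apply: ideal_coef0 => g; apply: ds_Rgen eps_double_shuffle.
Defined.

Definition RA_ideal : ideal.
Proof.
apply: (@Ideal RA); [exact: ideal_0|exact: ideal_add|exact: ideal_mul|].
move=> a; apply: ideal_coef0 => g [|->]; first exact: ds_Rgen eps_double_shuffle.
exact: linextU.
Defined.

Lemma Rf_RA p : Rf p -> RA p.
Proof.
elim=> [|g Gg|a b _ Ra _ Rb|q a _ Ra].
- exact: ideal_0.
- by apply: ideal_gen; left.
- exact: ideal_add.
- exact: ideal_mul.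
Qed.

(** * Stability of the relations under the coproduct *)

Section StarDoubleShuffle.
Variables (K : comAlgType rat).
Implicit Types f g : word -> K.

Lemma star_double_shuffle f g : double_shuffle f -> f zeta2_word = 0 -> double_shuffle g ->
  double_shuffle (star (K := K) f g).
Proof.
move=> df f01 dg; have [cf f0 f1 _] := df; have [cg g0 g1 _] := dg.
have tf n (x : K) : x *+ n.+1 = 0 -> x = 0.
  by rewrite -(@scaler_nat rat) => /eqP; rewrite scaler_eq0 Num.Theory.pnatr_eq0 => /eqP.
have dE n (x : K) : ((n.+1%:R)^-1 *: x) *+ n.+1 = x.
  by rewrite -(@scaler_nat rat) scalerA divff ?Num.Theory.pnatr_eq0 // scale1r.
split; [exact: character_star| | |exact: star_stuffle dE _ _ _ _ _].
- by rewrite -Dg_star //= !ser1E /lq /sg /= f0 g0; ring.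
- by rewrite -Dg_star //= !ser1E /lq /sg /= f1 g1; ring.
Qed.

(** zeta(2) is primitive modulo x_0 and x_1, so the coproduct also descends to the quotient by
    zeta(2). *)
Lemma star_zeta2 f g : double_shuffle f -> double_shuffle g ->
  star (K := K) f g zeta2_word = f zeta2_word + g zeta2_word.
Proof.
move=> [cf f0 f1 _] [cg g0 g1 _]; rewrite -Dg_star //= /lq /sg /= !ser1E /=.
rewrite (proj1 cf) (proj1 cg). rewrite /zeta2_word; ring.
Qed.

Lemma linext_RA f p : double_shuffle f -> f zeta2_word = 0 -> RA p -> linext f p = 0.
Proof.
move=> df f01; apply: linext_ideal; first exact: ds_char.
by move=> g [|->]; [apply: ds_Rgen|rewrite linextU].
Qed.

Lemma linext_Rf f p : double_shuffle f -> Rf p -> linext f p = 0.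
Proof. by move=> df; apply: linext_ideal; [apply: ds_char|move=> g; apply: ds_Rgen]. Qed.
End StarDoubleShuffle.

(** Two tensor factors are treated inside three; [narrow], the counit on the third factor, is a
    retraction. *)
Definition widen (t : QX2) : QX3 := linext (fun uv : word * word => << (uv.1, uv.2, [::]) >>) t.
HB.instance Definition _ := GRing.Linear.copy widen (linext _).
Definition narrow (t : QX3) : QX2 :=
  linext (fun x : word * word * word => eps x.2 *: << x.1 >>) t.
HB.instance Definition _ := GRing.Linear.copy narrow (linext _).

Lemma narrow_widen t : narrow (widen t) = t.
Proof.
rewrite /widen linear_linext -[RHS]linext_id; apply: linext_ext => -[u v] _ /=.
by rewrite /narrow linextU /= scale1r.
Qed.

Lemma narrow_tens3 p q r : narrow (tens3 p q r) = r@_[::] *: tens p q.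
Proof.
rewrite tens3E linear_linext /tens bilextE -linextZf; apply: linext_ext => u _ /=.
rewrite linear_linext -linextZf; apply: linext_ext => v _ /=.
rewrite linear_linext -linext_eps /linext scaler_suml; apply: eq_bigr => w _ /=.
by rewrite /narrow linextU /= scalerA.
Qed.

Lemma ker2_linext3 (I1 I2 : ideal) t :
  @qpi I1 I2 zero_ideal (widen t) = 0 -> ker2 I1 I2 t.
Proof.
move/qpi_0; rewrite -[in ker2 _ _ _](narrow_widen t).
apply: span_map => _ [a [b [c [abc ->]]]] /=; rewrite narrow_tens3.
case: abc => [Ia|[Ib|->]]; last by rewrite mcoeff0 scale0r; apply: span_0.
  by apply/span_scale/span_gen; exists a, b; split => //; left.
by apply/span_scale/span_gen; exists a, b; split => //; right.
Qed.

Lemma qpi_widen (I1 I2 I3 : ideal) t : @qpi I1 I2 I3 (widen t) =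
  linext2 (Phi1 I1 I2 I3) (Phi2 I1 I2 I3) t.
Proof.
rewrite qpi_linext3 /widen /linext3 linear_linext; apply: linext_ext => -[u v] _ /=.
by rewrite linextU /= mulr1.
Qed.

Section GoncharovKernels.
Variables I1 I2 : ideal.
Notation K := (quot3 I1 I2 zero_ideal).
Notation F1 := (Phi1 I1 I2 zero_ideal).
Notation F2 := (Phi2 I1 I2 zero_ideal).

Lemma ker2_DGon p : linext (star (K := K) F1 F2) p = 0 -> ker2 I1 I2 (DGon p).
Proof.
by move=> H; apply: ker2_linext3; rewrite qpi_widen linext2_DGon //; apply: Phi1_character.
Qed.

Hypotheses (R1 : forall p, Rf p -> I1 p) (R2 : forall p, Rf p -> I2 p).
Hypothesis (Z1 : I1 << zeta2_word >>).

Lemma Phi1_double_shuffle : double_shuffle (K := K) F1.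
Proof.
apply: Rgen_ds; first exact: Phi1_character.
by move=> g Gg; apply/Phi1_kill/R1/ideal_gen.
Qed.

Lemma Phi2_double_shuffle : double_shuffle (K := K) F2.
Proof.
apply: Rgen_ds; first exact: Phi2_character.
by move=> g Gg; apply/Phi2_kill/R2/ideal_gen.
Qed.

Lemma Phi1_zeta2 : F1 zeta2_word = 0.
Proof. by rewrite -linextU; apply: Phi1_kill. Qed.

Lemma Phi2_zeta2 : I2 << zeta2_word >> -> F2 zeta2_word = 0.
Proof. by move=> Z2; rewrite -linextU; apply: Phi2_kill. Qed.

Lemma DGon_Rf p : Rf p -> ker2 I1 I2 (DGon p).
Proof.
move=> Rp; apply/ker2_DGon/linext_Rf => //.
exact: star_double_shuffle Phi1_double_shuffle Phi1_zeta2 Phi2_double_shuffle.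
Qed.

Lemma DGon_RA p : I2 << zeta2_word >> -> RA p -> ker2 I1 I2 (DGon p).
Proof.
move=> Z2 Rp; apply/ker2_DGon/linext_RA => //.
  exact: star_double_shuffle Phi1_double_shuffle Phi1_zeta2 Phi2_double_shuffle.
rewrite star_zeta2 ?Phi1_zeta2 ?Phi2_zeta2 ?addr0 //.
  exact: Phi1_double_shuffle.
exact: Phi2_double_shuffle.
Qed.
End GoncharovKernels.

Lemma RA_DGon p : RA p -> ker2 RA RA (DGon p).
Proof.
have R1 q : Rf q -> RA_ideal q by exact: Rf_RA.
have Z1 : RA_ideal << zeta2_word >> by apply: ideal_gen; right.
exact: (@DGon_RA RA_ideal RA_ideal).
Qed.

Lemma Rf_DGon p : Rf p -> ker2 RA Rf (DGon p).
Proof.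
have R1 q : Rf q -> RA_ideal q by exact: Rf_RA.
have Z1 : RA_ideal << zeta2_word >> by apply: ideal_gen; right.
exact: (@DGon_Rf RA_ideal Rf_ideal).
Qed.

(** * Algebraic identities *)

Section ExactIdentities.
Notation O := zero_ideal.
Notation K := (quot3 O O O).
Notation F1 := (Phi1 O O O).
Notation F2 := (Phi2 O O O).
Notation F3 := (Phi3 O O O).

Lemma ker3_zero t : ker3 O O O t -> t = 0.
Proof.
apply: (@span_kill _ _ _ idfun) => _ [a [b [c [[->|[->|->]] ->]]]].
- by rewrite tens3E linear0.
- by rewrite tens3E -[RHS](linext0 _ a); apply: linext_ext => u _; rewrite linear0.
rewrite tens3E -[RHS](linext0 _ a); apply: linext_ext => u _.
by rewrite -[RHS](linext0 _ b); apply: linext_ext => v _; rewrite linear0.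
Qed.

(** For zero ideals the universal characters are faithful, so multiplicativity and coassociativity
    hold exactly on Q<X>. *)
Lemma qpi_inj : injective (@qpi O O O).
Proof. by move=> s t /qpi_ker/ker3_zero/subr0_eq. Qed.

Lemma widen_inj : injective widen.
Proof. exact: can_inj narrow_widen. Qed.

Lemma linext2_inj : injective (linext2 F1 F2).
Proof. by move=> s t; rewrite -!qpi_widen => /qpi_inj/widen_inj. Qed.

Lemma linext2_sh2 (L : comAlgType rat) (f g : word -> L) s t :
  character (A := alphX) f -> character (A := alphX) g ->
  linext2 f g (sh2 s t) = linext2 f g s * linext2 f g t.
Proof.
move=> cf cg; rewrite /linext2 /sh2 linear_bilext -bilext_mul.
apply: bilext_ext => -[u v] [u' v'] _ _ /=; rewrite -/(linext2 f g _) linext2_tens.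
by rewrite !linext_shw (proj2 cf) (proj2 cg) mulrACA.
Qed.

Lemma DGon_sh p q : DGon (sh p q) = sh2 (DGon p) (DGon q).
Proof.
have c1 := Phi1_character O O O; have c2 := Phi2_character O O O.
apply: linext2_inj; apply: etrans (linext2_DGon _ c1 _) _.
apply: etrans (linext_sh _ _ (character_star c1 c2)) _; apply: esym.
apply: etrans (linext2_sh2 _ _ c1 c2) _.
exact: (congr2 *%R (linext2_DGon _ c1 p) (linext2_DGon _ c1 q)).
Qed.

Lemma DGon_unit : DGon unitX = tens unitX unitX.
Proof.
have c1 := Phi1_character O O O.
have c2 := Phi2_character O O O.
have E : linext2 F1 F2 (DGon unitX) = 1.
  apply: etrans (linext2_DGon _ c1 _) _; apply: etrans (linextU _ _) _.
  exact: proj1 (character_star c1 c2).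
have E' : linext2 F1 F2 (tens unitX unitX) = 1.
  apply: etrans (linext2_tens _ _ _ _) _; rewrite (linextU F1) (linextU F2).
  by rewrite (proj1 c1) (proj1 c2) mulr1.
exact: linext2_inj (etrans E (esym E')).
Qed.

Lemma linext3_DGon_id (L : comAlgType rat) (f g h : word -> L) t :
  linext3 f g h (DGon_id t) = linext2 (fun w => linext2 f g (DGon_word w)) h t.
Proof.
rewrite /linext3 /DGon_id linear_linext; apply: linext_ext => -[u v] _ /=.
rewrite linear_bilext /DGon linextU bilextEr linextU /linext2 linext_mulr.
by apply: linext_ext => -[a b] _ /=; rewrite linextU.
Qed.

Lemma linext3_id_DGon (L : comAlgType rat) (f g h : word -> L) t :
  linext3 f g h (id_DGon t) = linext2 f (fun w => linext2 g h (DGon_word w)) t.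
Proof.
rewrite /linext3 /id_DGon linear_linext; apply: linext_ext => -[u v] _ /=.
rewrite linear_bilext /DGon linextU bilextE linextU /linext2 linext_mull.
by apply: linext_ext => -[a b] _ /=; rewrite linextU mulrA.
Qed.

Lemma DGonA p : DGon_id (DGon p) = id_DGon (DGon p).
Proof.
have c1 := Phi1_character O O O; have c2 := Phi2_character O O O.
have E12 : (fun w => linext2 F1 F2 (DGon_word w)) = star (K := K) F1 F2.
  by apply/funext => w; apply: (linext2_DGon_word _ c1).
have E23 : (fun w => linext2 F2 F3 (DGon_word w)) = star (K := K) F2 F3.
  by apply/funext => w; apply: (linext2_DGon_word _ c2).
apply: qpi_inj; apply: etrans (qpi_linext3 _ _ _ _) _; apply: etrans (linext3_DGon_id _ _ _ _) _.
apply: esym; apply: etrans (qpi_linext3 _ _ _ _) _; apply: etrans (linext3_id_DGon _ _ _ _) _.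
apply: etrans (congr1 (fun h => linext2 F1 h (DGon p)) E23) _.
apply: esym; apply: etrans (congr1 (fun h => linext2 h F3 (DGon p)) E12) _.
apply: etrans (linext2_DGon _ (character_star c1 c2) _) _.
apply: esym; apply: etrans (linext2_DGon _ c1 _) _.
exact: (congr1 (fun h => linext h p) (starA _ c1 c2)).
Qed.
End ExactIdentities.

(** * Weight grading *)

Section Support.
Variables (I : choiceType) (P : I -> Prop).
Implicit Types p q : {malg rat[I]}.

Definition supported p := forall k, k \in msupp p -> P k.

Lemma supported0 : supported 0. Proof. by move=> w; rewrite msupp0. Qed.

Lemma supportedD p q : supported p -> supported q -> supported (p + q).
Proof.
by move=> hp hq w /(fsubsetP (msuppD_le _ _)); rewrite in_fsetU => /orP[/hp|/hq].
Qed.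

Lemma supportedZ c p : supported p -> supported (c *: p).
Proof. by move=> hp w /(fsubsetP (msuppZ_le _ _))/hp. Qed.

Lemma supportedU k : P k -> supported << k >>.
Proof. by move=> Pk z /(fsubsetP (msuppU_le)); rewrite inE => /eqP->. Qed.

Lemma supported_sum (J : Type) (r : seq J) (E : J -> {malg rat[I]}) :
  (forall j, supported (E j)) -> supported (\sum_(j <- r) E j).
Proof.
move=> hE; elim/big_rec: _ => [|j x _ hx]; first exact: supported0.
exact: supportedD.
Qed.

Lemma supported_linext (J : choiceType) (f : J -> {malg rat[I]}) (p : {malg rat[J]}) :
  (forall k, k \in msupp p -> supported (f k)) -> supported (linext f p).
Proof.
move=> hf; rewrite /linext big_seq; elim/big_rec: _ => [|k x /hf fk hx]; first exact: supported0.
by apply: supportedD => //; apply: supportedZ.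
Qed.
End Support.

Definition homog (n : nat) : QX -> Prop := supported (fun w => size w = n).

Lemma homogU w : homog (size w) << w >>. Proof. exact: supportedU. Qed.

Lemma homog_lcons n a p : homog n p -> homog n.+1 (lcons a p).
Proof. by move=> hp; apply: supported_linext => w /hp <-; apply: supportedU. Qed.

Lemma homog_shw u v : homog (size u + size v) (shw u v).
Proof.
elim: u v => [|a u IHu] v; first exact: homogU.
elim: v => [|b v IHv]; first by rewrite addn0; apply: homogU.
rewrite shw_cons; apply: supportedD; first exact: homog_lcons (IHu _).
by rewrite /= addnS; apply: homog_lcons.
Qed.

Lemma homog_sh n m p q : homog n p -> homog m q -> homog (n + m) (sh p q).
Proof.
move=> hp hq; rewrite /sh bilextE; apply: supported_linext => u /hp <-.
by apply: supported_linext => v /hq <-; apply: homog_shw.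
Qed.

Lemma homog_Iw a w b : homog (size w) (Iw a w b).
Proof.
rewrite /Iw; case: ifP => _; first exact: homogU.
case: ifP => _; first by apply: supportedZ; rewrite -size_rev; apply: homogU.
case: ifP => _; last exact: supported0.
by case: eqP => [->|_]; [apply: homogU|apply: supported0].
Qed.

Lemma homog_gaps a acc w m : size m = size w ->
  homog (size acc + size w - size (mask m w))
    (foldr sh unitX [seq Iw t.1.1 t.1.2 t.2 | t <- gaps a acc (rcons w x0) (rcons m true)]).
Proof.
elim: w m a acc => [|x w IH] [|b m] a acc //= => [_|[sm]].
  by rewrite shr1 addn0 subn0; apply: homog_Iw.
have le_m : (size (mask m w) <= size w)%N by rewrite size_mask // -sm count_size.
case: b => /=; last by have := IH m a (rcons acc x) sm; rewrite size_rcons addSnnS.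
have -> : (size acc + (size w).+1 - (size (mask m w)).+1 =
           size acc + (size (@nil letter) + size w - size (mask m w)))%N.
  by rewrite addnS subSS /= add0n addnBA.
by apply: homog_sh; [apply: homog_Iw|apply: IH].
Qed.

Lemma supported_tens (P Q : word -> Prop) p q : supported P p -> supported Q q ->
  supported (fun uv : word * word => P uv.1 /\ Q uv.2) (tens p q).
Proof.
move=> hp hq; rewrite /tens bilextE; apply: supported_linext => u /hp Pu.
by apply: supported_linext => v /hq Qv; apply: supportedU.
Qed.

Lemma DGon_word_weight w :
  supported (fun uv => (size uv.1 + size uv.2)%N = size w) (DGon_word w).
Proof.
apply: supported_sum => m uv; have sm : size m = size w by apply: size_tuple.
have h1 := @homog_gaps x1 [::] w m sm; have h2 := @homogU (mask m w).
case/(supported_tens h1 h2) => -> ->.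
rewrite add0n subnK //; apply: leq_trans (size_subseq (mask_subseq m w)) _; exact: leqnn.
Qed.

Lemma linextBf (I : choiceType) (V : lmodType rat) (f g : I -> V) p :
  linext (fun k => f k - g k) p = linext f p - linext g p.
Proof. by rewrite -scaleN1r -linextZf -linextDf; apply: linext_ext => k _; rewrite scaleN1r. Qed.

Lemma hcompE n p : hcomp n p = linext (fun w => if size w == n then << w >> else 0) p.
Proof.
rewrite /hcomp big_mkcond; apply: eq_bigr => w _.
by case: ifP => // _; rewrite scaler0.
Qed.

Fact hcomp_is_linear n : linear (hcomp n).
Proof. by move=> c p q; rewrite !hcompE linearP. Qed.
HB.instance Definition _ n := GRing.isLinear.Build rat QX QX *:%R (hcomp n) (hcomp_is_linear n).

Lemma hcomp_homog n m p : homog n p -> hcomp m p = if n == m then p else 0.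
Proof.
move=> hp; rewrite hcompE; case: (n =P m) => [<-|/eqP/negPf nm].
  by rewrite -[RHS]linext_id; apply: linext_ext => w /hp->; rewrite eqxx.
by rewrite -[RHS](linext0 _ p); apply: linext_ext => w /hp ->; rewrite nm.
Qed.

(** Homogeneity is tested as invariance under [hcomp], which [qst_wt] checks without expanding the
    product. *)
Lemma homog_iotaL_stw s t : homog (size (iw s) + size (iw t))
  (iotaL (stw (iinv_aux 0 (iw s)) (iinv_aux 0 (iw t)))).
Proof.
set n := (_ + _)%N; set p := iotaL _.
suff <- : hcomp n p = p.
  rewrite hcompE; apply: supported_linext => w _; case: eqP => [<-|_]; first exact: homogU.
  exact: supported0.
rewrite -[RHS]linext_id hcompE /p !iotaL_stw; apply: qst_wt => w wE.
by rewrite size_iw wE -!size_iw eqxx.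
Qed.

Section Homogeneous.
Variable G : QX -> Prop.
Hypothesis G_homog : forall g n, G g -> in_ideal G (hcomp n g).

Lemma ideal_scale c p : in_ideal G p -> in_ideal G (c *: p).
Proof.
move=> Gp; have -> : c *: p = sh (c *: unitX) p by rewrite /sh bilextZl -/(sh _ _) sh1.
exact: ideal_mul.
Qed.

Lemma ideal_linext (I : choiceType) (f : I -> QX) p :
  (forall k, k \in msupp p -> in_ideal G (f k)) -> in_ideal G (linext f p).
Proof.
move=> hf; rewrite /linext big_seq; elim/big_rec: _ => [|k x /hf fk hx]; first exact: ideal_0.
by apply: ideal_add => //; apply: ideal_scale.
Qed.

Lemma hcomp_shU n w p :
  hcomp n (sh << w >> p) = if (size w <= n)%N then sh << w >> (hcomp (n - size w) p) else 0.
Proof.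
rewrite -[p]linext_id sh_linr !linear_linext sh_linr.
case: leqP => wn; last first.
  rewrite -[RHS](linext0 _ p); apply: linext_ext => v _ /=.
  rewrite shU (hcomp_homog _ (@homog_shw w v)) gtn_eqF //.
  exact: leq_trans wn (leq_addr _ _).
apply: linext_ext => v _ /=; rewrite shU (hcomp_homog _ (@homog_shw w v)) (hcomp_homog _ (@homogU v)).
rewrite -{1}(subnKC wn) eqn_add2l.
by case: ifP => _; rewrite ?shU // /sh bilext0r.
Qed.

Lemma hcomp_ideal n p : in_ideal G p -> in_ideal G (hcomp n p).
Proof.
move=> Gp; elim: Gp n => [|g Gg|a b _ Ga _ Gb|q a _ Ga] n.
- by rewrite linear0; apply: ideal_0.
- exact: G_homog.
- by rewrite linearD /=; apply: ideal_add; [apply: Ga|apply: Gb].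
rewrite -[q]linext_id sh_linl linear_linext; apply: ideal_linext => w _ /=.
rewrite hcomp_shU; case: leqP => _; last exact: ideal_0.
exact: ideal_mul.
Qed.
End Homogeneous.

Lemma Rgen_homog G g n : (forall h, Rgen h -> G h) -> Rgen g -> in_ideal G (hcomp n g).
Proof.
move=> RG; have U w : Rgen << w >> -> in_ideal G (hcomp n << w >>).
  move=> Rw; rewrite (hcomp_homog _ (@homogU w)).
  by case: eqP => _; [apply/ideal_gen/RG|apply: ideal_0].
case=> [->|[->|[u [v [hu [hv ->]]]]]]; first by apply: U; left.
  by apply: U; right; left.
(* u and v may mix weights; by bilinearity the generator is a combination of generators on their
   monomials, which are homogeneous. *)
pose gen w z := shw w z - iotaL (stw (iinv_aux 0 w) (iinv_aux 0 z)).
have -> : sh u v - iotaL (st (iotainvL u) (iotainvL v)) = bilext gen u v.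
  rewrite st_iotainv /iotaL linear_bilext /sh !bilextE -linextBf; apply: linext_ext => w _.
  by rewrite -linextBf.
rewrite linear_bilext bilextE; apply: ideal_linext => w wu.
apply: ideal_linext => z zv /=.
have [s sE _] := h0_iw (hu _ wu); have [t tE] := h1_iw (hv _ zv).
rewrite (@hcomp_homog (size w + size z)); last first.
  rewrite /gen sE tE; apply: supportedD; first exact: homog_shw.
  by rewrite -scaleN1r; apply: supportedZ; apply: homog_iotaL_stw.
case: eqP => _; last exact: ideal_0.
apply/ideal_gen/RG; right; right; exists << w >>, << z >>; split; last split.
- by move=> x /(fsubsetP msuppU_le); rewrite inE => /eqP->; apply: hu.
- by move=> x /(fsubsetP msuppU_le); rewrite inE => /eqP->; apply: hv.
by rewrite shU st_iotainv bilextU.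
Qed.

Lemma RA_hcomp n p : RA p -> RA (hcomp n p).
Proof.
apply: hcomp_ideal => g m [Rg|->]; first by apply: Rgen_homog => // h; left.
rewrite (hcomp_homog _ (@homogU zeta2_word)).
by case: eqP => _; [apply: ideal_gen; right|apply: ideal_0].
Qed.

(** * Counit and antipode *)

Section Convolution.
Variable K : comAlgType rat.
Implicit Types f g h : word -> K.

Definition gconv f g (w : word) : K := linext2 f g (DGon_word w).
Definition epsK (w : word) : K := (w == [::])%:R.

Lemma linext_gconv f g p : linext (gconv f g) p = linext2 f g (DGon p).
Proof. by rewrite [RHS]linear_linext. Qed.

Lemma gconvA f g h w : gconv (gconv f g) h w = gconv f (gconv g h) w.
Proof.
have := congr1 (linext3 f g h) (DGonA << w >>).
by rewrite linext3_DGon_id linext3_id_DGon /DGon !linextU.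
Qed.

Lemma linext2Bl f f' g t :
  linext2 (fun w => f w - f' w) g t = linext2 f g t - linext2 f' g t.
Proof. by rewrite /linext2 -linextBf; apply: linext_ext => uv _; rewrite mulrBl. Qed.

Lemma linext2_sumr (J : Type) (r : seq J) f (E : J -> word -> K) t :
  linext2 f (fun w => \sum_(j <- r) E j w) t = \sum_(j <- r) linext2 f (E j) t.
Proof. by rewrite /linext2 -linext_sumf; apply: linext_ext => uv _; rewrite mulr_sumr. Qed.

Lemma linext2Zr c f g t : linext2 f (fun w => c *: g w) t = c *: linext2 f g t.
Proof. by rewrite /linext2 -linextZf; apply: linext_ext => uv _; rewrite scalerAr. Qed.

Lemma linext2_form_id g t : linext2 epsK g t = linext g (form_id eps t).
Proof.
rewrite /form_id linear_linext; apply: linext_ext => -[u v] _ /=.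
by rewrite linearZ /= linextU /epsK /eps; case: (u == _); rewrite ?mul1r ?mul0r ?scale1r ?scale0r.
Qed.

Lemma linext2_id_form f t : linext2 f epsK t = linext f (id_form eps t).
Proof.
rewrite /id_form linear_linext; apply: linext_ext => -[u v] _ /=.
by rewrite linearZ /= linextU /epsK /eps; case: (v == _); rewrite ?mulr1 ?mulr0 ?scale1r ?scale0r.
Qed.

Lemma epsK1 : epsK = (1 : series alphX K).
Proof. by apply/funext => w; rewrite ser1E. Qed.

Lemma epsK_character : character (A := alphX) epsK.
Proof. by split=> // u v; rewrite epsK1 qst1 !ser1E. Qed.
End Convolution.

(* Q<X> with the shuffle product. *)
Definition shalg := QX.
HB.instance Definition _ := GRing.Lmodule.on shalg.

Fact shalg_mulA : associative (sh : shalg -> shalg -> shalg).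
Proof. by move=> p q r; rewrite shA. Qed.
Fact shalg_mulDl : left_distributive (sh : shalg -> shalg -> shalg) +%R.
Proof. by move=> p q r; apply: bilextDl. Qed.
Fact shalg_oner_neq0 : (unitX : shalg) != 0.
Proof. by apply/eqP => /(congr1 (fun p : QX => p@_[::]))/eqP; rewrite mcoeffUU mcoeff0 oner_eq0. Qed.
HB.instance Definition _ := GRing.Zmodule_isComNzRing.Build shalg
  shalg_mulA shC sh1 shalg_mulDl shalg_oner_neq0.
Fact shalg_scaleAl (a : rat) (u v : shalg) : a *: (u * v) = (a *: u) * v.
Proof. exact: (esym (bilextZl shw a u v)). Qed.
HB.instance Definition _ := GRing.Lmodule_isLalgebra.Build rat shalg shalg_scaleAl.
HB.instance Definition _ := GRing.Lalgebra_isComAlgebra.Build rat shalg.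

(** The tautological character of Q<X>; pairing with it turns the counit axioms into [star1l] and
    [star1r]. *)
Definition wid (w : word) : shalg := << w >>.

Lemma wid_character : character (A := alphX) wid.
Proof.
split=> // u v; rewrite -linext_shw; apply: etrans (linext_id (shw u v)) _.
exact: (esym (shU u v)).
Qed.

Lemma form_id_DGon p : form_id eps (DGon p) = p.
Proof.
rewrite -[LHS]linext_id; apply: etrans (esym (linext2_form_id wid _)) _.
apply: etrans (linext2_DGon _ (epsK_character _) _) _.
by rewrite epsK1 star1l; apply: linext_id.
Qed.

Lemma id_form_DGon p : id_form eps (DGon p) = p.
Proof.
rewrite -[LHS]linext_id; apply: etrans (esym (linext2_id_form wid _)) _.
apply: etrans (linext2_DGon _ wid_character _) _.
by rewrite epsK1 star1r; apply: linext_id.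
Qed.

(** * Inverses for the convolution product *)

Section RightInverse.
Variable K : comAlgType rat.
Notation eps1 := (epsK K).
Implicit Types f g h : word -> K.

Lemma gconv1l g w : gconv eps1 g w = g w.
Proof. by rewrite /gconv linext2_form_id -[DGon_word w]linextU form_id_DGon linextU. Qed.

Lemma gconv1r f w : gconv f eps1 w = f w.
Proof. by rewrite /gconv linext2_id_form -[DGon_word w]linextU id_form_DGon linextU. Qed.

Variable f : word -> K.
Hypothesis f1 : f [::] = 1.

Definition shift (X : word -> K) : word -> K := fun w => gconv f X w - X w.
(* The k-th convolution power of f - eps. *)
Definition rinv_term k : word -> K := iter k shift eps1.
Lemma rinv_termS k w : rinv_term k.+1 w = gconv f (rinv_term k) w - rinv_term k w.
Proof. by []. Qed.

Definition rinv (w : word) : K := \sum_(0 <= k < (size w).+1) (-1) ^+ k *: rinv_term k w.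

Lemma gconv_local (X Y : word -> K) w :
  (forall v, (size v <= size w)%N -> X v = Y v) -> gconv f X w = gconv f Y w.
Proof.
move=> XY; apply: linext_ext => uv /DGon_word_weight uvw.
by rewrite XY // -uvw leq_addl.
Qed.

(** f - eps vanishes at the empty word, so every convolution factor uses up at least one letter. *)
Lemma rinv_term_eq0 k w : (size w < k)%N -> rinv_term k w = 0.
Proof.
elim: k w => // k IH w lt_k; rewrite rinv_termS.
rewrite -[in X in _ - X](gconv1l (rinv_term k)) /gconv -linext2Bl.
rewrite -[RHS](linext0 _ (DGon_word w)); apply: linext_ext => -[u v] /DGon_word_weight /= uvw.
case: u uvw => [|a u] /= uvw; first by rewrite f1 subrr mul0r.
rewrite IH ?mulr0 // -ltnS; apply: leq_ltn_trans lt_k.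
by rewrite -uvw addSn ltnS leq_addl.
Qed.

Lemma rinvE N w : (size w <= N)%N ->
  rinv w = \sum_(0 <= k < N.+1) (-1) ^+ k *: rinv_term k w.
Proof.
move=> wN; rewrite [RHS](big_cat_nat (n := (size w).+1)) //= [X in _ + X]big_nat_cond.
rewrite [X in _ + X]big1 ?addr0 // => k /andP[/andP[lt_k _] _].
by rewrite rinv_term_eq0 // scaler0.
Qed.

Lemma rinv_right w : gconv f rinv w = eps1 w.
Proof.
pose N := size w; pose S v := \sum_(0 <= k < N.+1) (-1) ^+ k *: rinv_term k v.
rewrite (@gconv_local _ S) => [|v /rinvE //].
rewrite /gconv /S linext2_sumr.
(* f convolved with (f - eps)^k is (f - eps)^(k+1) + (f - eps)^k, so the alternating sum
   telescopes. *)
rewrite (eq_bigr (fun k => (-1) ^+ k *: rinv_term k w - (-1) ^+ k.+1 *: rinv_term k.+1 w)).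
  rewrite -[LHS]opprK -sumrN.
  under eq_bigr => k _ do rewrite opprB.
  rewrite telescope_sumr // rinv_term_eq0 // scaler0 sub0r opprK expr0 scale1r.
  by [].
move=> k _; rewrite linext2Zr -/(gconv f _ w) rinv_termS.
by rewrite exprS mulN1r scaleNr opprK scalerBr addrC subrK.
Qed.
End RightInverse.

(** By associativity f is the right inverse of its own right inverse. *)
Lemma rinv_left (K : comAlgType rat) (f : word -> K) w : f [::] = 1 ->
  gconv (rinv f) f w = epsK K w.
Proof.
move=> f1; have r1 : rinv f [::] = 1.
  by rewrite /rinv big_nat1 expr0 scale1r.
have fE v : f v = rinv (rinv f) v.
  have E1 : gconv (rinv f) (rinv (rinv f)) = epsK K by apply/funext => z; apply: rinv_right.
  have E2 : gconv f (rinv f) = epsK K by apply/funext => z; apply: rinv_right.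
  by rewrite -(gconv1r f) -E1 -gconvA E2 gconv1l.
have -> : gconv (rinv f) f w = gconv (rinv f) (rinv (rinv f)) w by apply: gconv_local => v _; apply: fE.
exact: rinv_right.
Qed.

Definition antipode : word -> shalg := rinv wid.

Definition stable (X : word -> shalg) := forall p, RA p -> RA (linext X p).

Lemma wid_stable : stable wid.
Proof. by move=> p; have -> : linext wid p = p by exact: linext_id. Qed.

(** The coproduct sends RA to sums of tensors with one factor in RA, and RA is an ideal. *)
Lemma gconv_stable (X Y : word -> shalg) : stable X -> stable Y -> stable (gconv X Y).
Proof.
move=> sX sY p /RA_DGon; rewrite linext_gconv.
elim=> [|_ [a [b [ab ->]]]|s t _ Rs _ Rt|c s _ Rs].
- by rewrite /linext2 linear0; apply: ideal_0.
- rewrite linext2_tens; case: ab => [/sX|/sY] R; last exact: ideal_mul.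
  by rewrite mulrC; apply: ideal_mul.
- by rewrite /linext2 linearD; apply: ideal_add.
- by rewrite /linext2 linearZ; apply: ideal_scale.
Qed.

Lemma eps_RA p : RA p -> linext eps p = 0.
Proof. by move=> Rp; rewrite linext_eps; apply: (Id_proper (i := RA_ideal)). Qed.

Lemma linext_epsK p : linext (epsK shalg) p = linext eps p *: unitX.
Proof.
rewrite /linext scaler_suml; apply: eq_bigr => w _; rewrite -scalerA; congr (_ *: _).
by rewrite /epsK /eps; case: (w == _); rewrite ?scale1r ?scale0r.
Qed.

Lemma rinv_term_stable k : stable (rinv_term wid k).
Proof.
elim: k => [|k IH] p Rp.
  by rewrite [linext _ _]linext_epsK eps_RA // scale0r; apply: ideal_0.
rewrite /rinv_term iterS -/(rinv_term wid k) /shift linextBf -scaleN1r.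
apply: ideal_add; first exact: gconv_stable wid_stable IH _ Rp.
by apply: ideal_scale; apply: IH.
Qed.

(** The number of terms in [rinv] depends on the word; bounding it by the longest word of p gives
    one finite combination of stable maps. *)
Lemma antipode_stable : stable antipode.
Proof.
move=> p Rp; pose N := \max_(w <- msupp p) size w.
have -> : linext antipode p =
    linext (fun w => \sum_(0 <= k < N.+1) (-1) ^+ k *: rinv_term wid k w) p.
  apply: linext_ext => w wp; apply: rinvE => //.
  by rewrite /N (big_rem w) //= leq_maxl.
rewrite linext_sumf; elim/big_rec: _ => [|k x _ Rx]; first exact: ideal_0.
by apply: ideal_add => //; rewrite linextZf; apply: ideal_scale; apply: rinv_term_stable.
Qed.

Lemma mul_antipode_id p : mul_s_id antipode (DGon p) = linext eps p *: unitX.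
Proof.
rewrite -linext_epsK -[LHS]/(linext2 (antipode : word -> shalg) wid (DGon p)) -linext_gconv.
by apply: linext_ext => w _; apply: (@rinv_left shalg wid w erefl).
Qed.

Lemma mul_id_antipode p : mul_id_s antipode (DGon p) = linext eps p *: unitX.
Proof.
rewrite -linext_epsK -[LHS]/(linext2 wid (antipode : word -> shalg) (DGon p)) -linext_gconv.
by apply: linext_ext => w _; apply: (@rinv_right shalg wid erefl).
Qed.

Lemma RA0 p q : p = q -> RA (p - q).
Proof. by move=> ->; rewrite subrr; apply: ideal_0. Qed.

Theorem mainTheorem1 :
  (* ---------------- (i) ---------------- *)
  (* Delta is well defined on A^f (and A^f (x) A^f) *)
  (forall p : QX, RA p -> ker2 RA RA (DGon p)) /\
  (* (A^f, ш) is a commutative unital algebra *)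
  (forall p q : QX, RA (sh p q - sh q p)) /\
  (forall p q r : QX, RA (sh (sh p q) r - sh p (sh q r))) /\
  (forall p : QX, RA (sh unitX p - p)) /\
  (* weight grading: the ideal is homogeneous, product and coproduct
     preserve weight *)
  (forall (n : nat) (p : QX), RA p -> RA (hcomp n p)) /\
  (forall (u v w : word), w \in msupp (shw u v) -> size w = (size u + size v)%N) /\
  (forall (w : word) (uv : word * word), uv \in msupp (DGon << w >>) ->
      (size uv.1 + size uv.2)%N = size w) /\
  (* Delta is an algebra morphism A^f -> A^f (x) A^f *)
  (forall p q : QX, ker2 RA RA (DGon (sh p q) - sh2 (DGon p) (DGon q))) /\
  ker2 RA RA (DGon unitX - tens unitX unitX) /\
  (* Delta is coassociative *)
  (forall p : QX, ker3 RA RA RA (DGon_id (DGon p) - id_DGon (DGon p))) /\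
  (* counit and antipode exist (Hopf algebra); ii) the same counit for the
     coaction *)
  (exists (e : word -> rat) (s : word -> QX),
     (* counit: well defined algebra morphism A^f -> Q *)
     (forall p : QX, RA p -> linform e p = 0) /\
     (forall p q : QX, linform e (sh p q) = linform e p * linform e q) /\
     linform e unitX = 1 /\
     (* counit axioms *)
     (forall p : QX, RA (form_id e (DGon p) - p)) /\
     (forall p : QX, RA (id_form e (DGon p) - p)) /\
     (* antipode: well-defined linear map A^f -> A^f with the antipode axioms *)
     (forall p : QX, RA p -> RA (linext s p)) /\
     (forall p : QX, RA (mul_s_id s (DGon p) - linform e p *: unitX)) /\
     (forall p : QX, RA (mul_id_s s (DGon p) - linform e p *: unitX)) /\
     (* ---------------- (ii) counitality of the coaction ---------------- *)
     (forall p : QX, Rf (form_id e (DGon p) - p))) /\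
  (* ---------------- (ii) ---------------- *)
  (* independence of the lift: Delta_Gon maps R into the kernel of
     alpha o zeta^f (x) zeta^f *)
  (forall p : QX, Rf p -> ker2 RA Rf (DGon p)) /\
  (* algebra morphism Z^f -> A^f (x) Z^f *)
  (forall p q : QX, ker2 RA Rf (DGon (sh p q) - sh2 (DGon p) (DGon q))) /\
  ker2 RA Rf (DGon unitX - tens unitX unitX) /\
  (* coassociativity of the coaction: (Delta (x) id) o Delta_Gon =
     (id (x) Delta_Gon) o Delta_Gon in A^f (x) A^f (x) Z^f *)
  (forall p : QX, ker3 RA RA Rf (DGon_id (DGon p) - id_DGon (DGon p))).
Proof.
have Z2 I1 I2 s t : s = t -> ker2 I1 I2 (s - t) by move=> ->; rewrite subrr; apply: span_0.
have Z3 I1 I2 I3 s t : s = t -> ker3 I1 I2 I3 (s - t).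
  by move=> ->; rewrite subrr; apply: span_0.
split; first exact: RA_DGon.
split; first by move=> p q; apply/RA0/shC.
split; first by move=> p q r; apply/RA0/shA.
split; first by move=> p; apply/RA0/sh1.
split; first exact: RA_hcomp.
split; first by move=> u v w; apply: homog_shw.
split; first by move=> w uv; rewrite /DGon linextU; apply: DGon_word_weight.
split; first by move=> p q; apply/Z2/DGon_sh.
split; first by apply/Z2/DGon_unit.
split; first by move=> p; apply/Z3/DGonA.
split; last first.
  split; first exact: Rf_DGon.
  split; first by move=> p q; apply/Z2/DGon_sh.
  split; first by apply/Z2/DGon_unit.
  by move=> p; apply/Z3/DGonA.
exists eps, antipode; split; first exact: eps_RA.
split; first by move=> p q; exact: (linext_sh (K := rat^o) p q eps_character).
split; first exact: (linextU eps [::]).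
split; first by move=> p; apply/RA0/form_id_DGon.
split; first by move=> p; apply/RA0/id_form_DGon.
split; first exact: antipode_stable.
split; first by move=> p; apply/RA0/mul_antipode_id.
split; first by move=> p; apply/RA0/mul_id_antipode.
by move=> p; rewrite form_id_DGon subrr; apply: ideal_0.
Qed.
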